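(* Assume that $\mathbb E\sum_{i=1}^N\exp(\psi_i)=1$, $\mathbb E\sum_{i=1}^N\psi_i\exp(\psi_i)<0$ and $\mathbb E\Big[\Big(\sum_{i=1}^N\exp(\psi_i)\Big)\log^+\Big(\sum_{i=1}^N\exp(\psi_i)\Big)\Big]<\infty$, and that the function $\Lambda_\psi$ is finite on an open convex subset $\mathcal D_{\Lambda_\psi}$ of $\mathbb R^d$ containing $0$. Then with probability 1, for $\nu$-almost every $t\in\partial\mathsf T$, $\mathrm{LD}(\Lambda_\psi)$ holds at $t$. Thus, with probability 1, $\nu$ is supported on $$E(X,\beta_{\Lambda_\psi},\mathrm{LD}(\Lambda_\psi))=\Big\{t\in\partial\mathsf T:\lim_{n\to\infty}\frac{S_nX(t)}n=\beta_{\Lambda_\psi}\text{ and }\mathrm{LD}(\Lambda_\psi)\text{ holds at }t\Big\}.$$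
   Context: $\mathbb N=\{1,2,\dots\}$, $d\ge 1$; $\langle\cdot|\cdot\rangle$ is the Euclidean inner product, $B(x,r)$ the closed Euclidean ball. For $f:\mathbb R^d\to\mathbb R\cup\{\infty\}$, $f\not\equiv\infty$, set $f^*(\alpha)=\inf\{f(q)-\langle q|\alpha\rangle:q\in\mathbb R^d\}$. On a probability space $(\Omega,\mathcal A,\mathbb P)$, $(N,(X_i,\psi_i)_{i\ge1})$ is a random vector with values in $\mathbb N\times(\mathbb R^d\times\mathbb R)^{\mathbb N}$, with $\mathbb E(N)>1$ and $\mathbb P(N\ge1)=1$, and $\{(N_u,(X_{ui},\psi_{ui})_{i\ge1})\}_u$ is a family of independent copies of it indexed by the finite words $u\in\bigcup_{n\ge0}\mathbb N^n$ ($\mathbb N^0=\{\epsilon\}$). $\mathsf T_0=\{\epsilon\}$, $\mathsf T_n=\{ui:u\in\mathsf T_{n-1},1\le i\le N_u\}$, $\mathsf T=\bigcup_n\mathsf T_n$; $\partial\mathsf T$ is the set of infinite words all of whose finite prefixes are in $\mathsf T$. For $t=t_1t_2\cdots\in\partial\mathsf T$, $S_nX(t)=\sum_{k=1}^nX_{t_1\cdots t_k}$ ($S_0X=0$). Mandelbrot measure: for a finite word $u$, put $\mathsf T_0(u)=\{u\}$, $\mathsf T_n(u)=\{vi:v\in\mathsf T_{n-1}(u),1\le i\le N_v\}$, and $Y_n(u)=\sum_{v_1\cdots v_n\in\mathbb N^n:\,uv_1\cdots v_n\in\mathsf T_n(u)}\exp(\psi_{uv_1}+\cdots+\psi_{uv_1\cdots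 v_n})$. Under the assumptions on $\psi$, $Y_n(u)$ is a uniformly integrable martingale of mean $1$ with an almost surely positive limit $Y(u)$. The random measure $\nu=\nu_\omega$ on $\mathbb N^{\mathbb N}$ is defined by $\nu([u])=\mathbf 1_{\{u\in\mathsf T\}}\exp(\psi_{u_1}+\psi_{u_1u_2}+\cdots+\psi_{u_1\cdots u_n})Y(u)$ for $u=u_1\cdots u_n$, where $[u]$ is the cylinder $u\cdot\mathbb N^{\mathbb N}$. $\Lambda_\psi(\lambda)=\log\mathbb E\big(\sum_{i=1}^N\exp(\langle\lambda|X_i\rangle+\psi_i)\big)\in\mathbb R\cup\{\infty\}$, $\lambda\in\mathbb R^d$; $\beta_{\Lambda_\psi}=\nabla\Lambda_\psi(0)=\mathbb E\big(\sum_{i=1}^NX_i\exp(\psi_i)\big)$. Large deviations property. Let $\widetilde k=(k(n))_{n\in\mathbb N}$ be an increasing sequence of positive integers. For $t\in\partial\mathsf T$ let $\mu^t_{\widetilde k,n}=\frac1{nk(n)}\sum_{j=0}^{nk(n)-1}\delta_{(S_{j+n}X(t)-S_jX(t))/n}$ and $\Lambda^t_{\widetilde k,n}(\lambda)=\log\int_{\mathbb R^d}e^{n\langle\lambda|x\rangle}\,d\mu^t_{\widetilde k,n}(x)$. With $\Lambda=\Lambda_\psi$ and $\mathcal D=\mathcal D_{\Lambda_\psi}$, $\mathrm{LD}(\Lambda,\widetilde k)$ holds at $t$ if: (1) for all $\lambda\in\mathcal D$ with $\liminf_n\frac{\log k(n)}n>-\Lambda^*(\nabla\Lambda(\lambda))$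 one has $\lim_n\frac1n\Lambda^t_{\widetilde k,n}(\lambda)=\Lambda(\lambda)$, and hence (Gärtner–Ellis) $\lim_{\varepsilon\to0}\lim_n\frac1n\log\mu^t_{\widetilde k,n}(B(\nabla\Lambda(\lambda),\varepsilon))=\Lambda^*(\nabla\Lambda(\lambda))$; (2) for all $\lambda\in\mathcal D$ with $\limsup_n\frac{\log k(n)}n<-\Lambda^*(\nabla\Lambda(\lambda))$ there is $\varepsilon>0$ such that for $n$ large enough no $0\le j\le nk(n)-1$ satisfies $\frac{S_{j+n}X(t)-S_jX(t)}n\in B(\nabla\Lambda(\lambda),\varepsilon)$; (3) if $\lambda\in\mathcal D$, $\lim_n\frac{\log k(n)}n=-\Lambda^*(\nabla\Lambda(\lambda))$ and $\theta\ge0\mapsto\Lambda(\theta\lambda)$ is strictly convex at $1$ (not affine on any neighbourhood of $1$), then for all $\theta\ge1$, $\lim_n\frac1n\Lambda^t_{\widetilde k,n}(\theta\lambda)=\Lambda(\lambda)+(\theta-1)\langle\lambda|\nabla\Lambda(\lambda)\rangle$. $\mathrm{LD}(\Lambda)$ holds at $t$ if $\mathrm{LD}(\Lambda,\widetilde k)$ holds at $t$ for all $\widetilde k\in\boldsymbol{\widetilde K}$, where $\boldsymbol{\widetilde K}$ is the set of increasing sequences $\widetilde k\in\mathbb N^{\mathbb N}$ such that $\lim_n\frac{\log k(n)}n$ exists. *)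

(* Defs.v *)
From HB Require Import structures.
From mathcomp Require Export all_boot all_order all_algebra.
From mathcomp Require Export all_classical all_reals all_analysis.

Set Implicit Arguments.
Unset Strict Implicit.
Unset Printing Implicit Defensive.

Export Order.TTheory GRing.Theory Num.Theory.
Export numFieldNormedType.Exports.

Local Open Scope classical_set_scope.
Local Open Scope ring_scope.

(* Letters are 0-based: i : nat encodes the positive integer i + 1, so that
   the children of u are the words ui with 0 <= i < N_u. *)
Notation word := (seq nat) (only parsing).
Notation ray := (nat -> nat) (only parsing).

Section Euclidean.
Context {R : realType} {d : nat}.
Implicit Types (x y : 'rV[R]_d) (f : 'rV[R]_d -> \bar R).

Definition dot x y : R := \sum_(j < d) x ord0 j * y ord0 j.

(* The norm of the library on 'rV[R]_d is the sup norm. *)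
Definition eball x (r : R) : set 'rV[R]_d :=
  [set y | Num.sqrt (dot (y - x) (y - x)) <= r].

(* f^*(a) = inf_q (f(q) - <q|a>), a concave function of a. *)
Definition conjugate f (a : 'rV[R]_d) : \bar R :=
  ereal_inf (range (fun q => f q - (dot q a)%:E)%E).

Definition gradient f x : 'rV[R]_d :=
  \row_(j < d) 'D_(delta_mx ord0 j) (fine \o f) x.

End Euclidean.

(* Values of the random vector (N, (X_i, psi_i)_i). *)
Definition offspring (R : realType) (d : nat) : Type :=
  (nat * (nat -> 'rV[R]_d * R))%type.

(* The coordinate sets, which generate the product sigma-algebra. *)
Definition offspring_coord (R : realType) (d : nat) :
    set (set (offspring R d)) :=
  [set A | [\/ exists B : set nat, A = [set v : offspring R d | B v.1],
    exists (i : nat) (j : 'I_d), exists2 B : set R, measurable B &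
      A = [set v : offspring R d | B ((v.2 i).1 ord0 j)] |
    exists i : nat, exists2 B : set R, measurable B &
      A = [set v : offspring R d | B (v.2 i).2]]].

Notation offspringType R d := (g_sigma_algebraType (@offspring_coord R d)).

Section Tree.
Context {R : realType} {d : nat}.
Implicit Types (N : word -> nat) (X : word -> 'rV[R]_d) (psi : word -> R).
Implicit Types (u : word) (t : ray) (n : nat).

(* T_n(u), as a duplicate-free list. *)
Definition descendants N u n : seq word :=
  iter n (fun T => [seq rcons v i | v <- T, i <- iota 0 (N v)]) [:: u].

Definition tree N : set word :=
  [set u | exists n, u \in descendants N [::] n].

Definition boundary N : set ray := [set t | forall n, tree N (mkseq t n)].

Definition walk X t n : 'rV[R]_d := \sum_(k < n) X (mkseq t k.+1).

(* Y_n(u); for w = u v_1 ... v_n the inner sum is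
   psi_(u v_1) + ... + psi_(u v_1 ... v_n). *)
Definition Ymart N psi u n : R :=
  \sum_(w <- descendants N u n)
    expR (\sum_(size u <= k < size w) psi (take k.+1 w)).

Definition Ylim N psi u : R := limn (Ymart N psi u).

Definition mandelbrot_mass N psi u : R :=
  \1_(tree N) u * expR (\sum_(k < size u) psi (take k.+1 u)) * Ylim N psi u.

End Tree.

Definition cylinder (u : word) : set ray := [set t | mkseq t (size u) = u].

Notation rayType := (g_sigma_algebraType (range cylinder)).

Section LargeDeviations.
Context {R : realType} {d : nat}.
Local Open Scope ereal_scope.

Notation borel_rV := (g_sigma_algebraType (@open 'rV[R]_d)).

(* Below S n stands for S_n X(t); only the terms k n with n >= 1 of a sequence
   k matter. *)
Implicit Types (S : nat -> 'rV[R]_d) (k : nat -> nat) (lambda : 'rV[R]_d).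
Implicit Types (L : 'rV[R]_d -> \bar R) (D : set 'rV[R]_d).

Definition increment S n j : 'rV[R]_d := (n%:R^-1 *: (S (j + n)%N - S j))%R.

Definition empirical S k n : set borel_rV -> \bar R :=
  mscale ((n * k n)%:R^-1)%:nng%R
    (msum (fun j => \d_(increment S n j : borel_rV)) (n * k n)).

HB.instance Definition _ S k n := Measure.on (empirical S k n).

Definition empirical_logmgf S k n lambda : \bar R :=
  lne (\int[empirical S k n]_x (expR (n%:R * dot lambda x))%:E).

Definition growth k n : \bar R := (ln (k n)%:R / n%:R)%:E.

Definition increasing_pos k : Prop :=
  forall n, (0 < n)%N -> (0 < k n)%N /\ (k n < k n.+1)%N.

Definition scaled_log_ball S k (x : 'rV[R]_d) (e : R) n : \bar R :=
  (n%:R^-1)%:E * lne (empirical S k n (eball x e)).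

Definition LD1 L D S k : Prop :=
  forall lambda, D lambda ->
  - conjugate L (gradient L lambda) < limn_einf (growth k) ->
  [/\ (n%:R^-1)%:E * empirical_logmgf S k n lambda @[n --> \oo] --> L lambda,
      \forall e \near 0^'+, cvgn (scaled_log_ball S k (gradient L lambda) e) &
      limn (scaled_log_ball S k (gradient L lambda) e) @[e --> 0^'+] -->
        conjugate L (gradient L lambda)].

Definition LD2 L D S k : Prop :=
  forall lambda, D lambda ->
  limn_esup (growth k) < - conjugate L (gradient L lambda) ->
  exists2 e : R, (0 < e)%R &
    \forall n \near \oo, forall j, (j < n * k n)%N ->
      ~ eball (gradient L lambda) e (increment S n j).

Definition affine_near1 L lambda : Prop :=
  exists a b : R,
    \forall theta \near (1%R : R), L (theta *: lambda) = (a + b * theta)%:E.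

Definition LD3 L D S k : Prop :=
  forall lambda, D lambda ->
  growth k n @[n --> \oo] --> - conjugate L (gradient L lambda) ->
  ~ affine_near1 L lambda ->
  forall theta : R, (1 <= theta)%R ->
  (n%:R^-1)%:E * empirical_logmgf S k n (theta *: lambda) @[n --> \oo] -->
    L lambda + ((theta - 1) * dot lambda (gradient L lambda))%:E.

Definition LDk L D S k : Prop := [/\ LD1 L D S k, LD2 L D S k & LD3 L D S k].

(* The limit of log k(n) / n is taken in [0, +oo]. *)
Definition LD L D S : Prop :=
  forall k, increasing_pos k -> cvgn (growth k) -> LDk L D S k.

End LargeDeviations.

Section Branching.
Context {disp : measure_display} {Omega : measurableType disp} {R : realType}.
Context {d : nat}.
Variable P : probability Omega R.
Local Open Scope ereal_scope.

Definition family_at (N : word -> Omega -> nat)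
    (X : word -> Omega -> 'rV[R]_d) (psi : word -> Omega -> R)
    (u : word) (w : Omega) : offspringType R d :=
  (N u w, fun i => (X (rcons u i) w, psi (rcons u i) w)).

Definition independent_copies (V : Omega -> offspringType R d)
    (W : word -> Omega -> offspringType R d) : Prop :=
  [/\ forall u, measurable_fun setT (W u),
      forall u (A : set (offspringType R d)), measurable A ->
        P (W u @^-1` A) = P (V @^-1` A) &
      forall (s : seq word) (A : word -> set (offspringType R d)),
        uniq s -> (forall u, measurable (A u)) ->
        P (\bigcap_(u in [set` s]) (W u @^-1` A u)) =
        \prod_(u <- s) P (W u @^-1` A u)].

Definition Lambda (V : Omega -> offspringType R d) (lambda : 'rV[R]_d) :
    \bar R :=
  lne 'E_P[fun w => (\sum_(i < (V w).1)
    expR (dot lambda ((V w).2 i).1 + ((V w).2 i).2))%R].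

Definition beta (V : Omega -> offspringType R d) : 'rV[R]_d :=
  gradient (Lambda V) 0.

(* This determines nu almost surely, the cylinders being a pi-system that
   generates the sigma-algebra of rayType. *)
Definition is_mandelbrot_measure (N : word -> Omega -> nat)
    (psi : word -> Omega -> R)
    (nu : Omega -> {measure set rayType -> \bar R}) : Prop :=
  {ae P, forall w, forall u : word,
    nu w (cylinder u) = (mandelbrot_mass (N ^~ w) (psi ^~ w) u)%:E}.

End Branching.

(* E(X, b, LD(L)) for a given labelling of the words. *)
Definition level_set {R : realType} {d : nat} (N : word -> nat)
    (X : word -> 'rV[R]_d) (b : 'rV[R]_d) (L : 'rV[R]_d -> \bar R)
    (D : set 'rV[R]_d) : set ray :=
  [set t | [/\ boundary N t,
    n%:R^-1 *: walk X t n @[n --> \oo] --> b & LD L D (walk X t)]].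

(* Main.v *)
(* Only upper bounds for [nu] are needed.  Let [rho] be the law of i.i.d. letters
   drawn from f |-> E (sum_(i < N) e^(psi_i) f(X_i)), whose log-Laplace transform
   is Lambda_psi.  By the many-to-one formula and Fatou's lemma, the expected
   [nu]-mass of the rays whose labels satisfy a finite-horizon event is at most the
   [rho]-probability of that event.  Hence, by Borel-Cantelli, properties of paths
   whose failures are summable under [rho] hold almost surely at [nu]-almost every
   ray, and only the i.i.d. walk has to be studied.

   The n k(n) windows of length n split into n families of k(n) independent
   ones, so Chernoff bounds control, for all k simultaneously, from above the
   sums of e^<q|.> over the windows and the numbers of windows in a ball, and from
   below these numbers as soon as k exceeds the inverse probability of the ball.
   The ball probabilities have exponential rates by superadditivity, compared with
   the conjugate of Lambda_psi by exponential tilting.  Continuity of Lambda_psi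
   and of the rates in the radius reduces everything to rational parameters, and
   the clauses of LD follow by deterministic convexity arguments on each path. *)

From HB Require Import structures.
From mathcomp Require Import finmap measurable_realfun ring lra.
Require Import Defs.

Set Implicit Arguments.
Unset Strict Implicit.
Unset Printing Implicit Defensive.

Local Open Scope classical_set_scope.
Local Open Scope ring_scope.

(** * Laws of i.i.d. paths *)

(** The almost sure event must be fixed before the sequence k is chosen among uncountably many.
    Hence bounds are uniform in the number k of blocks; window sums being monotone in k, powers of
    two suffice, but failures must be summable over both n and m, where k is about 2^m. A first
    moment bound for a sum gives only exp(-n e), whatever m. The decay in m comes from moments of
    order 1 + s, for exponentials finite because the domain is open. For lower bounds on counts, k
    above the inverse probability makes the expected number of hits exponentially large, so that
    Chernoff bounds decay in m too.

    The first clause of LD asks for a limit at every small radius around a point that is in general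
    irrational. Sandwiching between rational balls works only if the rate has no jump at that
    radius; midpoint concavity of the rate in the radius, a consequence of superadditivity, excludes
    jumps.

    In the critical case of the third clause, lower bounds come from the parameters s lambda with s
    < 1. Their rate is strictly smaller unless equality holds in Jensen's inequality, which would
    make Lambda_psi affine on a whole line. *)

Definition path_coord d (T : measurableType d) : set (set (nat -> T)) :=
  [set A | exists (k : nat), exists2 B : set T, measurable B & A = [set x | B (x k)]].

Notation pathType T := (g_sigma_algebraType (@path_coord _ T)).

Section Paths.
Context {d : measure_display} {T : measurableType d}.
Implicit Types (x : pathType T).

Lemma measurable_coord k : measurable_fun setT (fun x : pathType T => x k).
Proof.
move=> _ B mB; rewrite setTI; apply: sub_sigma_algebra.
by exists k, B.
Qed.

Lemma measurable_path d' (aT : measurableType d') (f : aT -> pathType T) :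
  (forall k, measurable_fun setT (fun a => f a k)) -> measurable_fun setT f.
Proof.
move=> mf; apply: (@measurability _ _ _ (pathType T) setT f (@path_coord _ T)) => //.
move=> _ [_ [k [B mB ->]] <-].
by have := mf k measurableT B mB.
Qed.

Definition consp (p : T * pathType T) : pathType T :=
  fun k => if k is k'.+1 then p.2 k' else p.1.

Lemma measurable_consp : measurable_fun setT consp.
Proof.
apply: measurable_path => -[|k] /=; first exact: measurable_fst.
exact: (measurableT_comp (measurable_coord k) measurable_snd).
Qed.

Definition pshift a x : pathType T := fun k => x (a + k)%N.

Lemma measurable_pshift a : measurable_fun setT (pshift a : pathType T -> pathType T).
Proof. by apply: measurable_path => k; exact: measurable_coord. Qed.

(** Words of any length are encoded as infinite paths padded with the constant [z], so that all
    finite horizons live on one measurable space. *)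
Definition trunc (z : T) a x : pathType T := fun k => if (k < a)%N then x k else z.

Lemma measurable_trunc z a :
  measurable_fun setT (trunc z a : pathType T -> pathType T).
Proof.
apply: measurable_path => k; rewrite /trunc.
by case: (k < a)%N; [exact: measurable_coord|exact: measurable_cst].
Qed.

Definition rect (A : nat -> set T) : set (pathType T) := [set x | forall k, A k (x k)].

Lemma measurable_rect (A : nat -> set T) : (forall k, measurable (A k)) -> measurable (rect A).
Proof.
move=> mA; rewrite (_ : rect A = \bigcap_k ((fun x : pathType T => x k) @^-1` A k)).
  by apply: bigcap_measurable => // k _; rewrite -[X in measurable X]setTI; exact: measurable_coord.
by apply/seteqP; split=> x; [move=> h k _; exact: (h k)|move=> h k; exact: (h k I)].
Qed.

(** Boxes constraining every coordinate form a pi-system containing the generating sets; finiteness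
    of [m1] allows the exhausting sequence to be constantly [setT]. *)
Lemma path_measure_unique (R : realType) (m1 m2 : {measure set (pathType T) -> \bar R}) :
  (forall A : nat -> set T, (forall k, measurable (A k)) -> m1 (rect A) = m2 (rect A)) ->
  (m1 setT < +oo)%E ->
  forall A : set (pathType T), measurable A -> m1 A = m2 A.
Proof.
move=> e foo.
have rT : rect (fun=> setT) = setT by apply/seteqP; split.
apply: (measure_unique [set B | exists2 A : nat -> set T, (forall k, measurable (A k)) & B = rect A] (fun=> setT)).
- apply/seteqP; split; apply: smallest_sub.
  + exact: smallest_sigma_algebra.
  + move=> _ [k [B mB ->]]; apply: sub_sigma_algebra.
    exists (fun l => if l == k then B else setT).
      by move=> l; case: eqP.
    apply/seteqP; split=> x /=; first by move=> xB l; case: eqP => [->|].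
    by move=> /(_ k); rewrite eqxx.
  + exact: sigma_algebra_measurable.
  + by move=> _ [A mA ->]; exact: measurable_rect.
- move=> _ _ [A mA ->] [B mB ->]; exists (fun k => A k `&` B k) => [k|].
    exact: measurableI.
  apply/seteqP; split=> x /=; first by move=> [h1 h2] k; split.
  by move=> h; split=> k; case: (h k).
- by move=> _; exists (fun=> setT).
- by apply/seteqP; split=> // x _; exists 0%N.
- by move=> _ [A mA ->]; exact: e.
- by [].
Qed.

End Paths.

Lemma measure_integral_indic d (T : measurableType d) (R : realType)
    (m : {measure set T -> \bar R}) (A : set T) :
  measurable A -> m A = (\int[m]_x (\1_A x)%:E)%E.
Proof. by move=> mA; rewrite integral_indic// setIT. Qed.

Section Rho.
Context {d : measure_display} {T : measurableType d} {R : realType}.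
Variables (mu : probability T R) (z : T).
Local Open Scope ereal_scope.

Section step.
Variable p : probability (pathType T) R.

HB.instance Definition _ := isMeasurableFun.Build _ _ _ _ (@consp _ T) measurable_consp.

Definition consm : probability (pathType T) R :=
  distribution (mu \x p)%E (@consp _ T).

End step.

(** The law of n independent letters followed by the padding [z]. Each step prepends one letter, so
    only binary products of probabilities occur. *)
Fixpoint rho (n : nat) : probability (pathType T) R :=
  if n is n'.+1 then consm (rho n') else (\d_((fun=> z) : pathType T)).

Lemma integral_rhoS n (f : pathType T -> \bar R) : measurable_fun setT f ->
  (forall x, 0 <= f x) ->
  \int[rho n.+1]_x f x = \int[mu]_x \int[rho n]_y f (consp (x, y)).
Proof.
move=> mf f0; rewrite [LHS](_ : _ = \int[(mu \x rho n)%E]_p f (consp p)).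
  rewrite fubini_tonelli1//.
    by apply: measurableT_comp => //; exact: measurable_consp.
by rewrite /= /consm ge0_integral_distribution.
Qed.

Lemma integral_rho0 (f : pathType T -> \bar R) : measurable_fun setT f ->
  (forall x, 0 <= f x) -> \int[rho 0]_x f x = f (fun=> z).
Proof. by move=> mf f0; rewrite /= integral_dirac//= diracT mul1e. Qed.

(** Induction on [a]: Tonelli isolates the first letter, and truncation commutes with prepending it.
    All later independence of blocks is derived from this identity. *)
Lemma integral_rho_split a b (F G : pathType T -> \bar R) :
  measurable_fun setT F -> (forall x, 0 <= F x) ->
  measurable_fun setT G -> (forall x, 0 <= G x) ->
  \int[rho (a + b)]_x (F (trunc z a x) * G (pshift a x)) =
  \int[rho a]_x F x * \int[rho b]_x G x.
Proof.
move=> + + mG G0; elim: a F => [|a IH] F mF F0.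
  rewrite add0n integral_rho0// -ge0_integralZl//.
have mFc x : measurable_fun setT (fun y : pathType T => F (consp (x, y))).
  apply: (measurableT_comp mF); apply: (measurableT_comp measurable_consp).
  exact: pair1_measurable.
have mI : measurable_fun setT (fun x => \int[rho a]_y F (consp (x, y))).
  apply: (@measurable_fun_fubini_tonelli_F _ _ _ _ _ (rho a) (F \o consp)) => //.
    by apply: measurableT_comp => //; exact: measurable_consp.
  by move=> p; exact: F0.
rewrite addSn !integral_rhoS//; last 2 first.
- apply: emeasurable_funM; apply: measurableT_comp => //.
    exact: measurable_trunc.
  exact: measurable_pshift.
- by move=> x; rewrite mule_ge0.
rewrite -ge0_integralZr//.
- apply: eq_integral => x _; rewrite -IH//; apply: eq_integral => y _.
  by have -> : trunc z a.+1 (consp (x, y)) = consp (x, trunc z a y) by apply/funext => -[|k].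
- by move=> x _; exact: integral_ge0.
- exact: integral_ge0.
Qed.

(** The indicator records whether the padding satisfies the constraints beyond [n]. *)
Lemma rho_rect n (A : nat -> set T) : (forall k, measurable (A k)) ->
  rho n (rect A) = (\prod_(k < n) mu (A k)) *
    (\1_(rect (fun k => A (n + k)%N)) (fun=> z))%:E.
Proof.
elim: n A => [|n IH] A mA.
  by rewrite big_ord0 mul1e /= diracE indicE.
have mrA := measurable_rect mA.
rewrite measure_integral_indic// integral_rhoS//; last exact: measurableT_comp.
rewrite [LHS](_ : _ = \int[mu]_x ((\1_(A 0%N) x)%:E *
    rho n (rect (fun k => A k.+1)))).
  rewrite ge0_integralZr//; last exact: measurableT_comp.
  by rewrite -measure_integral_indic// IH// big_ord_recl muleA.
apply: eq_integral => x _.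
rewrite [in RHS]measure_integral_indic; last exact: measurable_rect.
rewrite -ge0_integralZl//; last first.
  by apply: measurableT_comp => //; apply: measurable_indic; exact: measurable_rect.
apply: eq_integral => y _; rewrite -EFinM; congr (_%:E).
rewrite !indicE -natrM mulnb; congr (_%:R); congr nat_of_bool.
apply/idP/andP; rewrite !inE.
  by move=> h; split; [exact: (h 0%N)|move=> k; exact: (h k.+1)].
by move=> [h0 h] [|k] //; exact: h.
Qed.

End Rho.

(** * The many-to-one formula *)

Section ge0_measurable_ind.
Context {d : measure_display} {T : measurableType d} {R : realType}.
Local Open Scope ereal_scope.
Variable Q : (T -> \bar R) -> Prop.
Hypothesis Q0 : Q (cst 0).
Hypothesis Qindic : forall A : set T, measurable A -> Q (fun x => (\1_A x)%:E).
Hypothesis QD : forall f g, measurable_fun setT f -> measurable_fun setT g ->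
  (forall x, 0 <= f x) -> (forall x, 0 <= g x) -> Q f -> Q g -> Q (f \+ g).
Hypothesis QZ : forall f (c : R), measurable_fun setT f ->
  (forall x, 0 <= f x) -> (0 <= c)%R -> Q f -> Q (fun x => c%:E * f x).
Hypothesis Qlim : forall f : nat -> T -> \bar R,
  (forall n, measurable_fun setT (f n)) -> (forall n x, 0 <= f n x) ->
  (forall x, nondecreasing_seq (f ^~ x)) ->
  (forall n, Q (f n)) -> Q (fun x => limn (f ^~ x)).

Import HBNNSimple.

(** The standard passage from indicators to simple functions and then to increasing limits, as an
    induction principle. *)
Lemma ge0_measurable_ind f : measurable_fun setT f -> (forall x, 0 <= f x) -> Q f.
Proof.
move=> mf f0; pose f_ := nnsfun_approx measurableT mf.
have -> : f = (fun x => limn (fun n => (f_ n x)%:E)).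
  apply/funext => x; apply/esym/cvg_lim => //.
  exact: cvg_nnsfun_approx.
apply: (Qlim (f := fun n x => (f_ n x)%:E)).
- by move=> n; apply/measurable_EFinP.
- by move=> n x; rewrite lee_fin.
- by move=> x m n mn; rewrite lee_fin; exact/lefP/nd_nnsfun_approx.
move=> n; set h := f_ n.
have -> : (fun x => (h x)%:E) =
    (fun x => \sum_(r <- fset_set (range h)) (r%:E * (\1_(h @^-1` [set r]) x)%:E)).
  by apply/funext => x; rewrite [in LHS]fimfunE -fsumEFin// fsbig_finite.
have hr (r : R) : r \in fset_set (range h) -> (0 <= r)%R.
  by rewrite in_fset_set// in_setE => -[x _ <-].
have mI r : measurable_fun setT (fun x => (\1_(h @^-1` [set r]) x)%:E : \bar R).
  by apply/measurable_EFinP; exact: measurable_indic.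
have : {subset (fset_set (range h) : seq R) <= [pred r | 0 <= r]%R}.
  by move=> r /hr.
elim: (fset_set (range h) : seq R) => [_|r s IH rs].
  by rewrite (_ : (fun _ => _) = cst 0)//; apply/funext => x; rewrite big_nil.
have r0 : (0 <= r)%R by have := rs r; rewrite !inE eqxx; exact.
have {}rs : {subset s <= [pred r | 0 <= r]%R}.
  by move=> y ys; have := rs y; rewrite !inE ys orbT; exact.
rewrite (_ : (fun _ => _) = (fun x => r%:E * (\1_(h @^-1` [set r]) x)%:E) \+
   (fun x => \sum_(r <- s) (r%:E * (\1_(h @^-1` [set r]) x)%:E))); last first.
  by apply/funext => x; rewrite big_cons.
apply: QD.
- exact: measurable_funeM.
- by apply: emeasurable_sum => i; exact: measurable_funeM.
- by move=> x; rewrite mule_ge0// lee_fin.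
- move=> x; rewrite big_seq; apply: sume_ge0 => i /rs/= i0.
  by rewrite mule_ge0// lee_fin.
- apply: QZ => //; exact: Qindic.
- exact: IH.
Qed.

End ge0_measurable_ind.

Section weighted_law.
Context {d d' : measure_display} {T : measurableType d} {T' : measurableType d'}.
Context {R : realType}.
Variables (P : {measure set T -> \bar R}).
Local Open Scope ereal_scope.

Section def.
Variables (a : T -> R) (phi : T -> T').
Hypotheses (ma : measurable_fun setT a) (a0 : forall x, (0 <= a x)%R).
Hypothesis mphi : measurable_fun setT phi.

(** The image by [phi] of the measure with density [a] with respect to [P]. *)
Definition wlaw_fun (A : set T') : \bar R := \int[P]_(w in phi @^-1` A) (a w)%:E.

Let mae : measurable_fun setT (EFin \o a).
Proof. exact/measurable_EFinP. Qed.

Let mafP f : measurable_fun setT f ->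
  measurable_fun setT (fun w => (a w)%:E * f (phi w)).
Proof. by move=> mf; apply: emeasurable_funM => //; exact: measurableT_comp. Qed.

Let af0 (f : T' -> \bar R) w : (forall x, 0 <= f x) -> 0 <= (a w)%:E * f (phi w).
Proof. by move=> f0; rewrite mule_ge0// lee_fin. Qed.

Let wlaw0 : wlaw_fun set0 = 0.
Proof. by rewrite /wlaw_fun preimage_set0 integral_set0. Qed.

Let wlaw_ge0 A : 0 <= wlaw_fun A.
Proof. by apply: integral_ge0 => x _; rewrite lee_fin. Qed.

Let wlaw_sigma_additive : semi_sigma_additive wlaw_fun.
Proof.
move=> F mF tF mUF; rewrite /wlaw_fun preimage_bigcup ge0_integral_bigcup//.
- by apply: is_cvg_ereal_nneg_natsum_cond => n _ _; apply: integral_ge0 => x _; rewrite lee_fin.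
- by move=> n; rewrite -[X in measurable X]setTI; exact: mphi.
- exact: measurable_funTS.
- by move=> x _; rewrite lee_fin.
- apply/trivIsetP => /= i j _ _ ij; rewrite -preimage_setI.
  by move/trivIsetP : tF => /(_ _ _ _ _ ij) ->//; rewrite preimage_set0.
Qed.

Definition wlaw : {measure set T' -> \bar R} := HB.pack wlaw_fun
  (isMeasure.Build _ _ _ wlaw_fun wlaw0 wlaw_ge0 wlaw_sigma_additive).

Lemma wlawE A : measurable A -> wlaw A = \int[P]_w ((a w)%:E * (\1_A (phi w))%:E).
Proof.
move=> mA; rewrite /wlaw/= /wlaw_fun integral_mkcond; apply: eq_integral => x _.
by rewrite patchE indicE -[x \in _]/(phi x \in A); case: ifP; rewrite ?mule1 ?mule0.
Qed.

Lemma integral_wlaw f : measurable_fun setT f -> (forall x, 0 <= f x) ->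
  \int[wlaw]_x f x = \int[P]_w ((a w)%:E * f (phi w)).
Proof.
move: f; apply: (ge0_measurable_ind (Q := fun f => \int[wlaw]_x f x = \int[P]_w ((a w)%:E * f (phi w)))).
- by rewrite integral0 integral0_eq// => x _; rewrite mule0.
- by move=> A mA; rewrite -wlawE// integral_indic// setIT.
- move=> f g mf mg f0 g0 hf hg; rewrite ge0_integralD// hf hg -ge0_integralD//.
  + by apply: eq_integral => x _ /=; rewrite ge0_muleDr.
  + by move=> x _; exact: af0.
  + exact: mafP.
  + by move=> x _; exact: af0.
  + exact: mafP.
- move=> f c mf f0 c0 hf; rewrite ge0_integralZl//.
  rewrite hf -ge0_integralZl//.
  + by apply: eq_integral => x _ /=; rewrite muleCA.
  + exact: mafP.
  + by move=> x _; exact: af0.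
- move=> f mf f0 ndf hf; rewrite monotone_convergence//.
  under eq_fun do rewrite hf.
  rewrite -monotone_convergence//; last 3 first.
  + by move=> n; exact: mafP.
  + by move=> n x _; exact: af0.
  + by move=> x _ m n mn; rewrite lee_wpmul2l//; [rewrite lee_fin|exact: ndf].
  apply: eq_integral => x _.
  have cf : cvgn (f ^~ (phi x)) by exact: ereal_nondecreasing_is_cvgn.
  by apply/cvg_lim => //; exact: cvgeZl.
Qed.

End def.
End weighted_law.

(** * Sums over the words of a given length *)

Section wsum.
Context {R : realType}.
Local Open Scope ereal_scope.
Implicit Types F G : seq nat -> \bar R.

(** Nested nonnegative series, the last letter innermost. Tonelli, Fatou and factorisation over
    words then follow one letter at a time from their versions for series. *)
Fixpoint wsum n F : \bar R :=
  if n is n'.+1 then wsum n' (fun w => \sum_(i <oo) F (rcons w i)) else F [::].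

Lemma eq_wsum n F G : (forall w, size w = n -> F w = G w) -> wsum n F = wsum n G.
Proof.
elim: n F G => [|n IH] F G FG /=; first exact: FG.
apply: IH => w sw; apply: eq_eseriesr => i _.
by rewrite FG// size_rcons sw.
Qed.

Lemma wsum_ge0 n F : (forall w, 0 <= F w) -> 0 <= wsum n F.
Proof. by elim: n F => [|n IH] F F0 //=; apply: IH => w; exact: nneseries_ge0. Qed.

Lemma le_wsum n F G : (forall w, 0 <= F w) ->
  (forall w, size w = n -> F w <= G w) -> wsum n F <= wsum n G.
Proof.
elim: n F G => [|n IH] F G F0 FG /=; first exact: FG.
apply: IH => w; first exact: nneseries_ge0.
by move=> sw; apply: lee_nneseries => // i _; rewrite FG// size_rcons sw.
Qed.

Lemma wsumZl n (c : \bar R) F : c \is a fin_num -> (forall w, 0 <= F w) ->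
  wsum n (fun w => c * F w) = c * wsum n F.
Proof.
case: c => // c _; elim: n F => [|n IH] F F0 //=.
rewrite -IH; last by move=> w; exact: nneseries_ge0.
by apply: eq_wsum => w sw; rewrite nneseriesZl.
Qed.

Lemma wsum_add m n F : wsum (m + n) F = wsum m (fun u => wsum n (fun v => F (u ++ v))).
Proof.
elim: n F => [|n IH] F /=.
  by rewrite addn0; apply: eq_wsum => w _; rewrite cats0.
rewrite addnS /= IH; apply: eq_wsum => u _; apply: eq_wsum => v _.
by apply: eq_eseriesr => i _; rewrite rcons_cat.
Qed.

Lemma wsum_prod n (f : nat -> nat -> \bar R) : (forall l i, 0 <= f l i) ->
  (forall l i, f l i \is a fin_num) -> (forall l, \sum_(i <oo) f l i \is a fin_num) ->
  wsum n (fun w => \prod_(l < n) f l (nth 0%N w l)) =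
  \prod_(l < n) \sum_(i <oo) f l i.
Proof.
move=> f0 ffin sfin; elim: n => [|n IH] /=; first by rewrite !big_ord0.
rewrite big_ord_recr/= -IH muleC -wsumZl//; last first.
  by move=> w; apply: prode_ge0.
apply: eq_wsum => w sw.
have pfin : \prod_(l < n) f l (nth 0%N w l) \is a fin_num.
  by elim/big_rec: _ => // l x _ xfin; rewrite fin_numM.
rewrite -[in RHS](fineK pfin) muleC -nneseriesZl; last by move=> i _; exact: f0.
apply: eq_eseriesr => i _; rewrite (fineK pfin) big_ord_recr/= nth_rcons sw ltnn eqxx.
congr (_ * _); apply: eq_bigr => l _.
by rewrite nth_rcons sw ltn_ord.
Qed.

(** Fatou's lemma for the counting measure, applied to one letter after the other. *)
Lemma wsum_liminf n (F : nat -> seq nat -> \bar R) : (forall m w, 0 <= F m w) ->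
  wsum n (fun w => limn_einf (F ^~ w)) <= limn_einf (fun m => wsum n (F m)).
Proof.
elim: n F => [|n IH] F F0 //=.
apply: le_trans (IH _ _) => [|m w]; last exact: nneseries_ge0.
have lim0 w : 0 <= limn_einf (F ^~ w).
  rewrite limn_einf_lim; apply: lime_ge; first exact: is_cvg_einfs.
  by apply: nearW => m; apply: le_ereal_inf_tmp => _ [k /= _ <-].
apply: le_wsum => w; first exact: nneseries_ge0.
move=> _; pose count : {measure set nat -> \bar R} := mseries (fun n => \d_n) 0.
have sumE (f : nat -> \bar R) : (forall i, 0 <= f i) ->
    \sum_(i <oo) f i = \int[count]_i f i.
  move=> f0; rewrite ge0_integral_measure_series//.
  by apply: eq_eseriesr => i _; rewrite integral_dirac// diracT mul1e.
rewrite sumE//; under [in leRHS]eq_fun do rewrite sumE//.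
exact: (@fatou _ _ R count _ measurableT (fun m i => F m (rcons w i))).
Qed.
End wsum.

Section wsum_measure.
Context {d : measure_display} {T : measurableType d} {R : realType}.
Local Open Scope ereal_scope.

Lemma measurable_wsum n (F : seq nat -> T -> \bar R) :
  (forall w, measurable_fun setT (F w)) -> (forall w x, 0 <= F w x) ->
  measurable_fun setT (fun x => wsum n (F ^~ x)).
Proof.
elim: n F => [|n IH] F mF F0 //=.
apply: (IH (fun w x => \sum_(i <oo) F (rcons w i) x)) => [w|w x].
  exact: ge0_emeasurable_sum.
exact: nneseries_ge0.
Qed.

Lemma integral_wsum (m : {measure set T -> \bar R}) n (F : seq nat -> T -> \bar R) :
  (forall w, measurable_fun setT (F w)) -> (forall w x, 0 <= F w x) ->
  \int[m]_x wsum n (F ^~ x) = wsum n (fun w => \int[m]_x F w x).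
Proof.
elim: n F => [|n IH] F mF F0 //=.
rewrite (IH (fun w x => \sum_(i <oo) F (rcons w i) x)).
- by apply: eq_wsum => w _; rewrite integral_nneseries.
- by move=> w; exact: ge0_emeasurable_sum.
- by move=> w x; exact: nneseries_ge0.
Qed.

(** The same nested series formed on measures: the sum is then a measure by construction, and can be
    identified by its values on boxes. *)
Fixpoint wmeas n (F : seq nat -> {measure set T -> \bar R}) : {measure set T -> \bar R} :=
  if n is n'.+1 then wmeas n' (fun w => mseries (fun i => F (rcons w i)) 0) else F [::].

Lemma wmeasE n F A : wmeas n F A = wsum n (fun w => F w A).
Proof. by elim: n F => [|n IH] F //=; rewrite IH. Qed.

(** Countable subadditivity; the last letter is absorbed into a union before the induction
    hypothesis is applied. *)
Lemma le_wsum_measure (m : {measure set T -> \bar R}) n (F : seq nat -> set T) (B : set T) :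
  (forall w, measurable (F w)) -> measurable B ->
  (forall x, B x -> exists2 w, size w = n & F w x) -> m B <= wsum n (fun w => m (F w)).
Proof.
elim: n F B => [|n IH] F B mF mB BF /=.
  by apply: le_measure; rewrite ?inE// => x /BF[w /size0nil ->].
apply: (@le_trans _ _ (wsum n (fun w => m (\bigcup_i F (rcons w i))))).
  apply: IH => // [w|x /BF[w]]; first exact: bigcup_measurable.
  case/lastP: w => [//|w i]; rewrite size_rcons => -[sw] Fx.
  by exists w => //; exists i.
apply: le_wsum => // w _.
by apply: generalized_Boole_inequality => //; exact: bigcup_measurable.
Qed.

End wsum_measure.

Definition rV_coord (R : realType) (d : nat) : set (set 'rV[R]_d) :=
  [set A | exists (j : 'I_d), exists2 B : set R, measurable B & A = [set x : 'rV[R]_d | B (x ord0 j)]].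

Notation rVType R d := (g_sigma_algebraType (@rV_coord R d)).

Section offspring_functions.
Context {R : realType} {d : nat}.

Lemma measurable_rV_coord (j : 'I_d) :
  measurable_fun setT (fun x : rVType R d => x ord0 j).
Proof.
move=> _ B mB; rewrite setTI; apply: sub_sigma_algebra.
by exists j, B.
Qed.

Lemma measurable_rV d' (T : measurableType d') (f : T -> rVType R d) :
  (forall j, measurable_fun setT (fun a => f a ord0 j)) -> measurable_fun setT f.
Proof.
move=> mf; apply: (@measurability _ _ _ (rVType R d) setT f (@rV_coord R d)) => //.
move=> _ [_ [k [B mB ->]] <-].
by have := mf k measurableT B mB.
Qed.

Definition has_child i (v : offspringType R d) : bool := (i < v.1)%N.
Definition child_pos i (v : offspringType R d) : rVType R d := (v.2 i).1.
(** The factor 0 for absent children lets sums over children run over all integers. *)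
Definition child_weight i (v : offspringType R d) : R :=
  (has_child i v)%:R * expR (v.2 i).2.

Lemma measurable_child_pos i : measurable_fun setT (child_pos i).
Proof.
apply: measurable_rV => j _ B mB; rewrite setTI; apply: sub_sigma_algebra.
by apply: Or32; exists i, j, B.
Qed.

Lemma measurable_child_weight i : measurable_fun setT (child_weight i).
Proof.
apply: measurable_funM; last first.
  apply: measurableT_comp => // _ B mB; rewrite setTI; apply: sub_sigma_algebra.
  by apply: Or33; exists i, B.
apply: (@measurableT_comp _ _ _ _ _ _ (fun n : nat => (i < n)%N%:R : R) _ (fun v : offspringType R d => v.1)) => //.
move=> _ B mB; rewrite setTI; apply: sub_sigma_algebra.
by apply: Or31; exists B.
Qed.

Lemma child_weight_ge0 i v : 0 <= child_weight i v.
Proof. by rewrite mulr_ge0// expR_ge0. Qed.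

(** Integrated and summed over [i], this is the mass of [A] under the letter law. *)
Definition child_cell i (A : set (rVType R d)) (v : offspringType R d) : R :=
  child_weight i v * \1_A (child_pos i v).

Lemma measurable_child_cell i A : measurable A -> measurable_fun setT (child_cell i A).
Proof.
move=> mA; apply: measurable_funM; first exact: measurable_child_weight.
by apply: (measurableT_comp (measurable_indic mA)); exact: measurable_child_pos.
Qed.

Lemma child_cell_ge0 i A v : 0 <= child_cell i A v.
Proof. by rewrite mulr_ge0// child_weight_ge0. Qed.

End offspring_functions.

(** * Independence of the offspring vectors *)

Section independence.
Context {disp : measure_display} {Omega : measurableType disp} {R : realType} {d : nat}.
Variables (P : probability Omega R) (V : Omega -> offspringType R d).
Variable W : word -> Omega -> offspringType R d.
Hypothesis mV : measurable_fun setT V.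
Hypothesis indW : independent_copies P V W.
Local Open Scope ereal_scope.

Let mW u : measurable_fun setT (W u). Proof. by case: indW. Qed.

(** Independence is given for events only, so words move one by one from the indicators [s2] to the
    functions [s1]: the product of all other factors serves as a density, and the weighted law of
    [W u] is compared with a multiple of the law of [V]. *)
Lemma integral_indep_aux (s1 s2 : seq word) (g : word -> offspringType R d -> R)
    (A : word -> set (offspringType R d)) :
  (forall u, measurable_fun setT (g u)) -> (forall u v, (0 <= g u v)%R) ->
  (forall u, \int[P]_w (g u (V w))%:E \is a fin_num) ->
  (forall u, measurable (A u)) -> uniq (s1 ++ s2) ->
  \int[P]_w ((\prod_(u <- s1) g u (W u w)) * \prod_(u <- s2) \1_(A u) (W u w))%:E =
  (\prod_(u <- s1) \int[P]_w (g u (V w))%:E) * \prod_(u <- s2) P (V @^-1` A u).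
Proof.
move=> mg g0 gfin; elim: s1 s2 A => [|u s1 IH] s2 A mA us /=.
  have [_ lawW /(_ s2 A us mA) PW] := indW.
  rewrite big_nil mul1e -(eq_bigr _ (fun u _ => lawW u (A u) (mA u))) -PW.
  rewrite measure_integral_indic; last first.
    by apply: fin_bigcap_measurable => // u _; rewrite -[X in measurable X]setTI; exact: mW.
  apply: eq_integral => w _; rewrite big_nil mul1r; congr EFin.
  rewrite bigcap_seq; elim: (s2) => [|u s IHs]; first by rewrite !big_nil indicT.
  by rewrite !big_cons indicI /= IHs.
pose a w := ((\prod_(v <- s1) g v (W v w)) * \prod_(v <- s2) \1_(A v) (W v w))%R.
have ma : measurable_fun setT a.
  apply: measurable_funM.
    by apply: measurable_prod => v _; exact: measurableT_comp.
  by apply: measurable_prod => v _; apply: (measurableT_comp (measurable_indic _)).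
have a0 w : (0 <= a w)%R by rewrite mulr_ge0// prodr_ge0.
set c := (\prod_(v <- s1) \int[P]_w (g v (V w))%:E) * \prod_(v <- s2) P (V @^-1` A v).
have cfin : c \is a fin_num.
  rewrite fin_numM//; first by elim/big_rec: _ => // l x _ xfin; rewrite fin_numM.
  elim/big_rec: _ => // l x _ xfin; rewrite fin_numM// fin_num_measure//.
  by rewrite -[X in measurable X]setTI; exact: mV.
have c0 : 0 <= c.
  rewrite mule_ge0//; last exact: prode_ge0.
  by apply: prode_ge0 => v _; apply: integral_ge0 => w _; rewrite lee_fin.
transitivity (\int[wlaw P ma a0 (mW u)]_v (g u v)%:E).
  rewrite integral_wlaw; last by move=> v; rewrite lee_fin.
    by apply: eq_integral => w _; rewrite -EFinM big_cons/= -mulrA mulrC.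
  exact/measurable_EFinP.
(* The law of [V] is itself a weighted law, with density 1. *)
have m1 : measurable_fun setT (cst 1%R : Omega -> R) by [].
have m10 (w : Omega) : (0 <= (cst 1 w : R))%R by [].
rewrite (eq_measure_integral (mscale (NngNum (fine_ge0 c0)) (wlaw P m1 m10 mV))); last first.
  move=> B mB _; rewrite wlawE; last exact: mB.
  (* Replacing only the set attached to [u] by [B] makes the induction hypothesis compute the
     weighted law at [B]. *)
  pose A' v := if v == u then B else A v.
  have us' : uniq (s1 ++ u :: s2) by rewrite -(cat1s u s2) uniq_catCA.
  have mA' v : measurable (A' v) by rewrite /A'; case: eqP.
  have uNs1 v : v \in s1 -> (v == u) = false.
    by move=> vs; apply: contraNF (proj1 (andP us)) => /eqP <-; rewrite mem_cat vs.
  have uNs2 v : v \in s2 -> (v == u) = false.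
    by move=> vs; apply: contraNF (proj1 (andP us)) => /eqP <-; rewrite mem_cat vs orbT.
  have eA' v : v \in s2 -> A' v = A v by move=> vs; rewrite /A' uNs2.
  have eu : A' u = B by rewrite /A' eqxx.
  have := IH (u :: s2) A' mA' us'; rewrite !big_cons eu.
  rewrite (@eq_big_seq _ _ _ _ s2 (fun v => P (V @^-1` A' v)) (fun v => P (V @^-1` A v))); last first.
    by move=> v vs; rewrite eA'.
  rewrite muleCA [X in _ = X -> _]muleC -/c => h.
  transitivity (c * P (V @^-1` B)).
    rewrite -h; apply: eq_integral => w _; rewrite -EFinM; congr EFin.
    rewrite big_cons eu mulrCA mulrC; congr (_ * _)%R; congr (_ * _)%R.
    by apply: eq_big_seq => v vs; rewrite eA'.
  rewrite -[RHS]/((fine c)%:E * wlaw P m1 m10 mV B) fineK//; congr (_ * _).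
  rewrite -[RHS]/(\int[P]_(w in V @^-1` B) cst 1%E w) integral_cst ?mul1e//.
  by rewrite -[X in measurable X]setTI; exact: mV.
rewrite ge0_integral_mscale//; last 2 first.
- exact/measurable_EFinP.
- by move=> v _; rewrite lee_fin.
rewrite integral_wlaw; [|exact/measurable_EFinP|by move=> v; rewrite lee_fin].
rewrite -[X in X * _]/((fine c)%:E) fineK// [in RHS]big_cons -[in RHS]muleA -/c.
by rewrite [LHS]muleC; congr (_ * _); apply: eq_integral => w _; rewrite mul1e.
Qed.

Lemma integral_indep (s : seq word) (g : word -> offspringType R d -> R) :
  (forall u, measurable_fun setT (g u)) -> (forall u v, (0 <= g u v)%R) ->
  (forall u, \int[P]_w (g u (V w))%:E \is a fin_num) -> uniq s ->
  \int[P]_w (\prod_(u <- s) g u (W u w))%:E = \prod_(u <- s) \int[P]_w (g u (V w))%:E.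
Proof.
move=> mg g0 gfin us.
have := @integral_indep_aux s [::] g (fun=> setT) mg g0 gfin (fun=> measurableT).
rewrite cats0 big_nil mule1 => <-//.
by apply: eq_integral => w _; rewrite big_nil mulr1.
Qed.

End independence.

Lemma big_prefix (T : Type) (idx : T) (op : T -> T -> T) (F : word -> T) (w : word) n :
  \big[op/idx]_(u <- [seq take l w | l <- iota 0 n]) F u =
  \big[op/idx]_(l < n) F (take l w).
Proof.
by rewrite big_map -(big_mkord xpredT (fun l => F (take l w))) /index_iota subn0.
Qed.

Section child_sum.
Context {R : realType} {d : nat}.
Local Open Scope ereal_scope.

Lemma nneseries_lt (f : nat -> \bar R) n : (forall i, 0 <= f i) ->
  \sum_(i <oo) ((i < n)%N%:R : R)%:E * f i = \sum_(i < n) f i.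
Proof.
move=> f0; rewrite (nneseries_split 0 n) => [|k _]; last by rewrite mule_ge0// lee_fin.
rewrite add0n eseries0 ?adde0; last first.
  by move=> k nk _; rewrite ltnNge nk/= mul0e.
by rewrite big_mkord; apply: eq_bigr => i _; rewrite ltn_ord mul1e.
Qed.

Lemma child_sum (v : offspringType R d) (f : nat -> \bar R) : (forall i, 0 <= f i) ->
  \sum_(i <oo) (child_weight i v)%:E * f i =
  \sum_(i < v.1) (expR (v.2 i).2)%:E * f i.
Proof.
move=> f0; rewrite -(@nneseries_lt (fun i => (expR (v.2 i).2)%:E * f i))//.
  by apply: eq_eseriesr => i _; rewrite EFinM muleA.
by move=> i; rewrite mule_ge0// lee_fin expR_ge0.
Qed.

End child_sum.

Section letter_law.
Context {disp : measure_display} {Omega : measurableType disp} {R : realType} {d : nat}.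
Variables (P : probability Omega R) (V : Omega -> offspringType R d).
Hypothesis mV : measurable_fun setT V.
Hypothesis EV1 : ('E_P[fun w => (\sum_(i < (V w).1) expR ((V w).2 i).2)%R] = 1)%E.
Local Open Scope ereal_scope.

Let mwV i : measurable_fun setT (child_weight i \o V).
Proof. by apply: measurableT_comp => //; exact: measurable_child_weight. Qed.

Let wV0 i w : (0 <= (child_weight i \o V) w)%R.
Proof. exact: child_weight_ge0. Qed.

Let mpV i : measurable_fun setT (child_pos i \o V).
Proof. by apply: measurableT_comp => //; exact: measurable_child_pos. Qed.

Definition letter_measure : {measure set (rVType R d) -> \bar R} :=
  mseries (fun i => wlaw P (mwV i) (wV0 i) (mpV i)) 0.

Lemma integral_letter_measure (f : rVType R d -> \bar R) :
  measurable_fun setT f -> (forall x, 0 <= f x) ->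
  \int[letter_measure]_x f x =
  \int[P]_w \sum_(i < (V w).1) (expR ((V w).2 i).2)%:E * f ((V w).2 i).1.
Proof.
move=> mf f0; rewrite ge0_integral_measure_series//.
transitivity (\sum_(i <oo) \int[P]_w ((child_weight i (V w))%:E * f (child_pos i (V w)))).
  by apply: eq_eseriesr => i _; rewrite integral_wlaw.
rewrite -integral_nneseries//; last 2 first.
- move=> i; apply: emeasurable_funM; first by apply/measurable_EFinP; exact: mwV.
  by apply: measurableT_comp => //; exact: mpV.
- by move=> i w _; rewrite mule_ge0// lee_fin child_weight_ge0.
by apply: eq_integral => w _; rewrite child_sum.
Qed.

Lemma letter_measureT : letter_measure setT = 1.
Proof.
rewrite measure_integral_indic// integral_letter_measure; last 2 first.
- by apply/measurable_EFinP; exact: measurable_indic.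
- by move=> x; rewrite lee_fin.
rewrite -EV1 expectation.unlock; apply: eq_integral => w _.
by rewrite -sumEFin; apply: eq_bigr => i _; rewrite indicT mule1.
Qed.

Let letter_mixin := Measure_isProbability.Build _ _ _ _ letter_measureT.
Definition letter_law : probability (rVType R d) R :=
  HB.pack (letter_measure : set _ -> \bar R) (Measure.class letter_measure) letter_mixin.

Lemma letter_lawE A : measurable A -> letter_law A = \sum_(i <oo) \int[P]_w (child_cell i A (V w))%:E.
Proof.
move=> mA; apply: eq_eseriesr => i _; rewrite wlawE//.
Qed.

End letter_law.

Section words.
Context {disp : measure_display} {Omega : measurableType disp} {R : realType} {d : nat}.
Variables (P : probability Omega R) (V : Omega -> offspringType R d).
Variables (N : word -> Omega -> nat) (X : word -> Omega -> 'rV[R]_d).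
Variable psi : word -> Omega -> R.
Hypothesis mV : measurable_fun setT V.
Hypothesis indW : independent_copies P V (family_at N X psi).
Hypothesis EV1 : ('E_P[fun w => (\sum_(i < (V w).1) expR ((V w).2 i).2)%R] = 1)%E.
Local Open Scope ereal_scope.
Let W := family_at N X psi.
Let mW u : measurable_fun setT (W u). Proof. by case: indW. Qed.
Let mu := letter_law mV EV1.

(** Equals the exponential of the sum of [psi] along [w] if all its letters are admissible, and 0
    otherwise. Factor l depends only on the vector at the prefix of length l. *)
Definition word_weight (w : word) (o : Omega) : R :=
  (\prod_(l < size w) child_weight (nth 0%N w l) (W (take l w) o))%R.

Definition word_path (w : word) (o : Omega) : pathType (rVType R d) :=
  fun k => if (k < size w)%N then X (take k.+1 w) o else 0%R.

Lemma word_weight_ge0 w o : (0 <= word_weight w o)%R.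
Proof. by apply: prodr_ge0 => l _; exact: child_weight_ge0. Qed.

Lemma measurable_word_weight w : measurable_fun setT (word_weight w).
Proof.
apply: measurable_prod => l _.
by apply: (measurableT_comp (measurable_child_weight _)).
Qed.

Lemma word_pos w k o : (k < size w)%N ->
  X (take k.+1 w) o = child_pos (nth 0%N w k) (W (take k w) o).
Proof. by move=> kw; rewrite (take_nth 0%N). Qed.

Lemma measurable_word_path w : measurable_fun setT (word_path w).
Proof.
apply: measurable_path => k; rewrite /word_path; case: ltnP => kw.
  rewrite (_ : (fun _ => _) = child_pos (nth 0%N w k) \o W (take k w)).
    by apply: (measurableT_comp (measurable_child_pos _)).
  by apply/funext => o; exact: word_pos.
exact: measurable_cst.
Qed.

Definition word_law w : {measure set (pathType (rVType R d)) -> \bar R} :=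
  wlaw P (measurable_word_weight w) (word_weight_ge0 w) (measurable_word_path w).

Lemma child_cell_fin i A : measurable A ->
  \int[P]_w (child_cell i A (V w))%:E \is a fin_num.
Proof.
move=> mA; rewrite ge0_fin_numE; last first.
  by apply: integral_ge0 => w _; rewrite lee_fin child_cell_ge0.
apply: (@le_lt_trans _ _ (mu A)); last first.
  by rewrite -ge0_fin_numE// fin_num_measure.
rewrite letter_lawE//.
rewrite (nneseriesD1 (n := i))//; last first.
  by move=> k _; apply: integral_ge0 => w _; rewrite lee_fin child_cell_ge0.
by rewrite leeDl// nneseries_ge0// => k _ _; apply: integral_ge0 => w _; rewrite lee_fin child_cell_ge0.
Qed.

(** The weight and the label of step l are both functions of the vector at the prefix of length l.
    These prefixes are distinct words, so the expectation factorises; the indicator accounts for the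
    padding. *)
Lemma word_law_rect n (A : nat -> set (rVType R d)) w : (forall k, measurable (A k)) ->
  size w = n ->
  word_law w (rect A) =
  (\1_(rect (fun k => A (n + k)%N)) (fun=> 0%R))%:E *
  \prod_(l < n) \int[P]_o (child_cell (nth 0%N w l) (A l) (V o))%:E.
Proof.
move=> mA sw.
(* The length of a prefix tells which letter and which set belong to it. *)
pose g (u : word) := @child_cell R d (nth 0%N w (size u)) (A (size u)).
pose s := [seq take l w | l <- iota 0 n].
have us : uniq s.
  rewrite map_inj_in_uniq ?iota_uniq// => i j; rewrite !mem_iota !add0n /= => iN jN.
  by move/(congr1 size); rewrite !size_take sw iN jN.
have gE l : (l < n)%N -> g (take l w) = child_cell (nth 0%N w l) (A l).
  by move=> ln; rewrite /g size_take sw ln.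
rewrite wlawE; last exact: measurable_rect.
set c := \1_(rect (fun k => A (n + k)%N)) (fun=> 0%R).
transitivity (\int[P]_o (c%:E * (\prod_(u <- s) g u (W u o))%:E)).
  apply: eq_integral => o _; rewrite -!EFinM; congr EFin.
  rewrite big_prefix.
  rewrite (eq_bigr (fun l : 'I_n => child_weight (nth 0%N w l) (W (take l w) o) *
      \1_(A l) (X (take l.+1 w) o)))%R; last first.
    by move=> l _; rewrite gE// /child_cell -word_pos// sw.
  rewrite big_split/= mulrCA /word_weight sw; congr (_ * _)%R.
  have [cA|cA] := pselect (rect (fun k => A (n + k)%N) (fun=> 0%R)).
    have -> : c = 1%R by rewrite /c indicE mem_set.
    rewrite mul1r.
    have [h|h] := pselect (forall l : 'I_n, A l (X (take l.+1 w) o)).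
      rewrite big1 => [|l _]; last by rewrite indicE mem_set.
      rewrite indicE mem_set// => k; rewrite /word_path sw.
      have [kn|nk] := ltnP k n; first exact: (h (Ordinal kn)).
      by have := cA (k - n)%N; rewrite subnKC.
    have [l hl] : exists l : 'I_n, ~ A l (X (take l.+1 w) o) by apply/existsNP.
    rewrite (bigD1 l)//= [X in (X * _)%R]indicE memNset// mul0r.
    rewrite indicE memNset// => /(_ l); rewrite /word_path sw ltn_ord; exact.
  have -> : c = 0%R by rewrite /c indicE memNset.
  rewrite mul0r indicE memNset// => h.
  apply: cA => k; have := h (n + k)%N.
  by rewrite /word_path sw ltnNge leq_addr.
rewrite ge0_integralZl//; last 3 first.
- apply/measurable_EFinP; apply: measurable_prod => u _; apply: (measurableT_comp (measurable_child_cell _ _)) => //.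
- by move=> o _; rewrite lee_fin; apply: prodr_ge0 => u _; exact: child_cell_ge0.
- by rewrite lee_fin.
congr (_ * _); rewrite (integral_indep mV indW)//.
- rewrite big_prefix.
  by apply: eq_bigr => l _; rewrite gE.
- by move=> u; exact: measurable_child_cell.
- by move=> u v; exact: child_cell_ge0.
- by move=> u; exact: child_cell_fin.
Qed.

(** Both sides are finite measures, so boxes suffice. There the sum over words of a product over
    steps is a product of sums over letters, each equal to some [mu (B l)]. *)
Lemma many_to_one n (A : set (pathType (rVType R d))) : measurable A ->
  wsum n (fun w => word_law w A) = rho mu 0%R n A.
Proof.
have e (B : nat -> set (rVType R d)) : (forall k, measurable (B k)) ->
    wmeas n word_law (rect B) = rho mu 0%R n (rect B).
  move=> mB; rewrite wmeasE (eq_wsum (fun w => @word_law_rect n B w mB))// wsumZl//; last first.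
    move=> w; apply: prode_ge0 => l _; apply: integral_ge0 => o _.
    by rewrite lee_fin child_cell_ge0.
  have lE l : \sum_(i <oo) \int[P]_o (child_cell i (B l) (V o))%:E = mu (B l).
    by rewrite letter_lawE.
  pose f l i : \bar R := \int[P]_o (child_cell i (B l) (V o))%:E.
  rewrite -/(f _ _) (@wsum_prod R n f).
  - by rewrite rho_rect// muleC; congr (_ * _); apply: eq_bigr => l _; rewrite lE.
  - by move=> l i; apply: integral_ge0 => o _; rewrite lee_fin child_cell_ge0.
  - by move=> l i; exact: child_cell_fin.
  - by move=> l; rewrite lE fin_num_measure.
move=> mA; rewrite -wmeasE; apply: path_measure_unique => //.
have <- : rect (fun=> setT) = setT :> set (pathType (rVType R d)).
  by apply/seteqP; split.
rewrite [X in X < _]e// -ge0_fin_numE// fin_num_measure//.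
exact: measurable_rect.
Qed.

End words.

(** * From cylinder masses to sums over words *)

Section descendants.
Context {R : realType}.
Variable N : word -> nat.

Definition branch (u v : word) : R :=
  \prod_(l < size v) (nth 0%N v l < N (u ++ take l v))%N%:R.

Lemma branch_ge0 u v : 0 <= branch u v.
Proof. exact: prodr_ge0. Qed.

Lemma branch_rcons u v i :
  branch u (rcons v i) = branch u v * (i < N (u ++ v))%N%:R.
Proof.
rewrite /branch size_rcons big_ord_recr/= nth_rcons ltnn eqxx.
rewrite -cats1 take_size_cat//; congr (_ * _); apply: eq_bigr => l _.
by rewrite nth_cat ltn_ord take_cat ltn_ord.
Qed.

(** Puts sums over the random tree into the form [wsum], whose index set is deterministic; [branch]
    is the indicator of being a descendant. *)
Lemma sum_descendants (f : word -> R) u n : (forall w, 0 <= f w) ->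
  (\sum_(w <- descendants N u n) f w)%:E =
  wsum n (fun v => (branch u v * f (u ++ v))%:E).
Proof.
elim: n f => [|n IH] f f0 /=.
  by rewrite big_seq1 /branch big_ord0 mul1r cats0.
rewrite big_allpairs_dep/= IH => [|v]; last by rewrite sumr_ge0.
apply: eq_wsum => v _; rewrite EFinM.
have -> : (\sum_(i <- iota 0 (N (u ++ v))) f (rcons (u ++ v) i))%:E =
    (\sum_(i <oo) (((i < N (u ++ v))%N%:R : R)%:E * (f (rcons (u ++ v) i))%:E))%E.
  rewrite nneseries_lt => [|i]; last by rewrite lee_fin.
  by rewrite sumEFin -(big_mkord xpredT (fun i => f (rcons (u ++ v) i))) /index_iota subn0.
rewrite -nneseriesZl => [|i _]; last by rewrite mule_ge0// lee_fin.
by apply: eq_eseriesr => i _; rewrite branch_rcons rcons_cat -!EFinM mulrA.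
Qed.

Lemma descendants_branch u n w : w \in descendants N u n ->
  exists2 v, w = u ++ v & branch u v = 1.
Proof.
elim: n w => [|n IH] w /=.
  by rewrite inE => /eqP ->; exists [::]; rewrite ?cats0// /branch big_ord0.
move=> /allpairsPdep[w' [i [/IH[v -> v1]]]].
rewrite mem_iota add0n => /= iN ->; exists (rcons v i); first by rewrite rcons_cat.
by rewrite branch_rcons v1 mul1r iN.
Qed.

Lemma tree_branch u : (\1_(tree N) u : R) <= branch [::] u.
Proof.
rewrite indicE; have [h|h] := pselect (tree N u); last by rewrite memNset// branch_ge0.
by rewrite mem_set//; case: h => n /descendants_branch[v -> ->].
Qed.

End descendants.

Definition ray_path {R : realType} {d : nat} (x : word -> 'rV[R]_d) h (t : ray) :
  pathType (rVType R d) := fun k => if (k < h)%N then x (mkseq t k.+1) else 0.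

Section mass.
Context {disp : measure_display} {Omega : measurableType disp} {R : realType} {d : nat}.
Variables (P : probability Omega R) (V : Omega -> offspringType R d).
Variables (N : word -> Omega -> nat) (X : word -> Omega -> 'rV[R]_d).
Variable psi : word -> Omega -> R.
Hypothesis mV : measurable_fun setT V.
Hypothesis indW : independent_copies P V (family_at N X psi).
Hypothesis EV1 : ('E_P[fun w => (\sum_(i < (V w).1) expR ((V w).2 i).2)%R] = 1)%E.
Local Notation word_weight := (word_weight N X psi).
Local Notation word_path := (word_path X).

(** The bracket is the summand of [Ymart] at [u] for the descendant [u ++ v], so summing over [v]
    produces the martingale. *)
Lemma word_weight_cat u v o :
  word_weight (u ++ v) o = word_weight u o *
    (branch (N ^~ o) u v *
     expR (\sum_(size u <= k < size (u ++ v)) psi (take k.+1 (u ++ v)) o)).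
Proof.
pose f w l : R := (nth 0%N w l < N (take l w) o)%N%:R.
have wwE w : word_weight w o = \prod_(0 <= l < size w)
    (f w l * expR (psi (take l.+1 w) o)).
  rewrite big_mkord; apply: eq_bigr => l _; rewrite (take_nth 0%N)//.
rewrite !wwE (@big_cat_nat _ _ _ (size u))//=; last by rewrite size_cat leq_addr.
congr (_ * _).
  rewrite big_nat [in RHS]big_nat; apply: eq_bigr => l /= lu.
  rewrite /f nth_cat take_cat lu takel_cat//.
rewrite big_split/= -expR_sum; congr (_ * _).
rewrite size_cat [(size u + size v)%N]addnC -{1}(add0n (size u)) big_addn addnK big_mkord.
apply: eq_bigr => l _.
have e : (l + size u < size u)%N = false by rewrite ltnNge leq_addl.
by rewrite /f nth_cat take_cat e addnK.
Qed.

Lemma Ylim_ge0 u o : 0 <= Ylim (N ^~ o) (psi ^~ o) u.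
Proof.
rewrite /Ylim; have [h|h] := pselect (cvgn (Ymart (N ^~ o) (psi ^~ o) u)).
  by apply: limr_ge => //; apply: nearW => n; apply: sumr_ge0 => *; exact: expR_ge0.
(* [limn] of a divergent sequence is the default value 0. *)
by rewrite dvgP.
Qed.

(** By multiplicativity the sum over [v] is [word_weight u o * Y m]. If the martingale converges,
    its limit is the liminf; otherwise [Ylim] has its default value 0 and nonnegativity is
    enough. *)
Lemma le_mandelbrot_mass u o : ((mandelbrot_mass (N ^~ o) (psi ^~ o) u)%:E <=
  limn_einf (fun m => wsum m (fun v => (word_weight (u ++ v) o)%:E)))%E.
Proof.
set Y := Ymart (N ^~ o) (psi ^~ o) u.
have wY m : wsum m (fun v => (word_weight (u ++ v) o)%:E) = (word_weight u o * Y m)%:E.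
  rewrite EFinM /Y /Ymart sum_descendants => [|w]; last exact: expR_ge0.
  rewrite -wsumZl//; last by move=> v; rewrite lee_fin mulr_ge0 ?branch_ge0// expR_ge0.
  by apply: eq_wsum => v _; rewrite word_weight_cat EFinM.
rewrite (eq_fun wY).
apply: (@le_trans _ _ (word_weight u o * Ylim (N ^~ o) (psi ^~ o) u)%:E).
  rewrite lee_fin /mandelbrot_mass ler_wpM2r ?Ylim_ge0//.
  have := word_weight_cat [::] u o; rewrite cat0s => ->.
  rewrite /word_weight big_ord0 mul1r big_mkord ler_wpM2r ?expR_ge0//.
  exact: tree_branch.
rewrite /Ylim -/Y; have [h|h] := pselect (cvgn Y); last first.
  rewrite dvgP// mulr0 limn_einf_lim; apply: lime_ge; first exact: is_cvg_einfs.
  apply: nearW => m; apply: le_ereal_inf_tmp => _ [k /= _ <-].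
  by rewrite lee_fin mulr_ge0 ?word_weight_ge0// sumr_ge0// => *; exact: expR_ge0.
have /cvg_limn_einf_sup[-> _] //:
    (word_weight u o * Y m)%:E @[m --> \oo] --> (word_weight u o * limn Y)%:E.
apply: cvg_EFin; first exact: nearW.
by apply: cvgMr; exact: h.
Qed.

End mass.

Lemma measurable_cylinder (w : word) : measurable (cylinder w : set rayType).
Proof. by apply: sub_sigma_algebra; exists w. Qed.

(** * Borel-Cantelli on rays *)

Section rays.
Context {disp : measure_display} {Omega : measurableType disp} {R : realType} {d : nat}.
Variables (P : probability Omega R) (V : Omega -> offspringType R d).
Variables (N : word -> Omega -> nat) (X : word -> Omega -> 'rV[R]_d).
Variable psi : word -> Omega -> R.
Variable nu : Omega -> {measure set rayType -> \bar R}.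
Hypothesis mV : measurable_fun setT V.
Hypothesis indW : independent_copies P V (family_at N X psi).
Hypothesis EV1 : ('E_P[fun w => (\sum_(i < (V w).1) expR ((V w).2 i).2)%R] = 1)%E.
Local Open Scope ereal_scope.
Let rho := rho (letter_law mV EV1) 0%R.
Local Notation trunc0 := (@trunc _ (rVType R d) 0%R).
Local Notation word_weight := (word_weight N X psi).
Local Notation word_path := (word_path X).

Let mww w : measurable_fun setT (word_weight w).
Proof. exact: (measurable_word_weight indW). Qed.

Let mwp w : measurable_fun setT (word_path w).
Proof. exact: (measurable_word_path indW). Qed.

Lemma ray_path_word x h t (o : Omega) : (forall u, x u = X u o) ->
  ray_path x h t = word_path (mkseq t h) o.
Proof.
move=> xX; apply/funext => k; rewrite /ray_path /word_path size_mkseq.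
by case: ltnP => // kh; rewrite xX /mkseq -map_take take_iota (minn_idPl kh).
Qed.

Lemma measurable_trunc_preimage h (A : set (pathType (rVType R d))) :
  measurable A -> measurable (trunc0 h @^-1` A).
Proof. by move=> mA; rewrite -[X in measurable X]setTI; exact: measurable_trunc. Qed.

Lemma rho_trunc h m (A : set (pathType (rVType R d))) : measurable A ->
  rho (h + m) (trunc0 h @^-1` A) = rho h A.
Proof.
move=> mA.
have mtA := measurable_trunc_preimage h mA.
rewrite measure_integral_indic//.
have := @integral_rho_split _ _ _ (letter_law mV EV1) 0%R h m (EFin \o \1_A) (cst 1).
have -> : \int[rho m]_x cst 1 x = 1.
  by rewrite integral_cst// mul1e; exact: probability_setT.
rewrite mule1 => h1.
transitivity (\int[rho (h + m)]_x ((\1_A (trunc0 h x))%:E * 1)).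
  by apply: eq_integral => x _; rewrite mule1.
rewrite h1//; first by rewrite -measure_integral_indic.
  by apply/measurable_EFinP; exact: measurable_indic.
by move=> x; rewrite lee_fin.
Qed.

Lemma measurable_ray_event h (A : set (pathType (rVType R d))) o :
  measurable ([set t | A (ray_path (X ^~ o) h t)] : set rayType).
Proof.
rewrite (_ : [set t | _] = \bigcup_(w : word) (if `[< size w = h /\ A (word_path w o) >]
  then cylinder w else set0)).
  apply: countable_bigcupT_measurable; first exact: countableP.
  by move=> w; case: asboolP => // _; exact: measurable_cylinder.
apply/seteqP; split=> t /=.
  rewrite (@ray_path_word _ h t o)// => At; exists (mkseq t h) => //.
  by rewrite asboolT ?size_mkseq//= /cylinder/= size_mkseq.
move=> [w _]; case: asboolP => // -[sw Aw] tw.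
by rewrite (@ray_path_word _ h t o)// -sw tw.
Qed.

(** Asymptotic total weight of the words whose first [h] labels lie in [A]: an explicit measurable
    function of [o] dominating the [nu o]-mass of the event, so that expectations can be taken. *)
Definition ray_bound h (A : set (pathType (rVType R d))) (o : Omega) : \bar R :=
  limn_einf (fun m => wsum h (fun w => wsum m (fun v =>
    (word_weight (w ++ v) o * \1_A (word_path w o))%:E))).

Lemma ray_bound_ge0 h A o : 0 <= ray_bound h A o.
Proof.
rewrite /ray_bound limn_einf_lim; apply: lime_ge; first exact: is_cvg_einfs.
apply: nearW => m; apply: le_ereal_inf_tmp => _ [k /= _ <-].
apply: wsum_ge0 => w; apply: wsum_ge0 => v.
by rewrite lee_fin mulr_ge0 ?word_weight_ge0.
Qed.

Let mterm m A w : measurable A -> measurable_fun setT (fun o => wsum m (fun v =>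
    (word_weight (w ++ v) o * \1_A (word_path w o))%:E)).
Proof.
move=> mA; apply: (measurable_wsum m (F := fun v o => (word_weight (w ++ v) o * \1_A (word_path w o))%:E)) => [v|v o].
  apply/measurable_EFinP; apply: measurable_funM => //.
  by apply: (measurableT_comp (measurable_indic mA)).
by rewrite lee_fin mulr_ge0 ?word_weight_ge0.
Qed.

Let mterms h m A : measurable A -> measurable_fun setT (fun o => wsum h (fun w => wsum m (fun v =>
    (word_weight (w ++ v) o * \1_A (word_path w o))%:E))).
Proof.
move=> mA; apply: (measurable_wsum h (F := fun w o => wsum m (fun v =>
    (word_weight (w ++ v) o * \1_A (word_path w o))%:E))) => [w|w o].
  exact: mterm.
by apply: wsum_ge0 => v; rewrite lee_fin mulr_ge0 ?word_weight_ge0.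
Qed.

Lemma measurable_ray_bound h A : measurable A -> measurable_fun setT (ray_bound h A).
Proof.
move=> mA; rewrite (_ : ray_bound h A = (fun o => - limn_esup (fun m => - wsum h (fun w =>
    wsum m (fun v => (word_weight (w ++ v) o * \1_A (word_path w o))%:E))))).
  apply: measurableT_comp => //; apply: (measurable_fun_limn_esup (f := fun m o => _)) => m.
  by apply: measurableT_comp => //; exact: mterms.
by [].
Qed.

(** By Fatou each [m] can be treated separately. The many-to-one formula gives the
    [rho (h + m)]-probability of an event about the first [h] letters, which does not depend on
    [m]. *)
Lemma integral_ray_bound h A : measurable A -> \int[P]_o ray_bound h A o <= rho h A.
Proof.
move=> mA; apply: le_trans; first apply: fatou => //.
- by move=> m; exact: mterms.
- move=> m o _; apply: wsum_ge0 => w; apply: wsum_ge0 => v.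
  by rewrite lee_fin mulr_ge0 ?word_weight_ge0.
rewrite (_ : (fun _ => _) = cst (rho h A)).
  by have [-> _] := cvg_limn_einf_sup (cvg_cst (rho h A)).
apply/funext => m /=; rewrite -(rho_trunc h m)// -(many_to_one mV indW); last exact: measurable_trunc_preimage.
pose F w o := (word_weight w o * \1_A (word_path (take h w) o))%:E.
transitivity (\int[P]_o wsum (h + m) (F ^~ o)).
  apply: eq_integral => o _; rewrite wsum_add; apply: eq_wsum => w sw.
  by apply: eq_wsum => v sv; rewrite /F -sw take_size_cat.
rewrite integral_wsum; last 2 first.
- move=> w; apply/measurable_EFinP; apply: measurable_funM => //.
  by apply: (measurableT_comp (measurable_indic mA)).
- by move=> w o; rewrite lee_fin mulr_ge0 ?word_weight_ge0.
apply: eq_wsum => w sw; rewrite wlawE; last exact: measurable_trunc_preimage.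
apply: eq_integral => o _; rewrite /F EFinM; congr (_ * _%:E).
suff <- : trunc0 h (word_path w o) = word_path (take h w) o by rewrite !indicE.
apply/funext => k; rewrite /word_path /trunc size_take sw.
have [hm|] := ltnP h (h + m)%N.
  by have [kh|//] := ltnP k h; rewrite (ltn_trans kh hm) take_takel.
rewrite -{2}(addn0 h) leq_add2l leqn0 => /eqP ->; rewrite addn0.
by have [kh|//] := ltnP k h; rewrite take_takel.
Qed.

Definition good_mass o := forall u : word,
  nu o (cylinder u) = (mandelbrot_mass (N ^~ o) (psi ^~ o) u)%:E.

(** The event is a union of cylinders of length [h], each of mass at most a liminf of weights; Fatou
    over words takes the liminf out of the sum. *)
Lemma le_ray_bound h A o : measurable A -> good_mass o ->
  nu o [set t | A (ray_path (X ^~ o) h t)] <= ray_bound h A o.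
Proof.
move=> mA go.
pose F w := if `[< A (word_path w o) >] then cylinder w else set0.
apply: (@le_trans _ _ (wsum h (fun w => nu o (F w)))).
  apply: le_wsum_measure => [w||t].
  - by rewrite /F; case: asboolP => // _; exact: measurable_cylinder.
  - exact: measurable_ray_event.
  - rewrite /= (@ray_path_word _ h t o)// => At; exists (mkseq t h); first by rewrite size_mkseq.
    by rewrite /F asboolT//= /cylinder/= size_mkseq.
apply: le_trans; last first.
  by apply: wsum_liminf => m w; apply: wsum_ge0 => v; rewrite lee_fin mulr_ge0 ?word_weight_ge0.
apply: le_wsum => // w _; rewrite /F; case: asboolP => Aw; last first.
  rewrite measure0 limn_einf_lim; apply: lime_ge; first exact: is_cvg_einfs.
  apply: nearW => m; apply: le_ereal_inf_tmp => _ [k /= _ <-].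
  by apply: wsum_ge0 => v; rewrite lee_fin mulr_ge0 ?word_weight_ge0.
rewrite go; apply: le_trans; first exact: (le_mandelbrot_mass N X psi).
rewrite (_ : \1_A _ = 1%R); last by rewrite indicE mem_set.
rewrite le_eqVlt; apply/orP; left; apply/eqP; congr limn_einf; apply/funext => m.
by apply: eq_wsum => v _; rewrite mulr1.
Qed.

(** The double sum of the [ray_bound] has finite expectation, hence is almost surely finite, and the
    classical lemma applies to [nu o]. Uniting the events over [m] for each [n] makes [n0] uniform
    in [m]. *)
Lemma ray_Borel_Cantelli (h : nat -> nat -> nat)
    (A : nat -> nat -> set (pathType (rVType R d))) :
  {ae P, forall o, good_mass o} ->
  (forall n m, measurable (A n m)) ->
  \sum_(n <oo) \sum_(m <oo) rho (h n m) (A n m) < +oo ->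
  {ae P, forall o, {ae nu o, forall t, exists n0, forall n m, (n0 <= n)%N ->
     ~ A n m (ray_path (X ^~ o) (h n m) t)}}.
Proof.
move=> ago mA sA.
pose H o := \sum_(n <oo) \sum_(m <oo) ray_bound (h n m) (A n m) o.
have mHn n : measurable_fun setT (fun o => \sum_(m <oo) ray_bound (h n m) (A n m) o).
  apply: ge0_emeasurable_sum => [m o _ _|m _]; first exact: ray_bound_ge0.
  exact: measurable_ray_bound.
have mH : measurable_fun setT H.
  by apply: ge0_emeasurable_sum => [n o _ _|n _]; [apply: nneseries_ge0 => *; exact: ray_bound_ge0|].
have H0 o : 0 <= H o.
  by apply: nneseries_ge0 => n _ _; apply: nneseries_ge0 => *; exact: ray_bound_ge0.
have iH : P.-integrable setT H.
  apply/integrableP; split => //; under eq_integral do rewrite gee0_abs//.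
  apply: le_lt_trans sA; rewrite integral_nneseries//; last first.
    by move=> n o _; apply: nneseries_ge0 => *; exact: ray_bound_ge0.
  apply: lee_nneseries => [n _ _|n _].
    by apply: integral_ge0 => o _; apply: nneseries_ge0 => *; exact: ray_bound_ge0.
  rewrite integral_nneseries//; last 2 first.
  - by move=> m; exact: measurable_ray_bound.
  - by move=> m o _; exact: ray_bound_ge0.
  apply: lee_nneseries => [m _ _|m _]; last exact: integral_ray_bound.
  by apply: integral_ge0 => o _; exact: ray_bound_ge0.
have := integrable_ae measurableT iH.
apply: filterS2 ago => o go /(_ I) Hfin.
pose E n := \bigcup_m [set t | A n m (ray_path (X ^~ o) (h n m) t)] : set rayType.
have mE n : measurable (E n).
  by apply: bigcup_measurable => m _; exact: measurable_ray_event.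
have nE : nu o (lim_sup_set E) = 0.
  apply: lim_sup_set_cvg0 => //; apply: (@le_lt_trans _ _ (H o)); last first.
    by rewrite -ge0_fin_numE.
  apply: lee_nneseries => // n _.
  apply: le_trans; first apply: generalized_Boole_inequality => //.
  - by move=> m; exact: measurable_ray_event.
  - exact: mE.
  by apply: lee_nneseries => // m _; exact: le_ray_bound.
exists (lim_sup_set E); split => //.
  apply: bigcap_measurable => // n _; apply: bigcup_measurable => k _; exact: mE.
move=> t /= /forallNP hn n _ /=.
have /existsNP[k /existsNP[m]] := hn n.
move=> /not_implyP[nk /contrapT Akm]; exists k => //; by exists m.
Qed.

End rays.

(** * Sums over sliding windows *)

Section measurable_comparison.
Context {d : measure_display} {T : measurableType d} {R : realType}.
Variables f g : T -> R.
Hypotheses (mf : measurable_fun setT f) (mg : measurable_fun setT g).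

Lemma measurable_ler_set : measurable [set x | f x <= g x].
Proof. by have := measurable_fun_ler mf mg measurableT (I : measurable (set1 true)); rewrite setTI. Qed.

Lemma measurable_ltr_set : measurable [set x | f x < g x].
Proof. by have := measurable_fun_ltr mf mg measurableT (I : measurable (set1 true)); rewrite setTI. Qed.

End measurable_comparison.

Section block_sums.
Context {R : realType} {d : nat}.
Local Notation rV := (rVType R d).
Local Notation trunc0 := (@trunc _ rV 0).

Definition psum n j (x : pathType rV) : rV := (\sum_(k < n) (x (j + k)%N : 'rV[R]_d))%R.

Lemma measurable_psum n j : measurable_fun setT (psum n j).
Proof.
apply: measurable_rV => i.
rewrite (_ : (fun _ => _) = fun x : pathType rV => \sum_(k < n) (x (j + k)%N ord0 i)).
  apply: measurable_sum => k.
  exact: (measurableT_comp (measurable_rV_coord i) (measurable_coord _)).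
by apply/funext => x; rewrite /psum summxE.
Qed.

Lemma psum_pshift n j r x : psum n j (pshift r x) = psum n (r + j) x.
Proof. by apply: eq_bigr => k _; rewrite /pshift addnA. Qed.

Lemma psum_trunc n j a x : (j + n <= a)%N -> psum n j (trunc0 a x) = psum n j x.
Proof.
move=> jna; apply: eq_bigr => k _; rewrite /trunc (leq_trans _ jna)//.
by rewrite ltn_add2l.
Qed.

Lemma psumD m n j x : psum (m + n) j x = psum m j x + psum n (j + m) x :> 'rV[R]_d.
Proof.
rewrite /psum big_split_ord/=; congr (_ + _).
by apply: eq_bigr => k _; rewrite addnA.
Qed.

End block_sums.

Section block_laws.
Context {R : realType} {d : nat}.
Local Notation rV := (rVType R d).
Local Notation trunc0 := (@trunc _ rV 0).
Variable mu : probability rV R.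
Local Notation rho := (rho mu 0%R).
Local Open Scope ereal_scope.

Lemma rho_window a b c (A : set (pathType rV)) : measurable A ->
  rho (a + (b + c)) [set x | A (trunc0 b (pshift a x))] = rho b A.
Proof.
move=> mA.
have mt : measurable (trunc0 b @^-1` A).
  by rewrite -[X in measurable X]setTI; exact: measurable_trunc.
have ms : measurable (pshift a @^-1` (trunc0 b @^-1` A)).
  by rewrite -[X in measurable X]setTI; exact: measurable_pshift.
have mI (B : set (pathType rV)) : measurable B -> measurable_fun setT (EFin \o \1_B : _ -> \bar R).
  by move=> mB; apply/measurable_EFinP; exact: measurable_indic.
have i1 k : \int[rho k]_x cst 1 x = 1.
  by rewrite integral_cst// mul1e; exact: probability_setT.
transitivity (rho (b + c) (trunc0 b @^-1` A)).
  rewrite [LHS]measure_integral_indic// [RHS]measure_integral_indic//.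
  have := @integral_rho_split _ _ _ mu 0%R a (b + c) (cst 1) (EFin \o \1_(trunc0 b @^-1` A)).
  rewrite i1 mul1e => <-//; last 2 first.
  - exact: mI.
  - by move=> x; rewrite lee_fin.
  by apply: eq_integral => x _; rewrite mul1e.
rewrite [LHS]measure_integral_indic// [RHS]measure_integral_indic//.
have := @integral_rho_split _ _ _ mu 0%R b c (EFin \o \1_A) (cst 1).
rewrite i1 mule1 => <-//; last 2 first.
- exact: mI.
- by move=> x; rewrite lee_fin.
by apply: eq_integral => x _; rewrite mule1.
Qed.

Lemma measurable_psum_set n j (B : set rV) : measurable B ->
  measurable [set x | B (psum n j x)].
Proof.
by move=> mB; rewrite -[X in measurable X]setTI; exact: (measurable_psum n j measurableT mB).
Qed.

Lemma rho_psum n j c (B : set rV) : measurable B ->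
  rho (j + (n + c)) [set x | B (psum n j x)] = rho n [set x | B (psum n 0 x)].
Proof.
move=> mB; rewrite -(rho_window j n c); last exact: measurable_psum_set.
congr (rho _ _); apply/seteqP; split=> x /=;
  by rewrite psum_trunc ?add0n// psum_pshift addn0.
Qed.

Definition Epsum n (g : rV -> R) : \bar R := \int[rho n]_x (g (psum n 0 x))%:E.

Lemma integral_blocks n K (g : rV -> R) : measurable_fun setT g -> (forall y, (0 <= g y)%R) ->
  \int[rho (K * n)]_x (\prod_(i < K) g (psum n (i * n) x))%:E =
  \prod_(i < K) Epsum n g.
Proof.
move=> mg g0; elim: K => [|K IH].
  rewrite mul0n big_ord0; under eq_integral do rewrite big_ord0.
  by rewrite (integral_cst _ _ 1) // mul1e; exact: probability_setT.
rewrite mulSn big_ord_recl/= -IH.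
pose F (x : pathType rV) := (g (psum n 0 x))%:E.
pose G (x : pathType rV) := (\prod_(i < K) g (psum n (i * n) x))%:E.
have := @integral_rho_split _ _ _ mu 0%R n (K * n) F G.
rewrite /Epsum => <-.
- apply: eq_integral => x _; rewrite /F /G -EFinM big_ord_recl psum_trunc ?add0n//.
  by congr (_ * _)%:E; apply: eq_bigr => i _; rewrite psum_pshift -mulSn.
- by apply/measurable_EFinP; apply: measurableT_comp => //; exact: measurable_psum.
- by move=> x; rewrite lee_fin.
- apply/measurable_EFinP; apply: measurable_prod => i _.
  by apply: measurableT_comp => //; exact: measurable_psum.
- by move=> x; rewrite lee_fin prodr_ge0.
Qed.

Lemma block_Markov n K (f : rV -> R) (S : set (pathType rV)) (b c : R) :
  measurable_fun setT f -> (forall y, (0 <= f y)%R) -> measurable S -> (0 < b)%R ->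
  Epsum n f <= c%:E ->
  (forall x, S x -> (b <= \prod_(i < K) f (psum n (i * n) x))%R) ->
  rho (K * n) S <= (c ^+ K / b)%:E.
Proof.
move=> mf f0 mS b0 Ec Sb.
rewrite EFinM muleC lee_pdivlMl//.
rewrite measure_integral_indic// -ge0_integralZl//; last 2 first.
- by apply/measurable_EFinP; exact: measurable_indic.
- exact: ltW.
apply: (@le_trans _ _ (\int[rho (K * n)]_x (\prod_(i < K) f (psum n (i * n) x))%:E)).
  apply: ge0_le_integral => //.
  - by move=> x _; rewrite -EFinM lee_fin mulr_ge0// ltW.
  - by apply: measurable_funeM; apply/measurable_EFinP; exact: measurable_indic.
  - apply/measurable_EFinP; apply: measurable_prod => i _.
    by apply: measurableT_comp => //; exact: measurable_psum.
  - move=> x _; rewrite -EFinM lee_fin indicE.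
    have [Sx|Sx] := pselect (S x); first by rewrite mem_set// mulr1 Sb.
    by rewrite memNset// mulr0 prodr_ge0.
have E0 : 0 <= Epsum n f by apply: integral_ge0 => x _; rewrite lee_fin.
rewrite integral_blocks//; elim: K {Sb} => [|K IH]; first by rewrite big_ord0 expr0.
by rewrite big_ord_recl exprS EFinM lee_pmul// prode_ge0.
Qed.

(** From [1 - y <= expR (- y)], because (1 + 2 y)(1 - y) >= 1 on this interval. *)
Lemma expR_le_1D2 (y : R) : (0 <= y <= 2^-1 -> expR y <= 1 + 2 * y)%R.
Proof.
move=> /andP[y0 y1].
have h : (1 - y <= expR (- y))%R by rewrite expR_ge1Dx.
have e0 := expR_gt0 y.
have : (expR y * (1 - y) <= 1)%R.
  by rewrite -[leRHS](expRxMexpNx_1 y) ler_wpM2l// ltW.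
by move=> h2; nra.
Qed.

(** As [g] may lack exponential moments, it is truncated at [A], the larger blocks being left to the
    union bound. For the truncated sum, the expectation of exp(min(A, g) / (2 A)) is at most 1 + M /
    A, and the threshold 4 K M leaves exp(-K M / A). *)
Lemma block_upper n K (g : rV -> R) (A M delta : R) :
  measurable_fun setT g -> (forall y, (0 <= g y)%R) -> (0 < A)%R ->
  Epsum n g <= M%:E -> rho n [set x | (A < g (psum n 0 x))%R] <= delta%:E ->
  rho (K * n) [set x | (K%:R * M *+ 4 <= \sum_(i < K) g (psum n (i * n) x))%R] <=
  (K%:R * delta + expR (- (K%:R * M / A)))%:E.
Proof.
move=> mg g0 A0 EM dA.
have M0 : (0 <= M)%R.
  by rewrite -lee_fin (le_trans _ EM)//; apply: integral_ge0 => x _; rewrite lee_fin.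
have mgp i : measurable_fun setT (fun x : pathType rV => g (psum n i x)).
  by apply: measurableT_comp => //; exact: measurable_psum.
pose big i : set (pathType rV) := [set x | (A < g (psum n (i * n) x))%R].
have mB : measurable [set y : rV | (A < g y)%R].
  exact: (measurable_ltr_set (measurable_cst A) mg).
pose S : set (pathType rV) := [set x |
  (K%:R * M *+ 4 <= \sum_(i < K) Num.min A (g (psum n (i * n) x)))%R].
have mS : measurable S.
  apply: measurable_ler_set => //; apply: measurable_sum => i.
  exact: measurable_minr.
have mbig i : measurable (big i) := @measurable_psum_set n (i * n) _ mB.
apply: (@le_trans _ _ (rho (K * n) ((\big[setU/set0]_(i < K) big i) `|` S))).
  apply: le_measure; rewrite ?inE.
  - by apply: measurable_ler_set => //; apply: measurable_sum => i.
  - by apply: measurableU => //; exact: bigsetU_measurable.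
  - move=> x /= h; have [[i hi]|/forallNP hx] := pselect (exists i : 'I_K, big i x).
      by left; rewrite -bigcup_mkord; exists i => /=.
    right; rewrite /S /= (le_trans h)// ler_sum// => i _.
    by rewrite le_min lexx andbT; move/negP: (hx i); rewrite -leNgt.
rewrite EFinD; apply: le_trans; first apply: measureU2 => //.
  exact: bigsetU_measurable.
apply: leeD.
  apply: le_trans; first exact: Boole_inequality.
  rewrite (_ : (K%:R * delta)%:E = \sum_(i < K) delta%:E); last first.
    by rewrite sumEFin sumr_const card_ord mulr_natl.
  apply: lee_sum => i _; apply: le_trans dA.
  have iK : (i * n + (n + (K - i.+1) * n) = K * n)%N.
    by rewrite addnA -mulSnr -mulnDl subnKC.
  have := @rho_psum n (i * n) ((K - i.+1) * n) [set y | (A < g y)%R] mB.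
  by rewrite iK => h; rewrite le_eqVlt; apply/orP; left; apply/eqP; exact: h.
(* Dividing by 2 A keeps the exponent in the range of [expR_le_1D2]. *)
pose f y := expR (Num.min A (g y) / (A *+ 2)).
have mf : measurable_fun setT f.
  apply: (measurableT_comp (@measurable_expR R)).
  apply: measurable_funM; last exact: measurable_cst.
  by apply: measurable_minr => //; exact: measurable_cst.
apply: le_trans; first apply: (@block_Markov n K f S (expR (K%:R * M *+ 4 / (A *+ 2))) (1 + M / A)%R) => //.
- by move=> y; exact: expR_ge0.
- exact: expR_gt0.
- apply: (@le_trans _ _ (\int[rho n]_x (cst 1 x + (A^-1)%:E * (g (psum n 0 x))%:E))).
    apply: ge0_le_integral => //.
    + by move=> x _; rewrite lee_fin expR_ge0.
    + by apply/measurable_EFinP; apply: measurableT_comp => //; exact: measurable_psum.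
    + apply: emeasurable_funD => //; apply: measurable_funeM.
      exact/measurable_EFinP.
    + move=> x _; rewrite -EFinM -EFinD lee_fin /f.
      have m0 : (0 <= Num.min A (g (psum n 0 x)))%R by rewrite le_min g0 ltW.
      apply: le_trans; first apply: expR_le_1D2.
        apply/andP; split; first by rewrite divr_ge0// mulrn_wge0// ltW.
        by rewrite ler_pdivrMr ?pmulrn_lgt0// (_ : 2^-1 * (A *+ 2) = A)%R; [rewrite ge_min lexx|lra].
      set m := Num.min _ _; have -> : (2 * (m / (A *+ 2)) = A^-1 * m)%R.
        by field; rewrite gt_eqF.
      rewrite lerD2l /m.
      by rewrite ler_wpM2l ?invr_ge0 ?(ltW A0)// ge_min lexx orbT.
  rewrite ge0_integralD//; last 2 first.
  - by move=> x _; rewrite -EFinM lee_fin mulr_ge0// invr_ge0 ltW.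
  - by apply: measurable_funeM; exact/measurable_EFinP.
  rewrite integral_cst// mul1e ge0_integralZl//; last 3 first.
  - by apply/measurable_EFinP.
  - by move=> x _; rewrite lee_fin.
  - by rewrite lee_fin invr_ge0 ltW.
  rewrite EFinD leeD//; first by rewrite le_eqVlt; apply/orP; left; apply/eqP; exact: probability_setT.
  rewrite mulrC EFinM lee_wpmul2l//.
  by rewrite lee_fin invr_ge0 ltW.
- move=> x Sx; rewrite -expR_sum ler_expR -mulr_suml ler_pM2r//.
  by rewrite invr_gt0 pmulrn_lgt0.
rewrite lee_fin.
apply: (@le_trans _ _ (expR (M / A) ^+ K / expR (K%:R * M *+ 4 / (A *+ 2)))%R).
  rewrite ler_pM2r ?invr_gt0 ?expR_gt0// lerXn2r ?nnegrE ?expR_ge0 ?expR_ge1Dx//.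
  by rewrite addr_ge0// divr_ge0// ltW.
rewrite -expRM_natl -expRB ler_expR.
have -> : (K%:R * M *+ 4 / (A *+ 2) = 2 * (K%:R * (M / A)))%R.
  by field; rewrite gt_eqF.
by rewrite mulrA; set a := (_ / A)%R; nra.
Qed.

(** Since 1 - 1/e >= 1/2, the expectation of exp(-\1_B) is at most 1 - p / 2 <= exp(-p / 2); the
    threshold K p / 4 leaves half of the exponent. *)
Lemma block_lower n K (B : set rV) (p : R) : measurable B ->
  p%:E <= rho n [set x | B (psum n 0 x)] ->
  rho (K * n) [set x | (\sum_(i < K) \1_B (psum n (i * n) x) <= K%:R * p / 4)%R] <=
  (expR (- (K%:R * p / 4)))%:E.
Proof.
move=> mB pB.
pose f y : R := expR (- \1_B y).
have mf : measurable_fun setT f.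
  by apply: measurableT_comp => //; apply: measurableT_comp => //; exact: measurable_indic.
have mI : measurable_fun setT (fun x : pathType rV => \1_B (psum n 0 x) : R).
  by apply: (measurableT_comp (measurable_indic mB)); exact: measurable_psum.
have Ef : Epsum n f <= (expR (- (p / 2)))%:E.
  apply: (@le_trans _ _ (1 - p / 2)%:E); last by rewrite lee_fin expR_ge1Dx.
  rewrite EFinB leeBrDr//.
  apply: (@le_trans _ _ (Epsum n f + (2^-1)%:E * rho n [set x | B (psum n 0 x)])).
    by rewrite leeD2l// mulrC EFinM lee_wpmul2l// lee_fin.
  rewrite (measure_integral_indic (rho n) (measurable_psum_set _ _ mB)).
  rewrite -ge0_integralZl//; last first.
    by apply/measurable_EFinP; apply: measurable_indic; exact: measurable_psum_set.
  rewrite -ge0_integralD//; last 3 first.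
  - by move=> x _; rewrite lee_fin expR_ge0.
  - apply/measurable_EFinP; apply: measurableT_comp => //; exact: measurable_psum.
  - apply: measurable_funeM; apply/measurable_EFinP; apply: measurable_indic.
    exact: measurable_psum_set.
  apply: (@le_trans _ _ (\int[rho n]_x cst 1 x)); last first.
    by rewrite integral_cst// mul1e le_eqVlt; apply/orP; left; apply/eqP; exact: probability_setT.
  apply: ge0_le_integral => //.
  - by move=> x _; rewrite -EFinM -EFinD lee_fin addr_ge0 ?expR_ge0// mulr_ge0.
  - apply: emeasurable_funD.
      by apply/measurable_EFinP; apply: measurableT_comp => //; exact: measurable_psum.
    apply: measurable_funeM; apply/measurable_EFinP; apply: measurable_indic.
    exact: measurable_psum_set.
  - move=> x _; rewrite -EFinM -EFinD lee_fin /f.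
    have [Bx|Bx] := pselect (B (psum n 0 x)); last first.
      by rewrite indicE memNset// [\1_[set _ | _] x]indicE memNset// mulr0 oppr0 expR0 addr0.
    rewrite indicE mem_set// [\1_[set _ | _] x]indicE mem_set// mulr1 expRN.
    have e2 : (2 <= expR 1 :> R)%R by have := @expR_ge1Dx R 1; lra.
    by rewrite -lerBrDr -[leRHS](_ : 2^-1 = _)%R ?lef_pV2 ?posrE ?expR_gt0//; lra.
apply: le_trans; first apply: (@block_Markov n K f _ (expR (- (K%:R * p / 4))) (expR (- (p / 2)))) => //.
- by move=> y; exact: expR_ge0.
- apply: measurable_ler_set => //; apply: measurable_sum => i.
  by apply: (measurableT_comp (measurable_indic mB)); exact: measurable_psum.
- exact: expR_gt0.
- by move=> x /= Sx; rewrite -expR_sum ler_expR sumrN lerN2.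
rewrite lee_fin -expRM_natl -expRB ler_expR.
by rewrite le_eqVlt; apply/orP; left; apply/eqP; field.
Qed.

End block_laws.

Section exponentials.
Context {R : realType}.
Implicit Types (c C z : R) (n m k : nat).

Lemma nat_le_expR c n : 0 < c -> n%:R <= c^-1 * expR (c * n%:R).
Proof.
move=> c0; rewrite -ler_pdivrMl ?invr_gt0// invrK.
by apply: le_trans (expR_ge1Dx _); rewrite lerDr.
Qed.

Lemma near_le_expR c C : 0 < c -> exists n0, forall n, (n0 <= n)%N -> C <= expR (c * n%:R).
Proof.
move=> c0; exists (Num.truncn (`|C| / c)).+1 => n nn.
apply: le_trans (ler_norm C) _; apply: le_trans (expR_ge1Dx _).
have : `|C| / c < n%:R.
  by apply: lt_le_trans (truncnS_gt _) _; rewrite ler_nat.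
by rewrite ltr_pdivrMr// mulrC => h; lra.
Qed.

Lemma expRN_expR_le z : expR (- expR z) <= expR (- z).
Proof. by rewrite ler_expR lerN2; apply: le_trans (expR_ge1Dx _); rewrite lerDr. Qed.

Lemma expRN_le_inv (y : R) : 0 < y -> expR (- y) <= y^-1.
Proof.
move=> y0; rewrite expRN lef_pV2 ?posrE ?expR_gt0//.
by apply: le_trans (expR_ge1Dx _); rewrite lerDr.
Qed.

Lemma exp2_expR m : (2 ^ m)%N%:R = expR (ln 2 * m%:R) :> R.
Proof. by rewrite mulrC expRM_natl lnK ?posrE// natrX. Qed.

Lemma nneseries_geometric_le (a z : R) : 0 <= a -> 0 <= z < 1 ->
  (\sum_(i <oo) (a * z ^+ i)%:E <= (a / (1 - z))%:E)%E.
Proof.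
move=> a0 /andP[z0 z1]; apply: lime_le.
  by apply: is_cvg_nneseries => i _ _; rewrite lee_fin mulr_ge0// exprn_ge0.
apply: nearW => n; rewrite sumEFin lee_fin -mulr_sumr ler_wpM2l//.
rewrite -[leRHS]mul1r ler_pdivlMr ?subr_gt0// mulrC big_mkord -opprB mulNr -subrX1.
by rewrite opprB lerBlDr lerDl exprn_ge0.
Qed.

Lemma double_geometric_lty (f : nat -> nat -> \bar R) (C a b : R) :
  0 <= C -> 0 < a -> 0 < b -> (forall n m, 0 <= f n m)%E ->
  (forall n m, f n m <= (C * expR (- (a * m%:R)) * expR (- (b * n%:R)))%:E)%E ->
  (\sum_(n <oo) \sum_(m <oo) f n m < +oo)%E.
Proof.
move=> C0 a0 b0 f0 fC.
have e1 (c : R) : 0 < c -> 0 <= expR (- c) < 1.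
  by move=> c0; rewrite expR_ge0 -expR0 ltr_expR oppr_lt0.
have eX (c : R) n : expR (- (c * n%:R)) = expR (- c) ^+ n.
  by rewrite -expRM_natl mulrN [n%:R * c]mulrC.
apply: (@le_lt_trans _ _ (\sum_(n <oo) (C / (1 - expR (- a)) * expR (- b) ^+ n)%:E)%E); last first.
  apply: le_lt_trans; first apply: nneseries_geometric_le; rewrite ?ltry ?e1//.
  by rewrite divr_ge0// subr_ge0 ltW//; case/andP: (e1 _ a0).
apply: lee_nneseries => [n _ _|n _]; first exact: nneseries_ge0.
apply: (@le_trans _ _ (\sum_(m <oo) (C * expR (- b) ^+ n * expR (- a) ^+ m)%:E)%E).
  by apply: lee_nneseries => // m _; rewrite -!eX mulrAC.
apply: le_trans; first apply: nneseries_geometric_le; rewrite ?e1//.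
  by rewrite mulr_ge0// exprn_ge0// expR_ge0.
by rewrite lee_fin mulrAC.
Qed.

End exponentials.

Lemma big_ord_mul (R : nmodType) (f : nat -> R) K n :
  \sum_(j < K * n) f j = \sum_(i < K) \sum_(r < n) f (i * n + r)%N.
Proof.
elim: K => [|K IH]; first by rewrite mul0n !big_ord0.
rewrite mulSnr big_split_ord/= big_ord_recr/= -IH; congr (_ + _).
Qed.

Section rare_events.
Context {R : realType} {d : nat}.
Local Notation rV := (rVType R d).
Local Notation trunc0 := (@trunc _ rV 0).
Variable mu : probability rV R.
Local Notation rho := (rho mu 0%R).
Local Notation Epsum := (Epsum mu).

(* A property of infinite paths that holds as soon as a summable family of
   finite-horizon events occurs only for finitely many n. *)
Definition rarely_fails (Q : pathType rV -> Prop) : Prop :=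
  exists (h : nat -> nat -> nat) (A : nat -> nat -> set (pathType rV)),
  [/\ forall n m, measurable (A n m),
     (\sum_(n <oo) \sum_(m <oo) rho (h n m) (A n m) < +oo)%E &
     forall y, (exists n0, forall n m, (n0 <= n)%N -> ~ A n m (trunc0 (h n m) y)) -> Q y].

(** The horizon K n + n is common to all residues [r], so that their events can be united. The
    second hypothesis says that [Q] depends on the first [K] blocks only. *)
Lemma rho_blocks n K (r : 'I_n) (Q : (nat -> rV) -> Prop) :
  measurable [set x : pathType rV | Q (fun i => psum n (i * n) x)] ->
  (forall u v, (forall i, (i < K)%N -> u i = v i) -> Q u -> Q v) ->
  rho (K * n + n) [set x | Q (fun i => psum n (r + i * n) x)] =
  rho (K * n) [set x | Q (fun i => psum n (i * n) x)].
Proof.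
move=> mQ Qext; rewrite -(rho_window mu r (K * n) (n - r))//.
have -> : (r + (K * n + (n - r)) = K * n + n)%N.
  by rewrite addnCA subnKC// ltnW.
have e x i : (i < K)%N -> psum n (i * n) (trunc0 (K * n) (pshift r x)) = psum n (r + i * n) x.
  by move=> iK; rewrite psum_trunc ?psum_pshift// -mulSnr leq_mul2r iK orbT.
by congr (rho _ _); apply/seteqP; split=> x /=; apply: Qext => i iK; rewrite e.
Qed.

(** The tail hypothesis has the form of Markov's inequality for a moment of order 1 + s; it makes
    the failures decay in the number of blocks as well. Numbers of blocks 2^m suffice, the sum being
    monotone in [k]. *)
Lemma upper_block_sums (g : nat -> rV -> R) (a : R) :
  (forall n, measurable_fun setT (g n)) -> (forall n y, 0 <= g n y) ->
  (forall e : R, 0 < e -> exists (s : R) (n1 : nat), 0 < s <= 1 /\ forall n, (n1 <= n)%N ->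
     (Epsum n (g n) <= (expR (n%:R * (a + e)))%:E)%E /\
     forall al : R, (rho n [set x | (expR al < g n (psum n 0 x))%R] <=
        (expR (n%:R * ((1 + s) * a + e) - (1 + s) * al))%:E)%E) ->
  forall e : R, 0 < e -> rarely_fails (fun y => exists n0, forall n k, (n0 <= n)%N -> (0 < k)%N ->
    \sum_(j < n * k) g n (psum n j y) <= (n * k)%:R * expR (n%:R * (a + e))).
Proof.
move=> mg g0 hg e e0.
have e8 : 0 < e / 8 by rewrite divr_gt0.
have [s [n1 [/andP[s0 s1] {}hg]]] := hg _ e8.
pose th : R := ln 2.
have th0 : 0 < th by rewrite ln_gt0// ltr1n.
pose M n := expR (n%:R * (a + e / 2)).
pose E n r m : set (pathType rV) := [set x |
  (2 ^ m)%N%:R * M n *+ 4 <= \sum_(i < 2 ^ m) g n (psum n (r + i * n) x)].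
have mE n r m : measurable (E n r m).
  apply: measurable_ler_set => //; apply: measurable_sum => i.
  by apply: measurableT_comp => //; exact: measurable_psum.
pose A n m : set (pathType rV) := if (n1 <= n)%N then \big[setU/set0]_(r < n) E n r m else set0.
exists (fun n m => 2 ^ m * n + n)%N, A; split.
- by move=> n m; rewrite /A; case: ifP => // _; exact: bigsetU_measurable.
- apply: (@double_geometric_lty _ _ (2 * (e / 16)^-1) (th * s / 3) (e / 16)).
  + by rewrite mulr_ge0// invr_ge0 divr_ge0// ltW.
  + by rewrite divr_gt0// mulr_gt0.
  + by rewrite divr_gt0.
  + by move=> n m.
  move=> n m; rewrite /A; case: ifPn => nn; last first.
    rewrite measure0 lee_fin mulr_ge0 ?expR_ge0// mulr_ge0 ?expR_ge0//.
    by rewrite mulr_ge0// invr_ge0 divr_ge0// ltW.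
  have [EM Eal] := hg n nn.
  have rE (r : 'I_n) : (rho (2 ^ m * n + n) (E n r m) <=
      (2 * expR (- (th * s / 3 * m%:R)) * expR (- (e / 8 * n%:R)))%:E)%E.
    rewrite (@rho_blocks n (2 ^ m) r (fun u => (2 ^ m)%N%:R * M n *+ 4 <= \sum_(i < 2 ^ m) g n (u i))); last 2 first.
    - by have := mE n 0%N m; rewrite /E; under [X in measurable X]eq_set => x do under eq_bigr => i _ do rewrite add0n.
    - by move=> u v uv; under eq_bigr => i _ do rewrite uv//.
    (* Logarithm of the truncation level. With K = 2^m the union bound gives the power 1 - (1 + s)(1
       - s/3) <= -s/3 of K, as s <= 1, and the Chernoff exponent is K^(s/3) exp(n e / 4): both terms
       decay in m and n. *)
    pose al := (1 - s / 3) * (th * m%:R) + n%:R * (a + e / 4).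
    have EM' : (Epsum n (g n) <= (M n)%:E)%E.
      apply: le_trans EM _; rewrite lee_fin ler_expR ler_wpM2l//.
      by rewrite lerD2l; lra.
    apply: le_trans (block_upper (2 ^ m) (mg n) (g0 n) (expR_gt0 al) EM' (Eal al)) _.
    have m0 : 0 <= th * m%:R by rewrite mulr_ge0// ltW.
    have n0 : 0 <= e * n%:R by rewrite mulr_ge0// ltW.
    set u := th * s / 3 * m%:R; set v := e / 8 * n%:R.
    have -> : 2 * expR (- u) * expR (- v) = expR (- u - v) + expR (- u - v).
      by rewrite expRD; ring.
    rewrite lee_fin lerD//.
      rewrite exp2_expR -expRD ler_expR /al -/th /u /v.
      have -> : th * s / 3 * m%:R = s / 3 * (th * m%:R) by lra.
      move: m0 n0; set p := th * m%:R => p0.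
      have := mulr_ge0 (ltW s0) p0; set q := n%:R => sp0 eq0.
      have ssu : s * (s * p) <= s * p by rewrite ler_piMl.
      have sev : 0 <= s * (e * q) by rewrite mulr_ge0// ltW.
      nra.
    rewrite exp2_expR -expRD -expRN -expRD.
    apply: le_trans (expRN_expR_le _) _; rewrite ler_expR /al -/th.
    by rewrite /u /v; lra.
  apply: le_trans; first exact: (Boole_inequality (rho (2 ^ m * n + n)) (A := fun r => E n r m) (n := n)).
  apply: le_trans; first by apply: lee_sum => r _; exact: rE.
  rewrite sumEFin lee_fin sumr_const card_ord -[leLHS]mulr_natl.
  (* The union over the n residues costs a factor n, absorbed by half of the decay in n. *)
  have e16 : 0 < e / 16 by rewrite divr_gt0.
  have := nat_le_expR n e16.
  have -> : expR (- (e / 8 * n%:R)) = expR (- (e / 16 * n%:R)) * expR (- (e / 16 * n%:R)).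
    by rewrite -expRD; congr expR; lra.
  set x := expR (- (e / 16 * n%:R)); set w := expR (- (_ * m%:R)) => h.
  have xe : expR (e / 16 * n%:R) * x = 1 by exact: expRxMexpNx_1.
  have x0 : 0 < x by exact: expR_gt0.
  have w0 : 0 < w by exact: expR_gt0.
  have h2 : n%:R * x <= (e / 16)^-1.
    by have := ler_wpM2r (ltW x0) h; rewrite -(mulrA _ (expR _)) xe mulr1.
  rewrite [leLHS](_ : _ = (n%:R * x) * (2 * w * x)); last by ring.
  rewrite [leRHS](_ : _ = (e / 16)^-1 * (2 * w * x)); last by ring.
  by rewrite ler_wpM2r// ?mulr_ge0// ltW.
move=> y [n0 hn0].
have e4 : 0 < e / 2 by rewrite divr_gt0.
have [n2 hn2] := near_le_expR 8 e4.
exists (maxn 1 (maxn n1 (maxn n0 n2))) => n k; rewrite !geq_max => /and4P[n_gt0 nn1 nn0 nn2] k0.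
(* The next power of two, at most 2 k. The factors 4 and 2 are absorbed by exp(n e / 2) >= 8. *)
pose m := up_log 2 k.
have km : (k <= 2 ^ m)%N by exact: up_logP.
have mk : (2 ^ m <= 2 * k)%N.
  have [k1|k1] := leqP k 1.
    by rewrite /m (_ : k = 1%N) ?up_log1//; apply/eqP; rewrite eqn_leq k1.
  have /andP[lo _] := up_log_bounds (isT : (1 < 2)%N) k1.
  have m0 : (0 < m)%N by rewrite /m up_log_gt0.
  by rewrite -(prednK m0) expnS leq_mul2l/= ltnW.
have hE (r : 'I_n) : \sum_(i < 2 ^ m) g n (psum n (r + i * n) y) <= (2 ^ m)%N%:R * M n *+ 4.
  have := hn0 n m nn0; rewrite /A nn1 -(bigcup_mkord n (fun r => E n r m)) => hA.
  rewrite leNgt; apply/negP => lt4; apply: hA; exists (val r); first exact: ltn_ord.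
  rewrite /E /=; apply: le_trans (ltW lt4) _; apply: ler_sum => i _.
  rewrite psum_trunc//.
  by rewrite -addnA addnC leq_add// ?(ltnW (ltn_ord r))// -mulSnr leq_mul2r ltn_ord orbT.
apply: (@le_trans _ _ (\sum_(j < 2 ^ m * n) g n (psum n j y))).
  rewrite -!(big_mkord xpredT (fun j => g n (psum n j y))).
  rewrite [leRHS](@big_cat_nat _ _ _ (n * k))//=; last by rewrite mulnC leq_mul2r km orbT.
  by rewrite lerDl sumr_ge0.
rewrite (big_ord_mul (fun j => g n (psum n j y))) exchange_big/=.
apply: (@le_trans _ _ (\sum_(r < n) (2 ^ m)%N%:R * M n *+ 4)).
  apply: ler_sum => r _; apply: le_trans (hE r).
  by rewrite le_eqVlt; apply/orP; left; apply/eqP; apply: eq_bigr => i _; rewrite addnC.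
rewrite sumr_const card_ord -mulrnA -mulr_natr.
have -> : expR (n%:R * (a + e)) = M n * expR (e / 2 * n%:R).
  by rewrite -expRD; congr expR; lra.
have M0 : 0 < M n by exact: expR_gt0.
have := hn2 n nn2; set x := expR _ => x8.
have mk' : (2 ^ m)%N%:R <= 2 * k%:R :> R by rewrite -natrM ler_nat.
rewrite !natrM.
have n0' : 0 <= n%:R :> R by [].
apply: (@le_trans _ _ (n%:R * k%:R * M n * 8)); last first.
  by rewrite !mulrA ler_wpM2l// !mulr_ge0// ltW.
rewrite [leLHS](_ : _ = ((2 ^ m)%N%:R * (n%:R * M n * 4))); last by ring.
rewrite [leRHS](_ : _ = (2 * k%:R) * (n%:R * M n * 4)); last by ring.
by rewrite ler_wpM2r// !mulr_ge0// ltW.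
Qed.

(** Only windows starting at multiples of [n] are counted; the lost factor n is absorbed by the
    exponent. If K blocks of hitting probability at least p have K p >= exp(n e / 4), then
    [block_lower] together with exp(-x) <= 1/x gives summable failures. *)
Lemma lower_block_counts (B : nat -> set rV) (l : R) :
  (forall n, measurable (B n)) ->
  (forall e : R, 0 < e -> exists n1 : nat, forall n, (n1 <= n)%N ->
     ((expR (n%:R * (l - e)))%:E <= rho n [set x | B n (psum n 0 x)])%E) ->
  forall e : R, 0 < e -> rarely_fails (fun y => exists n0, forall n k, (n0 <= n)%N -> (0 < k)%N ->
    expR (n%:R * (e - l)) <= k%:R ->
    (n * k)%:R * expR (n%:R * (l - e)) <= \sum_(j < n * k) \1_(B n) (psum n j y)).
Proof.
move=> mB hl e e0.
have e4 : 0 < e / 4 by rewrite divr_gt0.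
have [n1 {}hl] := hl _ e4.
pose th : R := ln 2.
have th0 : 0 < th by rewrite ln_gt0// ltr1n.
pose p n := expR (n%:R * (l - e / 4)).
pose E n m : set (pathType rV) := [set x |
  \sum_(i < 2 ^ m) \1_(B n) (psum n (i * n) x) <= (2 ^ m)%N%:R * p n / 4].
have mE n m : measurable (E n m).
  apply: measurable_ler_set => //; apply: measurable_sum => i.
  by apply: (measurableT_comp (measurable_indic (mB n))); exact: measurable_psum.
pose A n m : set (pathType rV) :=
  if (n1 <= n)%N && (n%:R * (e / 2 - l) <= th * m%:R) then E n m else set0.
(* The share of the nonnegative excess of log(2^m) over n (e / 2 - l) that is kept as decay in m; it
   is chosen so that sg (e / 2 - l) <= e / 8. *)
pose sg := e / (8 * (`|l| + e)).
have le0 : 0 < `|l| + e by rewrite ltr_wpDl.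
have sg0 : 0 < sg by rewrite divr_gt0// mulr_gt0.
have sg1 : sg * (`|l| + e) = e / 8 by rewrite /sg; field; rewrite gt_eqF.
exists (fun n m => 2 ^ m * n)%N, A; split.
- by move=> n m; rewrite /A; case: ifP.
- apply: (@double_geometric_lty _ _ 4 (sg * th) (e / 8)) => //.
  + by rewrite mulr_gt0.
  + by rewrite divr_gt0.
  move=> n m; rewrite /A; case: ifPn => [/andP[nn nm]|_]; last first.
    by rewrite measure0 lee_fin !mulr_ge0 ?expR_ge0.
  apply: le_trans (block_lower (2 ^ m) (mB n) (hl n nn)) _.
  rewrite lee_fin exp2_expR -expRD -/th.
  set z := _ + _; have z0 : 0 < expR z / 4 by rewrite divr_gt0// expR_gt0.
  apply: le_trans (expRN_le_inv z0) _; rewrite invfM invrK mulrC -expRN -mulrA.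
  rewrite ler_wpM2l// -expRD ler_expR /z.
  have s1 : sg <= 1.
    rewrite /sg ler_pdivrMr ?mulr_gt0// mul1r.
    by have := normr_ge0 l; lra.
  have n_ge0 : 0 <= n%:R :> R by [].
  have ll := ler_norm l; have lN := ler_norm (- l); rewrite normrN in lN.
  have := ler_wpM2r (ltW sg0) ll; have := ler_wpM2r (ltW sg0) lN.
  set q := `|l| in sg1 ll lN le0 * => h1 h2.
  set v := n%:R in n_ge0 nm *; set u := th * m%:R in nm *.
  have y0 : 0 <= u - v * (e / 2 - l) by rewrite subr_ge0.
  have h3 : sg * (u - v * (e / 2 - l)) <= u - v * (e / 2 - l) by rewrite ler_piMl.
  have h4 : v * (sg * (e / 2 - l)) <= v * (e / 8).
    rewrite ler_wpM2l//.
    have : 0 <= sg * e by rewrite mulr_ge0// ltW.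
    by nra.
  have -> : sg * th * m%:R = sg * u by rewrite /u mulrA.
  by nra.
move=> y [n0 hn0].
have e2 : 0 < e / 2 by rewrite divr_gt0.
have e4' : 0 < e / 4 by rewrite divr_gt0.
have [n2 hn2] := near_le_expR 2 e2.
have [n3 hn3] := near_le_expR (8 * (e / 4)^-1) e2.
exists (maxn 1 (maxn n1 (maxn n0 (maxn n2 n3)))) => n k.
rewrite !geq_max => /and5P[n_gt0 nn1 nn0 nn2 nn3] k0 hk.
(* The previous power of two, since counts are now bounded from below; one has k < 2^(m+1), and
   exp(n e / 2) >= 2 absorbs the factor. *)
pose m := trunc_log 2 k.
have mk : (2 ^ m <= k)%N by exact: trunc_logP.
have km : (k < 2 ^ m.+1)%N by exact: trunc_log_ltn.
have M2 : n%:R * (e / 2 - l) <= th * m%:R.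
  rewrite -ler_expR /th -exp2_expR.
  have -> : n%:R * (e / 2 - l) = n%:R * (e - l) - e / 2 * n%:R by lra.
  rewrite expRB ler_pdivrMr ?expR_gt0//.
  apply: le_trans hk _; apply: (@le_trans _ _ ((2 ^ m)%N%:R * 2)).
    by rewrite -natrM ler_nat -expnSr ltnW.
  by rewrite ler_wpM2l// hn2.
have : ~ E n m (trunc0 (2 ^ m * n)%N y) by have := hn0 n m nn0; rewrite /A nn1 M2.
rewrite /E /= => /negP; rewrite -ltNge => lt4.
have {lt4} lt4 : (2 ^ m)%N%:R * p n / 4 <= \sum_(i < 2 ^ m) \1_(B n) (psum n (i * n) y).
  apply: le_trans (ltW lt4) _; apply: ler_sum => i _.
  by rewrite psum_trunc// -mulSnr leq_mul2r ltn_ord orbT.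
apply: (@le_trans _ _ ((2 ^ m)%N%:R * p n / 4)).
  have km' : k%:R <= 2 * (2 ^ m)%N%:R :> R by rewrite -natrM ler_nat -expnS ltnW.
  have -> : expR (n%:R * (l - e)) = p n * expR (- (e / 4 * n%:R)) * expR (- (e / 2 * n%:R)).
    by rewrite -!expRD; congr expR; lra.
  have := nat_le_expR n e4'; have := hn3 n nn3.
  have x1 : expR (e / 4 * n%:R) * expR (- (e / 4 * n%:R)) = 1 by exact: expRxMexpNx_1.
  have z1 : expR (e / 2 * n%:R) * expR (- (e / 2 * n%:R)) = 1 by exact: expRxMexpNx_1.
  have x0 := @expR_gt0 R (- (e / 4 * n%:R)).
  have z0 := @expR_gt0 R (- (e / 2 * n%:R)).
  have p0 : 0 < p n by exact: expR_gt0.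
  move: x1 z1 x0 z0 p0; set x := expR (- _); set z := expR (- _); set xx := expR _; set zz := expR _.
  set c := (e / 4)^-1; set pn := p n; set K := (2 ^ m)%N%:R in km' *.
  move=> x1 z1 x0 z0 p0 h1 h2.
  have {h1} h1 : 8 * c * z <= 1 by have := ler_wpM2r (ltW z0) h1; rewrite z1.
  have {h2} h2 : n%:R * x <= c.
    by have := ler_wpM2r (ltW x0) h2; rewrite -(mulrA c) x1 mulr1.
  rewrite natrM.
  apply: (@le_trans _ _ (k%:R * pn * (c * z))).
    rewrite [leLHS](_ : _ = k%:R * pn * (n%:R * x * z)); last by ring.
    by apply: ler_wpM2l; [rewrite mulr_ge0// ltW|apply: ler_wpM2r h2; exact: ltW].
  apply: (@le_trans _ _ (2 * K * pn * (c * z))).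
    have c0 : 0 <= c by rewrite invr_ge0 ltW.
    by apply: ler_wpM2r; [rewrite mulr_ge0// ltW|apply: ler_wpM2r km'; exact: ltW].
  have K0 : 0 <= K * pn by rewrite mulr_ge0// ltW.
  by have := ler_wpM2l K0 h1; lra.
apply: le_trans lt4 _; rewrite mulnC.
apply: (@le_trans _ _ (\sum_(j < 2 ^ m * n) \1_(B n) (psum n j y))); last first.
  rewrite -!(big_mkord xpredT (fun j => \1_(B n) (psum n j y))).
  rewrite [leRHS](@big_cat_nat _ _ _ (2 ^ m * n))//=; last by rewrite leq_mul2r mk orbT.
  by rewrite lerDl sumr_ge0.
rewrite (big_ord_mul (fun j => \1_(B n) (psum n j y))); apply: ler_sum => i _.
rewrite (bigD1 (Ordinal n_gt0))//= addn0 lerDl sumr_ge0//.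
Qed.

End rare_events.

(** * The logarithmic moment generating function *)

Section dot.
Context {R : realType} {d : nat}.
Implicit Types x y z : 'rV[R]_d.

Lemma dotC x y : dot x y = dot y x.
Proof. by apply: eq_bigr => j _; rewrite mulrC. Qed.

Lemma dotDl x y z : dot (x + y) z = dot x z + dot y z.
Proof. by rewrite -big_split/=; apply: eq_bigr => j _; rewrite mxE mulrDl. Qed.

Lemma dotZl a x z : dot (a *: x) z = a * dot x z.
Proof. by rewrite mulr_sumr; apply: eq_bigr => j _; rewrite mxE mulrA. Qed.

Lemma dotNl x z : dot (- x) z = - dot x z.
Proof. by rewrite -scaleN1r dotZl mulN1r. Qed.

Lemma dotBl x y z : dot (x - y) z = dot x z - dot y z.
Proof. by rewrite dotDl dotNl. Qed.

Lemma dot0l z : dot 0 z = 0.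
Proof. by rewrite -(scale0r 0) dotZl mul0r. Qed.

Lemma dotDr x y z : dot z (x + y) = dot z x + dot z y.
Proof. by rewrite !(dotC z) dotDl. Qed.

Lemma dotZr a x z : dot z (a *: x) = a * dot z x.
Proof. by rewrite !(dotC z) dotZl. Qed.

Lemma dotBr x y z : dot z (x - y) = dot z x - dot z y.
Proof. by rewrite !(dotC z) dotBl. Qed.

Lemma dot_sumr (I : Type) (r : seq I) (F : I -> 'rV[R]_d) z :
  dot z (\sum_(i <- r) F i) = \sum_(i <- r) dot z (F i).
Proof.
elim/big_rec2: _ => [|i u v _ <-]; last by rewrite dotDr.
by rewrite dotC dot0l.
Qed.

Lemma dot_delta j x : dot (delta_mx ord0 j) x = x ord0 j.
Proof.
rewrite /dot (bigD1 j)//= mxE !eqxx mul1r big1 ?addr0// => i ij.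
by rewrite mxE (negbTE ij) andbF mul0r.
Qed.

Lemma measurable_dot (q : 'rV[R]_d) : measurable_fun setT (fun x : rVType R d => dot q x).
Proof.
apply: measurable_sum => j; apply: measurable_funM; first exact: measurable_cst.
exact: measurable_rV_coord.
Qed.

Lemma measurable_expR_dot (q : 'rV[R]_d) :
  measurable_fun setT (fun x : rVType R d => expR (dot q x)).
Proof. by apply: (measurableT_comp (@measurable_expR R)); exact: measurable_dot. Qed.

End dot.

Section scalar_inequalities.
Context {R : realType}.
Implicit Types z u t : R.

(** The tangent inequalities at t u, evaluated at 0 and u with weights 1 - t and t, have linear
    terms that cancel. *)
Lemma expR_convex_0 t u : 0 <= t <= 1 -> expR (t * u) <= 1 - t + t * expR u.
Proof.
move=> /andP[t0 t1].
have h1 : 1 + (u - t * u) <= expR (u - t * u) by exact: expR_ge1Dx.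
have h2 : 1 - t * u <= expR (- (t * u)) by exact: expR_ge1Dx.
have e0 := expR_gt0 (t * u).
have -> : expR u = expR (t * u) * expR (u - t * u) by rewrite -expRD; congr expR; ring.
have h3 : expR (t * u) * expR (- (t * u)) = 1 by exact: expRxMexpNx_1.
set E := expR (t * u) in e0 h3 *; set F := expR (u - _) in h1 *; set G := expR (- _) in h2 h3.
have k1 : E * (1 + (u - t * u)) <= E * F by rewrite ler_wpM2l// ltW.
have k2 : E * (1 - t * u) <= 1 by have := ler_wpM2l (ltW e0) h2; rewrite h3.
have k3 : t * (E * (1 + (u - t * u))) <= t * (E * F) by rewrite ler_wpM2l.
have k4 : (1 - t) * (E * (1 - t * u)) <= (1 - t) * 1 by rewrite ler_wpM2l// subr_ge0.
by lra.
Qed.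

Lemma expR_remainder_ge0 z : 0 <= expR z - 1 - z.
Proof. by have := expR_ge1Dx z; lra. Qed.

Lemma expR_remainder_le z : expR z - 1 - z <= z ^+ 2 * expR `|z|.
Proof.
have h : expR z - 1 <= z * expR z.
  have h2 : 1 - z <= expR (- z) by exact: expR_ge1Dx.
  have := ler_wpM2l (expR_ge0 z) h2; rewrite expRxMexpNx_1; lra.
have h3 : expR z - 1 - z <= z * (expR z - 1) by lra.
apply: le_trans h3 _; rewrite expr2 -mulrA.
have [z0|z0] := leP 0 z.
  rewrite ger0_norm// ler_wpM2l//.
rewrite ltr0_norm// ler_wnM2l//; first exact: ltW.
apply: (@le_trans _ _ z); last by have := expR_ge1Dx z; lra.
by rewrite -[leRHS]mulr1 ler_wnM2l ?(ltW z0)// -expR0 ler_expR oppr_ge0 ltW.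
Qed.

Lemma sqr_le_expR u : u ^+ 2 <= 2 * expR `|u|.
Proof.
have := @expR_ge1Dxn R `|u| 1 (normr_ge0 u).
rewrite real_normK ?num_real// (_ : 2`! = 2)%N//; lra.
Qed.

(* With [u = s y / 2], a bound for the second-order remainder of [expR (t y)]. *)
Lemma expR_remainder_scaled (s t y : R) : 0 < s -> `|t| <= s / 2 ->
  expR (t * y) - 1 - t * y <= 8 / s ^+ 2 * t ^+ 2 * (expR (s * y) + expR (- (s * y))).
Proof.
move=> s0 ts; apply: le_trans (expR_remainder_le _) _.
have h1 : expR `|t * y| <= expR (s / 2 * `|y|) by rewrite ler_expR normrM ler_wpM2r.
have h2 : y ^+ 2 <= 8 / s ^+ 2 * expR (s / 2 * `|y|).
  have := sqr_le_expR (s / 2 * y); rewrite normrM (ger0_norm (_ : 0 <= s / 2)); last first.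
    by rewrite divr_ge0// ltW.
  set E := expR _ => h.
  rewrite -(@ler_pM2l _ (s ^+ 2 / 4)); last by rewrite divr_gt0// exprn_gt0.
  rewrite [leLHS](_ : _ = (s / 2 * y) ^+ 2); last by field.
  rewrite [leRHS](_ : _ = 2 * E)//; field.
  by rewrite gt_eqF.
have h3 : expR (s / 2 * `|y|) * expR (s / 2 * `|y|) <= expR (s * y) + expR (- (s * y)).
  rewrite -expRD; have [y0|y0] := leP 0 y.
    rewrite ger0_norm// (_ : _ + _ = s * y); last by lra.
    by rewrite lerDl expR_ge0.
  rewrite ltr0_norm// (_ : _ + _ = - (s * y)); last by lra.
  by rewrite lerDr expR_ge0.
have E0 := @expR_ge0 R (s / 2 * `|y|).
have t20 : 0 <= t ^+ 2 by exact: sqr_ge0.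
have c0 : 0 <= 8 / s ^+ 2 by rewrite divr_ge0// sqr_ge0.
rewrite exprMn.
apply: (@le_trans _ _ (t ^+ 2 * (8 / s ^+ 2 * expR (s / 2 * `|y|)) * expR (s / 2 * `|y|))).
  apply: ler_pM => //; first by rewrite mulr_ge0 ?sqr_ge0.
  exact: ler_wpM2l.
rewrite [leLHS](_ : _ = 8 / s ^+ 2 * t ^+ 2 * (expR (s / 2 * `|y|) * expR (s / 2 * `|y|))); last by ring.
by rewrite ler_wpM2l// mulr_ge0.
Qed.

End scalar_inequalities.

Section mgf.
Context {R : realType} {d : nat}.
Local Notation rV := (rVType R d).
Variable mu : probability rV R.
Implicit Types q v : 'rV[R]_d.

Definition mgf q : \bar R := (\int[mu]_x (expR (dot q x))%:E)%E.

Let mE q : measurable_fun setT (fun x : rV => (expR (dot q x))%:E).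
Proof. by apply/measurable_EFinP; exact: measurable_expR_dot. Qed.

Lemma mgf_ge0 q : (0 <= mgf q)%E.
Proof. by apply: integral_ge0 => x _; rewrite lee_fin expR_ge0. Qed.

Lemma integrable_expR_dot q : (mgf q < +oo)%E ->
  mu.-integrable setT (EFin \o (fun x : rV => expR (dot q x))).
Proof.
move=> qoo; apply/integrableP; split; first exact: mE.
by under eq_integral do rewrite gee0_abs ?lee_fin ?expR_ge0//.
Qed.

Lemma mgf_fine q : (mgf q < +oo)%E -> mgf q = (fine (mgf q))%:E.
Proof. by move=> qoo; rewrite fineK// ge0_fin_numE// mgf_ge0. Qed.

Section at_point.
Variables (q v : 'rV[R]_d) (s : R).
Hypotheses (s0 : 0 < s) (qoo : (mgf q < +oo)%E).
Hypotheses (qpoo : (mgf (q + s *: v) < +oo)%E) (qmoo : (mgf (q - s *: v) < +oo)%E).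

Let dom x := expR (dot (q + s *: v) x) + expR (dot (q - s *: v) x).

Let idom : mu.-integrable setT (EFin \o dom).
Proof.
rewrite (_ : EFin \o dom = ((EFin \o (fun x : rV => expR (dot (q + s *: v) x))) \+
  (EFin \o (fun x : rV => expR (dot (q - s *: v) x))))%E); last by [].
by apply: integrableD => //; exact: integrable_expR_dot.
Qed.

Let domE x : dom x = expR (dot q x) * (expR (s * dot v x) + expR (- (s * dot v x))).
Proof. by rewrite /dom dotBl !dotDl dotZl mulrDr -!expRD. Qed.

(** The derivative of [mgf] at [q] along [v]; divided by [mgf mu q], the mean of [dot v] under the
    tilted law. *)
Definition tilted_mean := \int[mu]_x (dot v x * expR (dot q x)).

Lemma integrable_tilted :
  mu.-integrable setT (EFin \o (fun x : rV => dot v x * expR (dot q x))).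
Proof.
have iD : mu.-integrable setT (fun x => (s^-1%:E * (EFin \o dom) x)%E).
  exact: integrableZl.
apply: le_integrable iD => //.
  apply/measurable_EFinP; apply: measurable_funM; first exact: measurable_dot.
  exact: measurable_expR_dot.
move=> x _ /=; rewrite lee_fin domE normrM (gtr0_norm (expR_gt0 _)).
rewrite [leRHS]ger0_norm; last by rewrite mulr_ge0 ?invr_ge0 ?(ltW s0)// mulr_ge0 ?addr_ge0 ?expR_ge0.
rewrite mulrC mulrCA ler_wpM2l ?expR_ge0// -ler_pdivrMl ?invr_gt0// invrK.
rewrite -{1}(gtr0_norm s0) -normrM; set y := s * _.
have h1 := expR_ge1Dx y; have h2 := expR_ge1Dx (- y).
have p1 := expR_gt0 y; have p2 := expR_gt0 (- y).
by have [y0|y0] := leP 0 y; [rewrite ger0_norm//|rewrite ltr0_norm//]; lra.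
Qed.

Lemma mgf_quadratic : exists2 C : R, 0 <= C & forall t, `|t| <= s / 2 ->
  (mgf (q + t *: v) < +oo)%E /\
  0 <= fine (mgf (q + t *: v)) - fine (mgf q) - t * tilted_mean <= C * t ^+ 2.
Proof.
exists (8 / s ^+ 2 * \int[mu]_x dom x).
  rewrite mulr_ge0 ?divr_ge0 ?sqr_ge0// Rintegral_ge0// => x _.
  by rewrite /dom addr_ge0 ?expR_ge0.
move=> t ts.
pose rem x := (expR (t * dot v x) - 1 - t * dot v x) * expR (dot q x).
have rem0 x : 0 <= rem x by rewrite mulr_ge0 ?expR_ge0 ?expR_remainder_ge0.
have remd x : rem x <= 8 / s ^+ 2 * t ^+ 2 * dom x.
  rewrite domE [leRHS]mulrCA [leRHS]mulrC ler_wpM2r ?expR_ge0//.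
  exact: expR_remainder_scaled.
have mrem : measurable_fun setT (rem : rV -> R).
  apply: measurable_funM; last exact: measurable_expR_dot.
  have mt : measurable_fun setT (fun x : rV => t * dot v x).
    by apply: measurable_funM; [exact: measurable_cst|exact: measurable_dot].
  apply: measurable_funB => //; apply: measurable_funB => //.
  exact: (measurableT_comp (@measurable_expR R)).
have irem : mu.-integrable setT (EFin \o (rem : rV -> R)).
  apply: (le_integrable _ _ _ (integrableZl measurableT (8 / s ^+ 2 * t ^+ 2) idom)) => //.
    exact/measurable_EFinP.
  move=> x _ /=; rewrite lee_fin ger0_norm// ger0_norm ?remd//.
  exact: le_trans (remd x).
have iq := integrable_expR_dot qoo.
have itq : mu.-integrable setT (EFin \o (fun x : rV => t * (dot v x * expR (dot q x)))).
  exact: (integrableZl measurableT t integrable_tilted).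
have eE x : expR (dot (q + t *: v) x) = rem x + (expR (dot q x) + t * (dot v x * expR (dot q x))).
  by rewrite /rem dotDl dotZl expRD; ring.
have i1 : mu.-integrable setT (EFin \o (fun x : rV => expR (dot q x) + t * (dot v x * expR (dot q x)))).
  exact: (integrableD measurableT iq itq).
have i2 : mu.-integrable setT (EFin \o (fun x : rV => expR (dot (q + t *: v) x))).
  have := integrableD measurableT irem i1; apply: eq_integrable => // x _.
  by rewrite /= eE.
split.
  move/integrableP : i2 => [_].
  by under eq_integral do rewrite gee0_abs ?lee_fin ?expR_ge0//.
have -> : fine (mgf (q + t *: v)) = \int[mu]_x rem x + (\int[mu]_x expR (dot q x) + t * tilted_mean).
  rewrite -RintegralZl//; last exact: integrable_tilted.
  rewrite -RintegralD// -RintegralD//.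
  by apply: eq_Rintegral => x _; rewrite eE.
have -> : fine (mgf q) = \int[mu]_x expR (dot q x) by [].
set I := \int[mu]_x rem x.
rewrite (_ : _ - _ - _ = I); last by ring.
rewrite /I Rintegral_ge0//= mulrAC -RintegralZl//.
apply: le_Rintegral => //; exact: (integrableZl measurableT (8 / s ^+ 2 * t ^+ 2) idom).
Qed.

Hypothesis qgt0 : (0 < mgf q)%E.

Definition tilted_slope := tilted_mean / fine (mgf q).

Let Z := fine (mgf q).

Let Z0 : 0 < Z.
Proof. by rewrite fine_gt0// qgt0. Qed.

(** The defect in Jensen's inequality under the tilted law: nonnegative, and zero exactly where
    [dot v x] equals the slope. *)
Let gap (x : rV) := (expR (dot v x - tilted_slope) - 1 - (dot v x - tilted_slope)) * expR (dot q x).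

Let gap_ge0 x : 0 <= gap x.
Proof. by rewrite mulr_ge0 ?expR_ge0 ?expR_remainder_ge0. Qed.

Let gapE x : gap x = expR (- tilted_slope) * expR (dot (q + v) x) +
  ((tilted_slope - 1) * expR (dot q x) - dot v x * expR (dot q x)).
Proof. by rewrite /gap dotDl !expRD; ring. Qed.

Let integrable_gap2 : mu.-integrable setT
  (EFin \o (fun x : rV => (tilted_slope - 1) * expR (dot q x) - dot v x * expR (dot q x))).
Proof.
exact: (integrableB measurableT (integrableZl measurableT (tilted_slope - 1)
  (integrable_expR_dot qoo)) integrable_tilted).
Qed.

Let integrable_gap : (mgf (q + v) < +oo)%E -> mu.-integrable setT (EFin \o gap).
Proof.
move=> qvoo; have := integrableD measurableT (integrableZl measurableT (expR (- tilted_slope))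
  (integrable_expR_dot qvoo)) integrable_gap2.
by apply: eq_integrable => // x _; rewrite /= gapE.
Qed.

Let integral_gap : (mgf (q + v) < +oo)%E ->
  \int[mu]_x gap x = expR (- tilted_slope) * fine (mgf (q + v)) - Z.
Proof.
move=> qvoo; under eq_Rintegral do rewrite gapE.
rewrite RintegralD//; last first.
  exact: (integrableZl measurableT _ (integrable_expR_dot qvoo)).
rewrite RintegralB//; last 2 first.
- exact: (integrableZl measurableT _ (integrable_expR_dot qoo)).
- exact: integrable_tilted.
rewrite !RintegralZl//; try exact: integrable_expR_dot.
rewrite -/tilted_mean.
have -> : \int[mu]_x expR (dot q x) = Z by [].
have -> : \int[mu]_x expR (dot (q + v) x) = fine (mgf (q + v)) by [].
have -> : tilted_mean = tilted_slope * Z by rewrite /tilted_slope divfK// gt_eqF.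
by ring.
Qed.

Lemma mgf_tangent : ((Z * expR tilted_slope)%:E <= mgf (q + v))%E.
Proof.
have := leey (mgf (q + v)); rewrite le_eqVlt => /predU1P[->|qvoo]; first by rewrite leey.
rewrite (mgf_fine qvoo) lee_fin.
have : 0 <= \int[mu]_x gap x by apply: Rintegral_ge0 => x _; exact: gap_ge0.
rewrite integral_gap// subr_ge0 => h.
have := ler_wpM2r (expR_ge0 tilted_slope) h.
by rewrite mulrAC -expRD addNr expR0 mul1r.
Qed.

(** Equality makes the integral of [gap] vanish, so [dot v] is almost everywhere equal to the slope,
    and the logarithm of [mgf] is affine along the whole line. *)
Lemma mgf_tangent_eq : mgf (q + v) = (Z * expR tilted_slope)%:E ->
  forall th, mgf (q + th *: v) = (Z * expR (th * tilted_slope))%:E.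
Proof.
move=> qvE th; have qvoo : (mgf (q + v) < +oo)%E by rewrite qvE ltry.
have g0 : (\int[mu]_x (gap x)%:E = 0)%E.
  have ig := integrable_gap qvoo.
  rewrite -[LHS]fineK; last exact: integrable_fin_num.
  rewrite -/(Rintegral mu setT gap) integral_gap// qvE /=.
  by rewrite mulrCA -expRD addNr expR0 mulr1 subrr.
have mgap : measurable_fun setT (EFin \o gap).
  by have /integrableP[] := integrable_gap qvoo.
have gae : ae_eq mu setT (EFin \o gap) (cst 0%E).
  apply/(ae_eq_integral_abs mu measurableT mgap).
  by under eq_integral do rewrite gee0_abs ?lee_fin ?gap_ge0//.
have vae : {ae mu, forall x : rV, dot v x = tilted_slope}.
  apply: filterS gae => x /(_ I)/= [] /eqP; rewrite mulf_eq0 (gt_eqF (expR_gt0 _)) orbF => /eqP h.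
  apply/eqP; rewrite -subr_eq0; apply: contraT => /expR_gt1Dx; move: h; lra.
transitivity (\int[mu]_x ((expR (th * tilted_slope))%:E * (expR (dot q x))%:E))%E.
  apply: ae_eq_integral => //.
  - by apply: measurable_funeM; exact: mE.
  apply: filterS vae => x vx _; rewrite dotDl dotZl vx expRD -EFinM mulrC//.
rewrite ge0_integralZl//.
by rewrite -/(mgf q) (mgf_fine qoo) -EFinM mulrC.
Qed.

End at_point.
End mgf.

Section vertices.
Context {R : realType} {d : nat}.
Implicit Types (h x : 'rV[R]_d) (sg : {ffun 'I_d -> bool}).

(** Vertices of a cube: over a box, exponentials of linear forms are dominated by the sum over
    finitely many vertices. *)
Definition signs sg : 'rV[R]_d := \row_j (if sg j then 1 else -1).

Lemma dot_le_vertex h x (s : R) : (forall j, `|h ord0 j| <= s) ->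
  dot h x <= dot (s *: signs [ffun j => 0 <= x ord0 j]) x.
Proof.
move=> hs; apply: ler_sum => j _; rewrite !mxE ffunE.
have := hs j; rewrite ler_norml => /andP[h1 h2].
have [x0|x0] := leP 0 (x ord0 j); first by rewrite mulr1 ler_wpM2r.
by rewrite mulrN1 ler_wnM2r// ltW.
Qed.

Lemma expR_dot_le_vertices h x (s : R) : (forall j, `|h ord0 j| <= s) ->
  expR (dot h x) <= \sum_sg expR (dot (s *: signs sg) x).
Proof.
move=> hs; rewrite (bigD1 [ffun j => 0 <= x ord0 j])//= -[leLHS]addr0 lerD//.
  by rewrite ler_expR dot_le_vertex.
by apply: sumr_ge0 => *; exact: expR_ge0.
Qed.

(** [expR_convex_0] between 0 and the vertex adapted to [x]. The bound tends to 1 as the box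
    shrinks, whence semicontinuity in [LL_usc]. *)
Lemma expR_dot_le_interp h x (s t : R) : 0 <= t <= 1 -> (forall j, `|h ord0 j| <= t * s) ->
  expR (dot h x) <= 1 - t + t * \sum_sg expR (dot (s *: signs sg) x).
Proof.
move=> t01 hs; apply: (@le_trans _ _ (expR (t * dot (s *: signs [ffun j => 0 <= x ord0 j]) x))).
  by rewrite ler_expR -dotZl scalerA dot_le_vertex.
apply: le_trans (expR_convex_0 _ t01) _; rewrite lerD2l ler_wpM2l//; first by case/andP: t01.
rewrite (bigD1 [ffun j => 0 <= x ord0 j])//= lerDl.
by apply: sumr_ge0 => *; exact: expR_ge0.
Qed.

Lemma signs_le sg j (s : R) : 0 <= s -> `|(s *: signs sg) ord0 j| <= s.
Proof. by move=> s0; rewrite !mxE; case: ifP => _; rewrite ?mulrN ?normrN mulr1 ger0_norm. Qed.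

End vertices.

Lemma quadratic_rescale (R : realFieldType) (A Z C t m b : R) : 0 < Z ->
  A - Z - t * m <= C * t ^+ 2 -> m = Z * b -> A <= Z * (1 + (t * b + C / Z * t ^+ 2)).
Proof.
move=> Z0 h mE.
have e3 : Z * (C / Z * t ^+ 2) = C * t ^+ 2 by field; rewrite gt_eqF.
have e4 : Z * (t * b) = t * m by rewrite mE mulrCA.
by rewrite mulrDr mulr1 mulrDr e3 e4; lra.
Qed.

Definition log_mgf (R : realType) (d : nat) (mu : probability (rVType R d) R)
  (q : 'rV[R]_d) : R := fine (lne (mgf mu q)).

Lemma log_mgfE (R : realType) (d : nat) (mu : probability (rVType R d) R) :
  log_mgf mu = fine \o (fun q => lne (mgf mu q)).
Proof. by []. Qed.

Section log_mgf.
Context {R : realType} {d : nat}.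
Local Notation rV := (rVType R d).
Variable mu : probability rV R.
Variable D : set 'rV[R]_d.
Hypothesis oD : open D.
Let L (q : 'rV[R]_d) : \bar R := lne (mgf mu q).
Hypothesis DL : forall q, D q -> L q \is a fin_num.
Local Notation LL := (log_mgf mu).

Lemma D_mgf q : D q -> (0 < mgf mu q < +oo)%E.
Proof.
move=> /DL; rewrite /L; have := mgf_ge0 mu q.
case: (mgf mu q) => [r|//|//]; rewrite lee_fin lte_fin ltry andbT /= => r0.
by case: ifPn => //; rewrite -ltNge.
Qed.

Lemma D_ltoo q : D q -> (mgf mu q < +oo)%E.
Proof. by move=> /D_mgf/andP[]. Qed.

Lemma D_mgfE q : D q -> mgf mu q = (expR (LL q))%:E.
Proof.
move=> Dq; have /andP[q0 qoo] := D_mgf Dq.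
rewrite /log_mgf (mgf_fine qoo) /= leNgt fine_gt0 ?q0//= lnK// posrE.
by rewrite fine_gt0 ?q0.
Qed.

Lemma D_LE q : D q -> L q = (LL q)%:E.
Proof. by move=> Dq; rewrite /log_mgf fineK// DL. Qed.

Lemma D_box q : D q -> exists2 s : R, 0 < s & forall h : 'rV[R]_d, (forall j, `|h ord0 j| <= s) -> D (q + h).
Proof.
move=> Dq; have /nbhs_ballP[e /= e0 De] : nbhs q D by exact: open_nbhs_nbhs.
exists (e / 2); first by rewrite divr_gt0.
move=> h hs; apply: De; split => // i j; rewrite /ball/= !ord1 mxE opprD addrA subrr sub0r normrN.
by apply: le_lt_trans (hs j) _; rewrite ltr_pdivrMr// ltr_pMr// ltr1n.
Qed.

Lemma D_line q v : D q -> exists2 s : R, 0 < s & forall t, `|t| <= s -> D (q + t *: v).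
Proof.
move=> /D_box[s s0 Ds].
pose c := 1 + \sum_j `|v ord0 j|.
have c0 : 0 < c by rewrite ltr_pwDl// sumr_ge0.
exists (s / c); first by rewrite divr_gt0.
move=> t ts; apply: Ds => j; rewrite mxE normrM.
apply: (@le_trans _ _ (s / c * c)); last by rewrite divfK// gt_eqF.
apply: ler_pM => //; rewrite /c (bigD1 j)//= addrCA lerDl addr_ge0// sumr_ge0//.
Qed.

(** The mean of the letter law tilted by [q]; for [q] in [D] it is the gradient of [log_mgf]. *)
Definition mean_at q : 'rV[R]_d := \row_j tilted_slope mu q (delta_mx ord0 j).

Lemma tilted_mean_sum q v : D q ->
  tilted_mean mu q v = \sum_j v ord0 j * tilted_mean mu q (delta_mx ord0 j).
Proof.
move=> Dq.
have iT u : mu.-integrable setT (EFin \o (fun x : rV => dot u x * expR (dot q x))).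
  have [s s0 Ds] := D_line u Dq.
  apply: (@integrable_tilted _ _ mu q u s) => //.
  - by apply: D_ltoo; apply: Ds; rewrite ger0_norm// ltW.
  - by rewrite -scaleNr; apply: D_ltoo; apply: Ds; rewrite normrN ger0_norm// ltW.
have tZ a u : tilted_mean mu q (a *: u) = a * tilted_mean mu q u.
  rewrite /tilted_mean -RintegralZl//; apply: eq_Rintegral => x _.
  by rewrite dotZl mulrA.
have tD u w : tilted_mean mu q (u + w) = tilted_mean mu q u + tilted_mean mu q w.
  rewrite /tilted_mean -RintegralD//; apply: eq_Rintegral => x _.
  by rewrite dotDl mulrDl.
rewrite {1}(row_sum_delta v).
elim/big_rec2: _ => [|j y u _ <-]; last by rewrite tD tZ.
by rewrite -(scale0r 0) tZ mul0r.
Qed.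

Lemma tilted_slopeE q v : D q -> tilted_slope mu q v = dot v (mean_at q).
Proof.
move=> Dq; rewrite /tilted_slope tilted_mean_sum// mulr_suml; apply: eq_bigr => j _.
by rewrite !mxE /tilted_slope mulrA.
Qed.

Lemma LL_tangent q p : D q -> ((LL q + dot (p - q) (mean_at q))%:E <= L p)%E.
Proof.
move=> Dq; have /andP[q0 qoo] := D_mgf Dq.
have [s s0 Ds] := D_line (p - q) Dq.
have hp : (mgf mu (q + s *: (p - q)) < +oo)%E.
  by apply: D_ltoo; apply: Ds; rewrite ger0_norm// ltW.
have hm : (mgf mu (q - s *: (p - q)) < +oo)%E.
  by rewrite -scaleNr; apply: D_ltoo; apply: Ds; rewrite normrN ger0_norm// ltW.
have := mgf_tangent s0 qoo hp hm q0.
have -> : fine (mgf mu q) = expR (LL q) by rewrite D_mgfE.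
rewrite -expRD (tilted_slopeE _ Dq) [q + (p - q)]addrCA subrr addr0.
rewrite /L; case: (mgf mu p) => [r| |]; [|by move=> _; exact: leey|by rewrite leeNy_eq].
rewrite lee_fin => er; have r0 : 0 < r by exact: lt_le_trans (expR_gt0 _) er.
by rewrite lne_EFin// lee_fin -ler_expR lnK.
Qed.

(** The tangent inequality says that [q] attains the infimum. *)
Lemma conjugate_mean q : D q -> conjugate L (mean_at q) = (LL q - dot q (mean_at q))%:E.
Proof.
move=> Dq; apply/eqP; rewrite eq_le; apply/andP; split.
  by apply: ereal_inf_lbound; exists q => //; rewrite D_LE// EFinB.
apply: le_ereal_inf_tmp => _ [p _ <-].
rewrite leeBrDr// -EFinD; have := LL_tangent p Dq; rewrite dotBl.
by rewrite addrAC addrA.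
Qed.

Lemma LL_quadratic q v : D q -> exists (C s : R), [/\ 0 <= C, 0 < s & forall t, `|t| <= s ->
  D (q + t *: v) /\ LL (q + t *: v) <= LL q + t * dot v (mean_at q) + C * t ^+ 2].
Proof.
move=> Dq; have /andP[q0 qoo] := D_mgf Dq.
have [s s0 Ds] := D_line v Dq.
have hp : (mgf mu (q + s *: v) < +oo)%E.
  by apply: D_ltoo; apply: Ds; rewrite ger0_norm// ltW.
have hm : (mgf mu (q - s *: v) < +oo)%E.
  by rewrite -scaleNr; apply: D_ltoo; apply: Ds; rewrite normrN ger0_norm// ltW.
have [C C0 hC] := mgf_quadratic s0 qoo hp hm.
have Z0 := expR_gt0 (LL q).
exists (C / expR (LL q)), (s / 2); split; first by rewrite divr_ge0// ltW.
  by rewrite divr_gt0.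
move=> t ts; have [_ /andP[_ h]] := hC t ts.
have Dt : D (q + t *: v).
  by apply: Ds; apply: le_trans ts _; rewrite ler_pdivrMr// ler_pMr// ler1n.
split => //; move: h; rewrite (D_mgfE Dt) (D_mgfE Dq)/= => h.
have tm : tilted_mean mu q v = expR (LL q) * dot v (mean_at q).
  by rewrite -tilted_slopeE// /tilted_slope (D_mgfE Dq)/= mulrC divfK// gt_eqF.
rewrite -ler_expR -addrA expRD.
apply: (@le_trans _ _ (expR (LL q) * (1 + (t * dot v (mean_at q) + C / expR (LL q) * t ^+ 2)))).
  exact: (quadratic_rescale Z0 h tm).
by apply: ler_wpM2l; [exact: ltW|exact: expR_ge1Dx].
Qed.

(** Interpolation between [q] and the vertices of a larger box inside [D] bounds [mgf mu (q + h)] by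
    (1 - t) Z + t C, where Z is the value at [q]. *)
Lemma LL_usc q (e : R) : D q -> 0 < e -> exists2 s : R, 0 < s &
  forall h : 'rV[R]_d, (forall j, `|h ord0 j| <= s) -> D (q + h) /\ LL (q + h) <= LL q + e.
Proof.
move=> Dq e0; have /andP[q0 qoo] := D_mgf Dq.
have [s s0 Ds] := D_box Dq.
pose C := \sum_sg expR (LL (q + s *: signs sg)).
have C0 : 0 <= C by apply: sumr_ge0 => *; exact: expR_ge0.
have Dsg sg : D (q + s *: signs sg) by apply: Ds => j; rewrite signs_le// ltW.
pose Z := expR (LL q); have Z0 : 0 < Z by exact: expR_gt0.
(* So small that t C <= e Z, which bounds the interpolation by Z (1 + e). *)
pose t := Num.min 1 (e * Z / (C + 1)).
have C1 : 0 < C + 1 by rewrite ltr_wpDl.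
have t0 : 0 < t by rewrite lt_min ltr01 divr_gt0// mulr_gt0.
have t1 : t <= 1 by rewrite ge_min lexx.
have tC : t * C <= e * Z.
  apply: (@le_trans _ _ (e * Z / (C + 1) * C)).
    by rewrite ler_wpM2r// ge_min lexx orbT.
  rewrite mulrAC ler_pdivrMr// ler_pM2l ?mulr_gt0//; lra.
exists (t * s); first by rewrite mulr_gt0.
move=> h hs; have Dh : D (q + h).
  by apply: Ds => j; apply: le_trans (hs j) _; rewrite ler_piMl// ltW.
split => //; rewrite -ler_expR expRD.
rewrite -lee_fin -(D_mgfE Dh).
apply: (@le_trans _ _ (\int[mu]_x ((1 - t)%:E * (expR (dot q x))%:E + t%:E *
   \sum_sg (expR (dot (q + s *: signs sg) x))%:E))%E).
  apply: ge0_le_integral => //.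
  - by apply/measurable_EFinP; exact: measurable_expR_dot.
  - apply: emeasurable_funD; apply: measurable_funeM.
      by apply/measurable_EFinP; exact: measurable_expR_dot.
    by apply: emeasurable_sum => sg; apply/measurable_EFinP; exact: measurable_expR_dot.
  - move=> x _; rewrite sumEFin -!EFinM -EFinD lee_fin dotDl expRD.
    under eq_bigr do rewrite dotDl expRD; rewrite -mulr_sumr.
    have t01 : 0 <= t <= 1 by rewrite ltW.
    have := ler_wpM2l (expR_ge0 (dot q x)) (expR_dot_le_interp x t01 hs).
    by lra.
rewrite ge0_integralD//; last 4 first.
- by move=> x _; apply: mule_ge0; rewrite lee_fin ?expR_ge0// subr_ge0.
- by apply: measurable_funeM; apply/measurable_EFinP; exact: measurable_expR_dot.
- move=> x _; apply: mule_ge0; first by rewrite lee_fin ltW.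
  by apply: sume_ge0 => sg _; rewrite lee_fin expR_ge0.
- apply: measurable_funeM; apply: emeasurable_sum => sg.
  by apply/measurable_EFinP; exact: measurable_expR_dot.
have mE q' : measurable_fun setT (fun x : rV => (expR (dot q' x))%:E).
  by apply/measurable_EFinP; exact: measurable_expR_dot.
have E0 q' (x : rV) : (0 <= (expR (dot q' x))%:E)%E by rewrite lee_fin expR_ge0.
rewrite (ge0_integralZl _ measurableT (mE q)); last 2 first.
- by move=> x _; exact: E0.
- by rewrite lee_fin subr_ge0.
rewrite ge0_integralZl; last 4 first.
- exact: measurableT.
- by apply: emeasurable_sum => sg; exact: mE.
- by move=> x _; apply: sume_ge0 => sg _; exact: E0.
- by rewrite lee_fin ltW.
rewrite ge0_integral_sum; last 3 first.
- exact: measurableT.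
- by move=> sg; exact: mE.
- by move=> sg x _; exact: E0.
rewrite -/(mgf mu q) (eq_bigr (fun sg => (expR (LL (q + s *: signs sg)))%:E)); last first.
  by move=> sg _; rewrite -D_mgfE.
rewrite (D_mgfE Dq) sumEFin -!EFinM -EFinD lee_fin -/C -/Z.
have e1 : 1 + e <= expR e by exact: expR_ge1Dx.
have := ler_wpM2l (ltW Z0) e1; have : 0 <= t * Z by rewrite mulr_ge0// ltW.
by lra.
Qed.

End log_mgf.

Global Opaque log_mgf.

Section gradient_and_walk.
Context {R : realType} {d : nat}.
Local Notation rV := (rVType R d).
Variable mu : probability rV R.
Variable D : set 'rV[R]_d.
Hypothesis oD : open D.
Let L (q : 'rV[R]_d) : \bar R := lne (mgf mu q).
Hypothesis DL : forall q, D q -> L q \is a fin_num.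
Local Notation LL := (log_mgf mu).
Local Notation G := (mean_at mu).
Local Notation rho := (rho mu 0).

(** The difference quotient is squeezed between the tangent inequality and the quadratic bound. *)
Lemma derive_LL q v : D q -> 'D_v LL q = dot v (G q).
Proof.
move=> Dq; apply: cvg_lim => //.
have [C [s [C0 s0 hC]]] := LL_quadratic oD DL v Dq.
apply/cvgrPdist_le => e e0.
have Ce : 0 < e / (C + 1) by rewrite divr_gt0// ltr_wpDl.
near=> h.
have h0 : h != 0 by near: h; exact: nbhs_dnbhs_neq.
have hs : `|h| <= s by near: h; apply: dnbhs0_le.
have he : `|h| <= e / (C + 1) by near: h; apply: dnbhs0_le.
have [Dh up0] := hC h hs.
have up : LL (q + h *: v) <= LL q + h * dot v (G q) + C * h ^+ 2 := up0.
have lo : LL q + h * dot v (G q) <= LL (q + h *: v).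
  have := LL_tangent oD DL (q + h *: v) Dq.
  by rewrite (D_LE DL Dh) lee_fin addrAC subrr add0r dotZl.
rewrite /= (_ : h *: v + q = q + h *: v); last by rewrite addrC.
rewrite /GRing.scale/=.
have -> : dot v (G q) - h^-1 * (LL (q + h *: v) - LL q) =
    - (h^-1 * (LL (q + h *: v) - LL q - h * dot v (G q))).
  by field.
rewrite normrN normrM normfV (@ger0_norm _ (_ - _ - _)); last by lra.
rewrite ler_pdivrMl ?normr_gt0//.
apply: (@le_trans _ _ (C * h ^+ 2)); first by lra.
rewrite -real_normK ?num_real// expr2 mulrCA ler_wpM2l//.
move: he; rewrite ler_pdivlMr ?ltr_wpDl// => he.
by apply: le_trans he; rewrite mulrC ler_wpM2l//; lra.
Unshelve. all: by end_near. Qed.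

Lemma gradient_LL q : D q -> gradient L q = G q.
Proof.
move=> Dq; apply/rowP => j; rewrite !mxE.
by rewrite /L -log_mgfE derive_LL// dot_delta mxE.
Qed.

Lemma Epsum_expR n q : D q ->
  Epsum mu n (fun y => expR (dot q y)) = (expR (n%:R * LL q))%:E.
Proof.
move=> Dq; pose g (y : rV) := expR (dot q y).
have E1 : Epsum mu 1 g = mgf mu q.
  rewrite /Epsum integral_rhoS; last 2 first.
  - by apply/measurable_EFinP; apply: measurableT_comp; [exact: measurable_expR_dot|exact: measurable_psum].
  - by move=> x; rewrite lee_fin expR_ge0.
  apply: eq_integral => x _; rewrite integral_rho0; last 2 first.
  - apply/measurable_EFinP; apply: measurableT_comp; first exact: measurable_expR_dot.
    apply: measurableT_comp; first exact: measurable_psum.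
    by apply: measurableT_comp; [exact: measurable_consp|exact: pair1_measurable].
  - by move=> y; rewrite lee_fin expR_ge0.
  by rewrite /g /psum big_ord_recl big_ord0 addr0.
have := @integral_blocks _ _ mu 1 n g; rewrite muln1 E1 (D_mgfE DL Dq) prodEFin prodr_const card_ord -expRM_natl => <-.
- apply: eq_integral => x _; rewrite /g -expR_sum -dot_sumr.
  congr (expR (dot q _))%:E; apply: eq_bigr => k _.
  by rewrite /psum big_ord_recl big_ord0 addr0 muln1 addn0 add0n.
- exact: measurable_expR_dot.
- by move=> y; exact: expR_ge0.
Qed.

Lemma rho_Markov n (f : rV -> R) (S : set (pathType rV)) (b c : R) :
  measurable_fun setT f -> (forall y, 0 <= f y) -> measurable S -> 0 < b ->
  (Epsum mu n f <= c%:E)%E -> (forall x, S x -> b <= f (psum n 0 x)) ->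
  (rho n S <= (c / b)%:E)%E.
Proof.
move=> mf f0 mS b0 Ec Sb; have := @block_Markov _ _ mu n 1 f S b c mf f0 mS b0 Ec.
rewrite mul1n expr1; apply => x /Sb; rewrite big_ord_recl big_ord0 mulr1//.
Qed.

End gradient_and_walk.

(** * Exponential rates of balls *)

Section euclidean_norm.
Context {R : realType} {d : nat}.
Implicit Types x y c : 'rV[R]_d.

Definition enorm x : R := Num.sqrt (dot x x).

Lemma dotxx_ge0 x : 0 <= dot x x.
Proof. by apply: sumr_ge0 => j _; rewrite -expr2 sqr_ge0. Qed.

Lemma enorm_ge0 x : 0 <= enorm x. Proof. exact: sqrtr_ge0. Qed.

Lemma enorm_sqr x : enorm x ^+ 2 = dot x x.
Proof. by rewrite sqr_sqrtr// dotxx_ge0. Qed.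

(** Cauchy-Schwarz, from the squared norm of [enorm y *: x - enorm x *: y]. *)
Lemma dot_le_enorm x y : dot x y <= enorm x * enorm y.
Proof.
have [y0|y0] := eqVneq (enorm y) 0.
  suff -> : dot x y = 0 by rewrite y0 mulr0.
  have yy : dot y y = 0 by rewrite -enorm_sqr y0 expr0n.
  have yj j : y ord0 j = 0.
    apply/eqP; rewrite -sqrf_eq0; apply/eqP.
    have := psumr_eq0P (fun j (_ : true) => sqr_ge0 (y ord0 j)).
    by move=> /(_ _); apply => //; rewrite -[RHS]yy; apply: eq_bigr => i _; rewrite expr2.
  by apply: big1 => j _; rewrite yj mulr0.
have [x0|x0] := eqVneq (enorm x) 0.
  suff -> : dot x y = 0 by rewrite x0 mul0r.
  have xx : dot x x = 0 by rewrite -enorm_sqr x0 expr0n.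
  have xj j : x ord0 j = 0.
    apply/eqP; rewrite -sqrf_eq0; apply/eqP.
    have := psumr_eq0P (fun j (_ : true) => sqr_ge0 (x ord0 j)).
    by move=> /(_ _); apply => //; rewrite -[RHS]xx; apply: eq_bigr => i _; rewrite expr2.
  by apply: big1 => j _; rewrite xj mul0r.
have a0 : 0 < enorm x by rewrite lt_neqAle eq_sym x0 enorm_ge0.
have b0 : 0 < enorm y by rewrite lt_neqAle eq_sym y0 enorm_ge0.
have := dotxx_ge0 (enorm y *: x - enorm x *: y).
rewrite dotBl !dotBr !dotZl !dotZr -!enorm_sqr (dotC y x).
set a := enorm x in a0 *; set b := enorm y in b0 *; set t := dot x y => h.
have : 0 <= (a * b) * (a * b - t) by lra.
by rewrite pmulr_rge0 ?mulr_gt0// subr_ge0.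
Qed.

Lemma enormZ a x : enorm (a *: x) = `|a| * enorm x.
Proof. by rewrite /enorm dotZl dotZr mulrA -expr2 sqrtrM ?sqr_ge0// sqrtr_sqr. Qed.

Lemma enormN x : enorm (- x) = enorm x.
Proof. by rewrite -scaleN1r enormZ normrN1 mul1r. Qed.

Lemma enormD x y : enorm (x + y) <= enorm x + enorm y.
Proof.
rewrite -(@ler_pXn2r _ 2)// ?nnegrE ?addr_ge0 ?enorm_ge0//.
rewrite enorm_sqr dotDl !dotDr (dotC y x) -!enorm_sqr sqrrD.
have := dot_le_enorm x y; rewrite -mulr_natl; lra.
Qed.

Lemma enorm_le_sum x : enorm x <= \sum_j `|x ord0 j|.
Proof.
rewrite {1}(row_sum_delta x); elim/big_rec2: _ => [|j s u _ h].
  by rewrite -(scale0r 0) enormZ normr0 mul0r.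
apply: le_trans (enormD _ _) _; apply: lerD => //.
rewrite enormZ /enorm dot_delta mxE !eqxx sqrtr1 mulr1//.
Qed.

Lemma eballE c r y : eball c r y = (enorm (y - c) <= r) :> Prop.
Proof. by []. Qed.

Lemma subset_eball c c' (r r' : R) : enorm (c - c') + r <= r' -> eball c r `<=` eball c' r'.
Proof.
move=> h y; rewrite !eballE => yc; apply: le_trans h.
have -> : y - c' = (c - c') + (y - c) by rewrite [RHS]addrC subrKA.
by apply: le_trans (enormD _ _) _; rewrite lerD2l.
Qed.

End euclidean_norm.

Section ball_probabilities.
Context {R : realType} {d : nat}.
Local Notation rV := (rVType R d).
Variable mu : probability rV R.
Local Notation rho := (rho mu 0).

Definition nball (c : 'rV[R]_d) (r : R) n : set rV := [set y | eball c r (n%:R^-1 *: (y : 'rV[R]_d))].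

Definition ball_prob c r n : \bar R := rho n [set x | nball c r n (psum n 0 x)].

Lemma measurable_nball c r n : measurable (nball c r n).
Proof.
apply: (measurable_ler_set (f := fun y : rV => enorm (n%:R^-1 *: (y : 'rV[R]_d) - c)) (g := cst r)) => //.
apply: (measurableT_comp (continuous_measurable_fun (@sqrt_continuous R))).
apply: measurable_sum => j.
have mj : measurable_fun setT (fun y : rV => (n%:R^-1 *: (y : 'rV[R]_d) - c) ord0 j).
  rewrite (_ : (fun _ => _) = fun y : rV => n%:R^-1 * y ord0 j - c ord0 j); last first.
    by apply/funext => y; rewrite !mxE.
  apply: measurable_funB => //; apply: measurable_funM => //; exact: measurable_rV_coord.
exact: measurable_funM.
Qed.

Lemma ball_prob_le1 c r n : (ball_prob c r n <= 1)%E.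
Proof.
apply: probability_le1; apply: measurable_psum_set; exact: measurable_nball.
Qed.

Lemma ball_prob_ge0 c r n : (0 <= ball_prob c r n)%E.
Proof. exact: measure_ge0. Qed.

Lemma ball_prob_fin c r n : ball_prob c r n \is a fin_num.
Proof. by rewrite ge0_fin_numE ?ball_prob_ge0// (le_lt_trans (ball_prob_le1 _ _ _))// ltry. Qed.

Lemma le_ball_prob c r c' r' n : eball c r `<=` eball c' r' ->
  (ball_prob c r n <= ball_prob c' r' n)%E.
Proof.
move=> h; apply: le_measure; rewrite ?inE; do ?[apply: measurable_psum_set; exact: measurable_nball].
by move=> x; exact: h.
Qed.

Lemma rho_superadditive m n (A B C : set rV) :
  measurable A -> measurable B -> measurable C ->
  (forall u v : 'rV[R]_d, A u -> B v -> C (u + v)) ->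
  (rho m [set x | A (psum m 0 x)] * rho n [set x | B (psum n 0 x)] <=
   rho (m + n) [set x | C (psum (m + n) 0 x)])%E.
Proof.
move=> mA mB mC ABC.
have mpA := measurable_psum_set m 0 mA.
have mpB := measurable_psum_set n 0 mB.
have mpC := measurable_psum_set (m + n) 0 mC.
rewrite !measure_integral_indic//.
have mI (S : set (pathType rV)) : measurable S -> measurable_fun setT (fun x => (\1_S x)%:E : \bar R).
  by move=> mS; apply/measurable_EFinP; exact: measurable_indic.
rewrite -(@integral_rho_split _ _ _ mu 0 m n); last 4 first.
- exact: mI.
- by move=> x; rewrite lee_fin.
- exact: mI.
- by move=> x; rewrite lee_fin.
apply: ge0_le_integral => //.
- apply: emeasurable_funM.
    by apply: (measurableT_comp (mI _ mpA)); exact: measurable_trunc.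
  by apply: (measurableT_comp (mI _ mpB)); exact: measurable_pshift.
- exact: mI.
move=> x _; rewrite -EFinM lee_fin.
have [h|h] := pselect (A (psum m 0 (trunc (0 : rV) m x)) /\ B (psum n 0 (pshift m x))); last first.
  suff -> : (\1_[set x | A (psum m 0 x)] (trunc (0 : rV) m x) *
    \1_[set x | B (psum n 0 x)] (pshift m x) = 0 :> R) by [].
  move/not_andP : h => [hA|hB]; apply/eqP; rewrite mulf_eq0; apply/orP; [left|right];
    by rewrite indicE memNset.
rewrite [leRHS]indicE mem_set.
  by rewrite !indicE -natrM ler_nat; case: (_ \in _); case: (_ \in _).
case: h; rewrite psum_trunc ?add0n// psum_pshift addn0 => hA hB.
by rewrite /= psumD add0n; exact: ABC.
Qed.

(** The average over m + n letters is a convex combination of two independent averages. Different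
    radii are allowed: equal ones serve Fekete's lemma, unequal ones the midpoint concavity of the
    rate. *)
Lemma ball_prob_superadditive m n c (r1 r2 r : R) : (0 < m)%N -> (0 < n)%N ->
  m%:R * r1 + n%:R * r2 <= (m + n)%:R * r ->
  (ball_prob c r1 m * ball_prob c r2 n <= ball_prob c r (m + n))%E.
Proof.
move=> m0 n0 hr; apply: rho_superadditive; try exact: measurable_nball.
move=> u v; rewrite /nball /= !eballE => hu hv.
have M0 : 0 < m%:R :> R by rewrite ltr0n.
have N0 : 0 < n%:R :> R by rewrite ltr0n.
have S0 : 0 < (m + n)%:R :> R by rewrite ltr0n addn_gt0 m0.
rewrite -(ler_pM2l S0); apply: le_trans hr.
rewrite -{1}(gtr0_norm S0) -enormZ scalerBr scalerA divff ?gt_eqF// scale1r.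
have -> : u + v - (m + n)%:R *: c = m%:R *: (m%:R^-1 *: u - c) + n%:R *: (n%:R^-1 *: v - c).
  rewrite !scalerBr !scalerA !divff ?gt_eqF// !scale1r natrD scalerDl.
  by rewrite addrACA opprD.
apply: le_trans (enormD _ _) _; rewrite !enormZ !gtr0_norm//.
by apply: lerD; rewrite ler_pM2l.
Qed.

End ball_probabilities.

Section Fekete.
Context {R : realType}.
Implicit Types u : nat -> R.

(** Fekete's lemma from the index [n0] on: for smaller n a ball may have probability 0, and minus
    its logarithm is then not controlled. *)
Lemma Fekete u n0 : (forall n, (n0 <= n)%N -> 0 <= u n) ->
  (forall m n, (0 < m)%N -> (0 < n)%N -> (n0 <= m)%N -> (n0 <= n)%N -> u (m + n)%N <= u m + u n) ->
  exists l : R, (forall n, (0 < n)%N -> (n0 <= n)%N -> n%:R * l <= u n) /\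
    (forall e : R, 0 < e -> exists n1, forall n, (n1 <= n)%N -> u n <= n%:R * (l + e)).
Proof.
move=> u0 usub.
pose N0 := n0.+1.
pose A : set R := [set u n / n%:R | n in [set n | (N0 <= n)%N]].
have Alb : has_lbound A.
  by exists 0 => _ [n /= nN <-]; rewrite divr_ge0// u0// ltnW.
have Anz : A !=set0 by exists (u N0 / N0%:R), N0 => /=.
pose l := inf A.
have uN n : (N0 <= n)%N -> n%:R * l <= u n.
  move=> nN; have n_gt0 : 0 < n%:R :> R by rewrite ltr0n (leq_trans _ nN).
  by rewrite mulrC -ler_pdivlMr//; apply: ge_inf => //; exists n.
have umul a q : (N0 <= a)%N -> (0 < q)%N -> u (q * a)%N <= q%:R * u a.
  move=> aN; elim: q => [//|[|q] IH] _; first by rewrite !mul1n mul1r.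
  have a0 : (0 < a)%N by exact: leq_trans aN.
  rewrite mulSnr; apply: le_trans (usub _ _ _ _ _ _) _ => //.
  - by rewrite muln_gt0.
  - by apply: leq_trans (ltnW aN) _; rewrite leq_pmull.
  - exact: ltnW.
  rewrite -[in leRHS]natr1 mulrDl mul1r lerD2r; exact: IH.
exists l; split.
  move=> n n_gt0 nn0; have [nN|] := leqP N0 n; first exact: uN.
  rewrite ltnS => nn1; have {nn1 nn0} nE : n = n0 by apply/eqP; rewrite eqn_leq nn1.
  (* The index [n0] is left out of [A] so that all indices there are positive; subadditivity at n +
     n recovers it. *)
  have h : (N0 <= n + n)%N by rewrite /N0 -nE -addn1 leq_add2l.
  have := le_trans (uN _ h) (usub n n n_gt0 n_gt0 _ _); rewrite nE leqnn => /(_ isT isT).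
  by rewrite natrD; lra.
move=> e e0; have e2 : 0 < e / 2 by rewrite divr_gt0.
have [_ [a /= aN <-] la] := inf_adherent e2 (conj Anz Alb).
have a0 : (0 < a)%N by exact: leq_trans aN.
have a0R : 0 < a%:R :> R by rewrite ltr0n.
have ua : u a <= a%:R * (l + e / 2).
  by move: la; rewrite ltr_pdivrMr// mulrC => /ltW.
(* write n = q a + r with a <= r < 2 a *)
pose C := \sum_(r < a) `|u (a + r)%N| + 2 * a%:R * `|l + e / 2|.
have C0 : 0 <= C by rewrite addr_ge0 ?sumr_ge0// !mulr_ge0.
exists (maxn (2 * a) (Num.truncn (C / (e / 2))).+1) => n; rewrite geq_max => /andP[na nC].
pose q := (n %/ a).-1; pose r := (n %% a)%N.
have na2 : (2 <= n %/ a)%N by rewrite leq_divRL.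
have q0 : (0 < q)%N by rewrite /q -ltnS prednK// ltnW.
have qE : (q.+1 = n %/ a)%N by rewrite /q prednK// ltnW.
have nE : n = (q * a + (a + r))%N.
  by rewrite addnA -mulSnr qE -divn_eq.
have ra : (r < a)%N by rewrite ltn_mod.
have hC : C <= e / 2 * n%:R.
  rewrite mulrC -ler_pdivrMr//; apply: (@le_trans _ _ (Num.truncn (C / (e / 2))).+1%:R).
    by rewrite ltW// truncnS_gt.
  by rewrite ler_nat.
have aaN : (n0 <= a + r)%N by rewrite (leq_trans (ltnW aN))// leq_addr.
have qaN : (n0 <= q * a)%N by rewrite (leq_trans (ltnW aN))// leq_pmull.
have := usub (q * a)%N (a + r)%N; rewrite -nE muln_gt0 q0 a0 addn_gt0 a0 => /(_ isT isT qaN aaN) h.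
have h1 := umul _ _ aN q0.
have h2 : q%:R * u a <= q%:R * (a%:R * (l + e / 2)) by rewrite ler_wpM2l.
have h3 : u (a + r)%N <= \sum_(r < a) `|u (a + r)%N|.
  rewrite (bigD1 (Ordinal ra))//= (le_trans (ler_norm _))// lerDl sumr_ge0//.
have qn : q%:R * a%:R = n%:R - (a + r)%:R :> R by rewrite {1}nE natrD natrM addrK.
have h4 : - ((a + r)%:R * (l + e / 2)) <= 2 * a%:R * `|l + e / 2|.
  apply: le_trans (ler_norm _) _; rewrite normrN normrM ler_wpM2r//.
  by rewrite ger0_norm// -natrM ler_nat mul2n -addnn leq_add2l ltnW.
have h5 : q%:R * (a%:R * (l + e / 2)) = n%:R * (l + e / 2) - (a + r)%:R * (l + e / 2).
  by rewrite mulrA qn mulrBl.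
move: hC; rewrite /C.
lra.
Qed.

End Fekete.

Section ball_rates.
Context {R : realType} {d : nat}.
Local Notation rV := (rVType R d).
Variable mu : probability rV R.
Variable D : set 'rV[R]_d.
Hypothesis oD : open D.
Let L (q : 'rV[R]_d) : \bar R := lne (mgf mu q).
Hypothesis DL : forall q, D q -> L q \is a fin_num.
Local Notation LL := (log_mgf mu).
Local Notation G := (mean_at mu).
Local Notation ball_prob := (ball_prob mu).

Lemma ball_prob_Chernoff q c r n : D q -> (0 < n)%N ->
  (ball_prob c r n <= (expR (- (n%:R * (dot q c - enorm q * r - LL q))))%:E)%E.
Proof.
move=> Dq n0; have n0R : 0 < n%:R :> R by rewrite ltr0n.
have E1 := Epsum_expR DL n Dq.
apply: le_trans.
  apply: (@rho_Markov _ _ mu n (fun y => expR (dot q y)) _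
    (expR (n%:R * (dot q c - enorm q * r))) (expR (n%:R * LL q))).
  - exact: measurable_expR_dot.
  - by move=> y; exact: expR_ge0.
  - by apply: measurable_psum_set; exact: measurable_nball.
  - exact: expR_gt0.
  - by rewrite E1.
  move=> x; rewrite /= /nball /= eballE ler_expR; set y := psum n 0 x => yc.
  have -> : dot q y = n%:R * dot q (n%:R^-1 *: y).
    by rewrite dotZr mulrA divff ?gt_eqF// mul1r.
  rewrite ler_pM2l//; have := dot_le_enorm q (c - n%:R^-1 *: y).
  have : enorm q * enorm (c - n%:R^-1 *: y) <= enorm q * r.
    by rewrite ler_wpM2l ?enorm_ge0// -enormN opprB.
  by rewrite dotBr; lra.
by rewrite -expRB lee_fin ler_expR; lra.
Qed.

(** A weak law under the tilt, without the tilted measure: [expR (dot q y)] is at most a multiple of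
    the indicator of the ball plus tilted exponentials, whose expectations are exponentially smaller
    than exp(n LL q). *)
Lemma ball_prob_Cramer q r e : D q -> 0 < r -> 0 < e ->
  exists n1, forall n, (n1 <= n)%N ->
  ((expR (- (n%:R * (dot q (G q) - LL q + e))))%:E <= ball_prob (G q) r n)%E.
Proof.
move=> Dq r0 e0.
set c := G q; pose I := dot q c - LL q.
(* On this smaller ball [dot q] varies by at most e / 2 from its value at the centre. *)
pose r' := Num.min r (e / 2 / (enorm q + 1)).
have q1 : 0 < enorm q + 1 by rewrite ltr_wpDl ?enorm_ge0.
have r'0 : 0 < r' by rewrite lt_min r0 !divr_gt0.
have qr' : enorm q * r' <= e / 2.
  apply: (@le_trans _ _ ((enorm q + 1) * (e / 2 / (enorm q + 1)))).
    by apply: ler_pM; rewrite ?enorm_ge0 ?(ltW r'0)// ?lerDl// ge_min lexx orbT.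
  by rewrite mulrC divfK// gt_eqF.
(* A vector whose coordinates are at most [eta] in absolute value has norm at most r'. *)
pose eta := r' / d.+1%:R.
have eta0 : 0 < eta by rewrite divr_gt0.
(* an exponential tilt in each of the 2 d coordinate directions controls the
   complement of the ball *)
have tilt (v : 'rV[R]_d) : exists (s k : R), [/\ 0 < s, 0 < k, D (q + s *: v) &
    LL (q + s *: v) - s * dot v c - s * eta <= LL q - k].
  have [C [s [C0 s0 hC]]] := LL_quadratic oD DL v Dq.
  pose t := Num.min s (eta / 2 / (C + 1)).
  have C1 : 0 < C + 1 by rewrite ltr_wpDl.
  have t0 : 0 < t by rewrite lt_min s0 !divr_gt0.
  have ts : t <= s by rewrite ge_min lexx.
  have ts' : `|t| <= s by rewrite gtr0_norm.
  have [Dt ht] := hC t ts'.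
  exists t, (t * eta / 2); split => //; first by rewrite divr_gt0// mulr_gt0.
  have tC : t * C <= eta / 2.
    apply: (@le_trans _ _ ((eta / 2 / (C + 1)) * (C + 1))); last by rewrite divfK// gt_eqF.
    by apply: ler_pM; rewrite ?(ltW t0)// ?lerDl// ge_min lexx orbT.
  have : t * (t * C) <= t * (eta / 2) by rewrite ler_wpM2l// ltW.
  have ht' : LL (q + t *: v) <= LL q + t * dot v c + C * t ^+ 2 := ht.
  by rewrite expr2 in ht' *; lra.
pose V (i : 'I_d * bool) : 'rV[R]_d := (if i.2 then 1 else -1) *: delta_mx ord0 i.1.
have /choice[sk hsk] : forall i, exists sk : R * R, [/\ 0 < sk.1, 0 < sk.2, D (q + sk.1 *: V i) &
    LL (q + sk.1 *: V i) - sk.1 * dot (V i) c - sk.1 * eta <= LL q - sk.2].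
  by move=> i; have [s [k hs]] := tilt (V i); exists (s, k).
(* For large n each tilted term is at most Z / M, so together they are at most Z / 2. *)
pose M : R := (2 * #|{: 'I_d * bool}|%:R + 1).
have M0 : 0 < M by rewrite ltr_wpDl// mulr_ge0.
have /choice[nn hnn] : forall i, exists n1, forall n, (n1 <= n)%N -> M <= expR ((sk i).2 * n%:R).
  by move=> i; apply: near_le_expR; case: (hsk i).
have e2 : 0 < e / 2 by rewrite divr_gt0.
have [n2 hn2] := near_le_expR 2 e2.
exists (maxn 1 (maxn n2 (\max_i nn i))) => n; rewrite !geq_max => /and3P[n0 nn2 nnmax].
have n0R : 0 < n%:R :> R by rewrite ltr0n.
have nni i : M <= expR ((sk i).2 * n%:R).
  by apply: hnn; apply: leq_trans nnmax; exact: leq_bigmax.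
pose a := expR (n%:R * (dot q c + e / 2)).
pose b i := expR (- (n%:R * ((sk i).1 * (dot (V i) c + eta)))).
pose f i (y : rV) := expR (dot (q + (sk i).1 *: V i) y).
have mf i : measurable_fun setT (f i) by exact: measurable_expR_dot.
(* Off the smaller ball some signed coordinate of the deviation exceeds [eta], and the exponential
   tilted in that direction alone dominates. *)
have key (y : rV) : expR (dot q y) <= a * \1_(nball c r n) y + \sum_i b i * f i y.
  have sum0 : 0 <= \sum_i b i * f i y.
    by apply: sumr_ge0 => i _; rewrite mulr_ge0// expR_ge0.
  set z : 'rV[R]_d := n%:R^-1 *: (y : 'rV[R]_d) - c.
  have qz : dot q (y : 'rV[R]_d) = n%:R * (dot q c + dot q z).
    by rewrite /z dotBr dotZr addrC subrK mulrA divff ?gt_eqF// mul1r.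
  have [zr|zr] := leP (enorm z) r'.
    rewrite indicE mem_set; last first.
      by rewrite /nball /= eballE (le_trans zr)// ge_min lexx.
    rewrite mulr1 -[leLHS]addr0 lerD// ler_expR qz ler_pM2l// lerD2l.
    apply: le_trans (dot_le_enorm _ _) _; apply: le_trans qr'.
    by rewrite ler_wpM2l ?enorm_ge0.
  have [i hi] : exists i, eta < dot (V i) z.
    apply/existsP; rewrite -[X in is_true X]negbK; apply/negP => /existsPn h.
    move: zr; rewrite ltNge => /negP; apply.
    apply: le_trans (enorm_le_sum _) _; apply: (@le_trans _ _ (\sum_(j < d) eta)).
      apply: ler_sum => j _; rewrite ler_norml.
      have := h (j, true); have := h (j, false); rewrite /V/= -!leNgt !dotZl dot_delta.
      by rewrite mul1r mulN1r; lra.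
    rewrite sumr_const card_ord -mulr_natr /eta -mulrA ler_piMr ?(ltW r'0)//.
    by rewrite mulrC ler_pdivrMr// mul1r ler_nat.
  rewrite (bigD1 i)//= -[leLHS]add0r lerD//.
    by rewrite mulr_ge0// expR_ge0.
  rewrite -[leLHS]addr0 lerD//; last first.
    by apply: sumr_ge0 => k _; rewrite mulr_ge0// expR_ge0.
  rewrite /b /f -expRD ler_expR dotDl dotZl.
  have -> : dot (V i) y = n%:R * (dot (V i) c + dot (V i) z).
    by rewrite /z dotBr dotZr addrC subrK mulrA divff ?gt_eqF// mul1r.
  have [s0 _ _ _] := hsk i.
  have : 0 <= n%:R * ((sk i).1 * (dot (V i) z - eta)).
    by rewrite mulr_ge0// mulr_ge0 ?(ltW s0)// subr_ge0 ltW.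
  by lra.
have mB := measurable_nball c r n.
have mp (g : rV -> R) : measurable_fun setT g ->
    measurable_fun setT (fun x : pathType rV => (g (psum n 0 x))%:E).
  by move=> mg; apply/measurable_EFinP; apply: measurableT_comp => //; exact: measurable_psum.
have EB : Epsum mu n \1_(nball c r n) = ball_prob c r n.
  rewrite /ball_prob measure_integral_indic; last exact: measurable_psum_set.
  by apply: eq_integral => x _; rewrite !indicE.
have mI : measurable_fun setT (\1_(nball c r n) : rV -> R) by exact: measurable_indic.
have : (Epsum mu n (fun y => expR (dot q y)) <=
    a%:E * Epsum mu n \1_(nball c r n) + \sum_i (b i)%:E * Epsum mu n (f i))%E.
  have mbf i : measurable_fun setT (fun x : pathType rV => ((b i)%:E * (f i (psum n 0 x))%:E)%E).
    by apply: measurable_funeM; exact: (mp _ (mf i)).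
  have bf0 i (x : pathType rV) : (0 <= (b i)%:E * (f i (psum n 0 x))%:E)%E.
    by rewrite -EFinM lee_fin mulr_ge0// expR_ge0.
  have maI : measurable_fun setT (fun x : pathType rV => (a%:E * (\1_(nball c r n) (psum n 0 x))%:E)%E).
    by apply: measurable_funeM; exact: (mp _ mI).
  have aI0 (x : pathType rV) : (0 <= a%:E * (\1_(nball c r n) (psum n 0 x))%:E)%E.
    by rewrite -EFinM lee_fin mulr_ge0// expR_ge0.
  apply: (@le_trans _ _ (\int[rho mu 0%R n]_x (a%:E * (\1_(nball c r n) (psum n 0 x))%:E +
      \sum_i (b i)%:E * (f i (psum n 0 x))%:E))%E).
    apply: ge0_le_integral.
    - exact: measurableT.
    - by move=> x _; rewrite lee_fin expR_ge0.
    - exact: (mp _ (measurable_expR_dot q)).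
    - by apply: emeasurable_funD; [exact: maI|apply: emeasurable_sum => i; exact: mbf].
    - move=> x _; under [in leRHS]eq_bigr do rewrite -EFinM.
      by rewrite sumEFin -EFinM -EFinD lee_fin key.
  rewrite ge0_integralD//; last 2 first.
  - by move=> x _; apply: sume_ge0 => i _; exact: bf0.
  - by apply: emeasurable_sum => i; exact: mbf.
  rewrite ge0_integral_sum//.
  rewrite ge0_integralZl; last 4 first.
  - exact: measurableT.
  - exact: (mp _ mI).
  - by move=> x _; rewrite lee_fin.
  - by rewrite lee_fin expR_ge0.
  rewrite leeD2l//; apply: lee_sum => i _.
  rewrite ge0_integralZl//; last 3 first.
  - exact: (mp _ (mf i)).
  - by move=> x _; rewrite lee_fin expR_ge0.
  - by rewrite lee_fin expR_ge0.
rewrite (Epsum_expR DL n Dq) EB.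
rewrite (eq_bigr (fun i => (b i * expR (n%:R * LL (q + (sk i).1 *: V i)))%:E)); last first.
  by move=> i _; have [_ _ Di _] := hsk i; rewrite (Epsum_expR DL n Di) EFinM.
rewrite sumEFin -(fineK (ball_prob_fin mu c r n)) -EFinM -EFinD !lee_fin.
set p := fine (ball_prob c r n); set Z := expR (n%:R * LL q).
have Z0 : 0 < Z by exact: expR_gt0.
have a0 : 0 < a by exact: expR_gt0.
have hb i : b i * expR (n%:R * LL (q + (sk i).1 *: V i)) <= Z / M.
  rewrite ler_pdivlMr//; apply: (@le_trans _ _ (b i * expR (n%:R * LL (q + (sk i).1 *: V i)) * expR ((sk i).2 * n%:R))).
    by apply: ler_wpM2l; [apply: mulr_ge0; exact: expR_ge0|exact: nni].
  rewrite /b /Z -!expRD ler_expR.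
  have [_ _ _ h] := hsk i; have := ler_wpM2l (ltW n0R) h.
  by lra.
have : \sum_i b i * expR (n%:R * LL (q + (sk i).1 *: V i)) <= Z / 2.
  apply: (@le_trans _ _ (\sum_(i : 'I_d * bool) Z / M)); first by apply: ler_sum => i _; exact: hb.
  rewrite sumr_const -[leLHS]mulr_natr -mulrA ler_wpM2l ?(ltW Z0)//.
  by rewrite mulrC ler_pdivrMr// /M; lra.
move=> h1 h2.
have h3 : Z / 2 <= a * p by lra.
have x2 := hn2 n nn2.
apply: (@le_trans _ _ (Z / 2 / a)); last by rewrite ler_pdivrMr// [p * a]mulrC.
rewrite ler_pdivlMr// ler_pdivlMr// /a -expRD.
have -> : n%:R * (dot q c - LL q + e) = n%:R * (dot q c + e / 2) - n%:R * LL q + e / 2 * n%:R by lra.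
rewrite [X in expR X * _](_ : _ = n%:R * LL q - e / 2 * n%:R); last by lra.
rewrite expRD expRN -/Z -mulrA ler_piMr ?(ltW Z0)//.
by rewrite mulrC ler_pdivrMr ?expR_gt0// mul1r.
Qed.

(** By superadditivity the normalised logarithms approach their limit from below, so the upper bound
    carries no error term. *)
Definition is_rate c (r l : R) : Prop :=
  (forall e : R, 0 < e -> exists n1, forall n, (n1 <= n)%N ->
     ((expR (n%:R * (l - e)))%:E <= ball_prob c r n)%E) /\
  (exists n1, forall n, (n1 <= n)%N -> (ball_prob c r n <= (expR (n%:R * l))%:E)%E).

Lemma rate_exists c r : (exists n1, forall n, (n1 <= n)%N -> (0 < ball_prob c r n)%E) ->
  exists l, is_rate c r l.
Proof.
move=> [n1 p0].
pose p n := fine (ball_prob c r n).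
have pE n : ball_prob c r n = (p n)%:E by rewrite fineK// ball_prob_fin.
have {}p0 n : (n1 <= n)%N -> 0 < p n by move=> nn; rewrite -lte_fin -pE p0.
have p1 n : p n <= 1 by rewrite -lee_fin -pE ball_prob_le1.
pose u n := - ln (p n).
have [l [lo up]] : exists l : R, (forall n, (0 < n)%N -> (n1 <= n)%N -> n%:R * l <= u n) /\
    (forall e : R, 0 < e -> exists n2, forall n, (n2 <= n)%N -> u n <= n%:R * (l + e)).
  apply: (@Fekete R u n1).
    by move=> n nn; rewrite oppr_ge0 ln_le0.
  move=> m n m0 n0 mn nn; rewrite /u -opprD lerN2 -lnM ?posrE ?p0//.
  rewrite ler_ln ?posrE ?mulr_gt0 ?p0//; last by rewrite (leq_trans mn)// leq_addr.
  rewrite -lee_fin EFinM -!pE; apply: ball_prob_superadditive => //.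
  by rewrite natrD mulrDl.
exists (- l); split.
  move=> e e0; have [n2 hn2] := up e e0; exists (maxn n1 n2) => n.
  rewrite geq_max => /andP[nn1 nn2]; have := hn2 n nn2; rewrite /u => h.
  rewrite pE lee_fin -[leRHS](lnK (_ : _ \is Num.pos)) ?posrE ?p0// ler_expR; lra.
exists (maxn 1 n1) => n; rewrite geq_max => /andP[n0 nn].
have := lo n n0 nn; rewrite /u => h.
rewrite pE lee_fin -[leLHS](lnK (_ : _ \is Num.pos)) ?posrE ?p0// ler_expR; lra.
Qed.

Lemma le_rate c r l c' r' l' : is_rate c r l -> is_rate c' r' l' ->
  eball c r `<=` eball c' r' -> l <= l'.
Proof.
move=> [lo _] [_ [n1 up]] sub; apply/ler_addgt0Pr => e e0.
have [n2 hn2] := lo e e0.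
pose n := maxn 1 (maxn n1 n2).
have n0 : 0 < n%:R :> R by rewrite ltr0n leq_max.
have := le_trans (hn2 n _) (le_trans (le_ball_prob mu n sub) (up n _)).
rewrite /n !leq_max !leqnn !orbT => /(_ isT isT); rewrite -/n lee_fin ler_expR ler_pM2l//.
by lra.
Qed.

Lemma rate_ge q c r r0 l : D q -> 0 < r0 -> is_rate c r l ->
  eball (G q) r0 `<=` eball c r -> - (dot q (G q) - LL q) <= l.
Proof.
move=> Dq r00 [_ [n1 up]] sub; apply/ler_addgt0Pr => e e0.
have [n2 hn2] := ball_prob_Cramer Dq r00 e0.
pose n := maxn 1 (maxn n1 n2).
have n0 : 0 < n%:R :> R by rewrite ltr0n leq_max.
have := le_trans (hn2 n _) (le_trans (le_ball_prob mu n sub) (up n _)).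
rewrite /n !leq_max !leqnn !orbT => /(_ isT isT); rewrite -/n lee_fin ler_expR -mulrN ler_pM2l//.
by lra.
Qed.

Lemma rate_le q c r l : D q -> is_rate c r l -> l <= - (dot q c - enorm q * r - LL q).
Proof.
move=> Dq [lo _]; apply/ler_addgt0Pr => e e0.
have [n2 hn2] := lo e e0.
pose n := maxn 1 n2.
have n0 : (0 < n)%N by rewrite leq_max.
have n0R : 0 < n%:R :> R by rewrite ltr0n.
have := le_trans (hn2 n _) (ball_prob_Chernoff c r Dq n0).
rewrite /n !leq_max !leqnn !orbT => /(_ isT); rewrite -/n lee_fin ler_expR -mulrN ler_pM2l//.
by lra.
Qed.

Lemma rate_le0 c r l : is_rate c r l -> l <= 0.
Proof.
move=> [lo _]; apply/ler_addgt0Pr => e e0.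
have [n2 hn2] := lo e e0.
pose n := maxn 1 n2.
have n0 : 0 < n%:R :> R by rewrite ltr0n leq_max.
have := le_trans (hn2 n _) (ball_prob_le1 mu c r n).
rewrite /n !leq_max !leqnn !orbT => /(_ isT); rewrite -/n lee_fin -[leRHS]expR0 ler_expR.
by rewrite pmulr_rle0//; lra.
Qed.

(** Two consecutive stretches of n letters with averages within r1 and r2 of [c] have a joint
    average within the midpoint radius. *)
Lemma rate_midpoint c r1 r2 l1 l2 l : is_rate c r1 l1 -> is_rate c r2 l2 ->
  is_rate c ((r1 + r2) / 2) l -> (l1 + l2) / 2 <= l.
Proof.
move=> [lo1 _] [lo2 _] [_ [n0 up]]; apply/ler_addgt0Pr => e e0.
have [n1 hn1] := lo1 e e0; have [n2 hn2] := lo2 e e0.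
pose n := maxn 1 (maxn n0 (maxn n1 n2)).
have n_gt0 : (0 < n)%N by rewrite leq_max.
have n0R : 0 < n%:R :> R by rewrite ltr0n.
have sup : (ball_prob c r1 n * ball_prob c r2 n <= ball_prob c ((r1 + r2) / 2) (n + n))%E.
  by apply: ball_prob_superadditive => //; rewrite natrD; lra.
have [[nn0 nn1] nn2] : ((n0 <= n)%N /\ (n1 <= n)%N) /\ (n2 <= n)%N by rewrite /n !leq_max !leqnn !orbT.
have e1 : (0 <= (expR (n%:R * (l1 - e)))%:E)%E by rewrite lee_fin expR_ge0.
have e2 : (0 <= (expR (n%:R * (l2 - e)))%:E)%E by rewrite lee_fin expR_ge0.
have := le_trans (lee_pmul e1 e2 (hn1 n nn1) (hn2 n nn2))
  (le_trans sup (up (n + n)%N (leq_trans nn0 (leq_addr _ _)))).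
rewrite -EFinM lee_fin -expRD ler_expR natrD.
move=> h; have : 0 <= n%:R * (2 * l - (l1 + l2) + 2 * e) by lra.
by rewrite pmulr_rge0//; lra.
Qed.

(* Midpoint concavity and boundedness of a monotone function of the radius
   exclude jumps: along [r - h / 3 ^ k] a jump would be repeated at every step. *)
Lemma rate_modulus c (g : R -> R) (r e B : R) : (forall s, 0 < s -> is_rate c s (g s)) ->
  (forall s, 0 < s -> B <= g s) -> 0 < r -> 0 < e ->
  exists2 h : R, 0 < h < r & g (r + h) - g (r - h) <= e.
Proof.
move=> rg gB r0 e0; apply: contrapT => /forall2NP H.
have nojump h : 0 < h < r -> e < g (r + h) - g (r - h).
  by move=> hr; have [//|/negP] := H h; rewrite -ltNge.
pose h k := r / 2 / 3 ^+ k.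
have h0 k : 0 < h k by rewrite !divr_gt0// exprn_gt0.
have hS k : h k = 3 * h k.+1 by rewrite /h exprS; field; rewrite expf_neq0.
have hr k : h k < r.
  elim: k => [|k IH]; first by rewrite /h expr0 divr1; lra.
  by have := h0 k.+1; have := hS k; lra.
have step k : B + k%:R * e <= g (r - h k).
  elim: k => [|k IH]; first by rewrite mul0r addr0 gB// subr_gt0.
  have p1 : 0 < r - h k by rewrite subr_gt0.
  have p2 : 0 < r - h k.+1 by rewrite subr_gt0.
  have p3 : 0 < r + h k.+1 by rewrite addr_gt0.
  (* The ratio 3 is what makes r - h (k+1) the midpoint of r - h k and r + h (k+1). Concavity and
     the jump then raise the rate by [e], against its upper bound 0. *)
  have mid : (r - h k + (r + h k.+1)) / 2 = r - h k.+1 by rewrite hS; lra.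
  have := @rate_midpoint c (r - h k) (r + h k.+1) _ _ (g (r - h k.+1)) (rg _ p1) (rg _ p3).
  rewrite mid => /(_ (rg _ p2)).
  have := nojump (h k.+1); rewrite h0 hr => /(_ isT).
  by have -> : k.+1%:R * e = k%:R * e + e :> R; [rewrite -natr1 mulrDl mul1r|lra].
have [k hk] : exists k : nat, - B / e < k%:R.
  by exists (Num.truncn (- B / e)).+1; exact: truncnS_gt.
have := le_trans (step k) (rate_le0 (rg _ (_ : 0 < r - h k))).
rewrite subr_gt0 hr => /(_ isT); move: hk; rewrite ltr_pdivrMr//; lra.
Qed.

End ball_rates.

(** * Deterministic consequences along a good path *)

Section rational_approximation.
Context {R : realType} {d : nat}.

Definition ratv (a : 'rV[rat]_d) : 'rV[R]_d := \row_j ratr (a ord0 j).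

Lemma ratv_dense (x : 'rV[R]_d) (s : R) : 0 < s -> exists a, forall j, `|(x - ratv a) ord0 j| <= s.
Proof.
move=> s0.
have /choice[f hf] : forall j, exists b : rat, `|x ord0 j - ratr b| <= s.
  move=> j; have [b] := @rat_in_itvoo R (x ord0 j - s) (x ord0 j + s) (ltac:(lra)).
  rewrite in_itv/= => /andP[h1 h2]; exists b; rewrite ler_norml; lra.
by exists (\row_j f j) => j; rewrite !mxE.
Qed.

Lemma ratv_dense_enorm (x : 'rV[R]_d) (s : R) : 0 < s -> exists a, enorm (x - ratv a) <= s.
Proof.
move=> s0; have s1 : 0 < s / d.+1%:R by rewrite divr_gt0.
have [a ha] := ratv_dense x s1; exists a.
apply: le_trans (enorm_le_sum _) _; apply: (@le_trans _ _ (\sum_(j < d) s / d.+1%:R)).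
  by apply: ler_sum => j _; exact: ha.
rewrite sumr_const card_ord -[leLHS]mulr_natr -mulrA ler_piMr ?(ltW s0)//.
by rewrite mulrC ler_pdivrMr// mul1r ler_nat.
Qed.

Lemma rat_between (a b : R) : a < b -> exists q : rat, a < ratr q < b.
Proof.
by move=> ab; have [q] := rat_in_itvoo ab; rewrite in_itv/= => h; exists q.
Qed.

End rational_approximation.

Section good_path.
Context {R : realType} {d : nat}.
Local Notation rV := (rVType R d).
Variable mu : probability rV R.
Variable D : set 'rV[R]_d.
Hypothesis oD : open D.
Let L (q : 'rV[R]_d) : \bar R := lne (mgf mu q).
Hypothesis DL : forall q, D q -> L q \is a fin_num.
Local Notation LL := (log_mgf mu).
Local Notation G := (mean_at mu).
Variable y : pathType rV.

Definition path_mgf n k q : R := \sum_(j < n * k) expR (dot q (psum n j y)).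
Definition path_count n k c r : R := \sum_(j < n * k) \1_(nball c r n) (psum n j y).

(* The bounds below are uniform in [k], so that countably many almost sure
   events serve all sequences of block numbers at once. *)
Definition mgf_upper q : Prop := forall e : R, 0 < e -> exists n0, forall n k,
  (n0 <= n)%N -> (0 < k)%N -> path_mgf n k q <= (n * k)%:R * expR (n%:R * (LL q + e)).

Definition count_upper c r l : Prop := forall e : R, 0 < e -> exists n0, forall n k,
  (n0 <= n)%N -> (0 < k)%N -> path_count n k c r <= (n * k)%:R * expR (n%:R * (l + e)).

Definition count_lower c r l : Prop := forall e : R, 0 < e -> exists n0, forall n k,
  (n0 <= n)%N -> (0 < k)%N -> expR (n%:R * (e - l)) <= k%:R ->
  (n * k)%:R * expR (n%:R * (l - e)) <= path_count n k c r.

Hypothesis Hmgf : forall (a : 'rV[rat]_d) (b : rat) sg,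
  D (ratv a + ratr b *: signs sg) -> mgf_upper (ratv a + ratr b *: signs sg).
Hypothesis Hup : forall (a : 'rV[rat]_d) (b : rat) l, is_rate mu (ratv a) (ratr b) l ->
  count_upper (ratv a) (ratr b) l.
Hypothesis Hlo : forall (a : 'rV[rat]_d) (b : rat) l, is_rate mu (ratv a) (ratr b) l ->
  count_lower (ratv a) (ratr b) l.

(** A small cube around [q] with rational centre and half-side has vertices among the given
    parameters. The exponential at [q] is at most the sum over vertices; semicontinuity controls LL
    there, and the number of vertices is absorbed by the exponent. *)
Lemma mgf_upperD q : D q -> mgf_upper q.
Proof.
move=> Dq e e0.
have e2 : 0 < e / 4 by rewrite divr_gt0.
have [s s0 hs] := LL_usc oD DL Dq e2.
have [b /andP[b0 bs]] : exists b : rat, 0 < (ratr b : R) < s / 2.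
  by apply: rat_between; rewrite divr_gt0.
have [a ha] := ratv_dense q b0.
pose v sg : 'rV[R]_d := ratv a + ratr b *: signs sg.
have hv sg : D (v sg) /\ LL (v sg) <= LL q + e / 4.
  have := hs (v sg - q); rewrite [q + _]addrC subrK; apply => j.
  have -> : v sg - q = - (q - ratv a) + ratr b *: signs sg.
    by rewrite /v opprB [in RHS]addrAC.
  rewrite mxE; apply: le_trans (ler_normD _ _) _; rewrite mxE normrN.
  by have := ha j; have := @signs_le _ _ sg j _ (ltW b0); lra.
have /choice[nn hnn] : forall sg, exists n0, forall n k, (n0 <= n)%N -> (0 < k)%N ->
    path_mgf n k (v sg) <= (n * k)%:R * expR (n%:R * (LL (v sg) + e / 4)).
  by move=> sg; have [Dv _] := hv sg; exact: (Hmgf Dv).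
have e2' : 0 < e / 2 by rewrite divr_gt0.
have [n2 hn2] := near_le_expR #|{ffun 'I_d -> bool}|%:R e2'.
exists (maxn n2 (\max_sg nn sg)) => n k; rewrite geq_max => /andP[nn2 nnmax] k0.
have nn1 sg : (nn sg <= n)%N by apply: leq_trans nnmax; exact: leq_bigmax.
apply: (@le_trans _ _ (\sum_sg path_mgf n k (v sg))).
  rewrite /path_mgf exchange_big/=; apply: ler_sum => j _.
  rewrite (_ : dot q _ = dot (ratv a) (psum n j y) + dot (q - ratv a) (psum n j y)).
    2: by rewrite -dotDl addrC subrK.
  rewrite expRD.
  under eq_bigr do rewrite dotDl expRD; rewrite -mulr_sumr ler_wpM2l ?expR_ge0//.
  exact: expR_dot_le_vertices.
apply: (@le_trans _ _ (\sum_(sg : {ffun 'I_d -> bool}) (n * k)%:R * expR (n%:R * (LL q + e / 2)))).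
  apply: ler_sum => sg _; apply: le_trans (hnn sg n k (nn1 sg) k0) _.
  rewrite ler_wpM2l// ler_expR ler_wpM2l//.
  by have [_] := hv sg; lra.
rewrite sumr_const -[leLHS]mulr_natr -mulrA ler_wpM2l//.
have -> : expR (n%:R * (LL q + e)) = expR (n%:R * (LL q + e / 2)) * expR (e / 2 * n%:R).
  by rewrite -expRD; congr expR; lra.
by rewrite ler_wpM2l ?expR_ge0// hn2.
Qed.

Lemma rate_exists_at q c r r0 : D q -> 0 < r0 -> eball (G q) r0 `<=` eball c r ->
  exists l, is_rate mu c r l.
Proof.
move=> Dq r00 sub; apply: rate_exists.
have [n1 hn1] := ball_prob_Cramer oD DL Dq r00 ltr01.
exists n1 => n nn; apply: lt_le_trans (le_ball_prob mu n sub).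
by apply: lt_le_trans (hn1 n nn); rewrite lte_fin expR_gt0.
Qed.

Lemma rate_exists_center q r : D q -> 0 < r -> exists l, is_rate mu (G q) r l.
Proof. by move=> Dq r0; exact: (rate_exists_at Dq r0). Qed.

Let rateI q := dot q (G q) - LL q.

Lemma le_path_count n k c c' (r r' : R) : eball c r `<=` eball c' r' ->
  path_count n k c r <= path_count n k c' r'.
Proof.
move=> sub; apply: ler_sum => j _; rewrite !indicE.
case: (boolP (psum n j y \in nball c r n)) => [/set_mem h|_]; last by rewrite ler0n.
by rewrite mem_set//; exact: sub.
Qed.

(** The ball is squeezed between two rational balls whose rates are close to [g], by [rate_modulus]
    at the radius [r]. *)
Lemma path_count_near q r g (dl : R) (k : nat -> nat) : D q -> 0 < r -> is_rate mu (G q) r g ->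
  0 < dl -> (exists n1, forall n, (n1 <= n)%N -> (0 < k n)%N /\ expR (n%:R * (rateI q + dl)) <= (k n)%:R) ->
  forall e : R, 0 < e -> exists n0, forall n, (n0 <= n)%N ->
    (n * k n)%:R * expR (n%:R * (g - e)) <= path_count n (k n) (G q) r <=
    (n * k n)%:R * expR (n%:R * (g + e)).
Proof.
move=> Dq r0 gr dl0 [n1 hk] e e0.
set x := G q.
have [gg hgg] : exists gg : R -> R, forall s, 0 < s -> is_rate mu x s (gg s).
  have /choice[f hf] : forall s, exists l, 0 < s -> is_rate mu x s l.
    move=> s; have [s0|s0] := ltP 0 s; last by exists 0 => h; lra.
    by have [l hl] := rate_exists_center Dq s0; exists l.
  by exists f.
have gB s : 0 < s -> - rateI q <= gg s.
  by move=> s0; exact: (rate_ge oD DL Dq s0 (hgg s s0)).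
have e2 : 0 < e / 2 by rewrite divr_gt0.
have [h /andP[h0 hr] hmod] := rate_modulus hgg gB r0 e2.
have h4 : 0 < h / 4 by rewrite divr_gt0.
have [a ha] := ratv_dense_enorm x h4.
(* The margin h / 4 absorbs the displacement of the centre, so that the rational balls stay nested
   between the radii r - h, r and r + h. *)
have [b1 /andP[b1l b1u]] : exists b : rat, r - 3 * h / 4 < (ratr b : R) < r - h / 4.
  by apply: rat_between; lra.
have [b2 /andP[b2l b2u]] : exists b : rat, r + h / 4 < (ratr b : R) < r + 3 * h / 4.
  by apply: rat_between; lra.
have ha' : enorm (ratv a - x) <= h / 4 by rewrite -enormN opprB.
have rh0 : 0 < r - h by rewrite subr_gt0.
have rh1 : 0 < r + h by rewrite addr_gt0.
have s1 : eball x (r - h) `<=` eball (ratv a) (ratr b1) by apply: subset_eball; lra.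
have s2 : eball (ratv a) (ratr b1) `<=` eball x r by apply: subset_eball; lra.
have s3 : eball x r `<=` eball (ratv a) (ratr b2) by apply: subset_eball; lra.
have s4 : eball (ratv a) (ratr b2) `<=` eball x (r + h) by apply: subset_eball; lra.
have [l1 hl1] := rate_exists_at Dq rh0 s1.
have [l2 hl2] := rate_exists_at Dq r0 s3.
have t1 := le_rate (hgg _ rh0) hl1 s1.
have t2 := le_rate hl1 gr s2.
have t3 := le_rate gr hl2 s3.
have t4 := le_rate hl2 (hgg _ rh1) s4.
have t5 := rate_ge oD DL Dq rh0 hl1 s1.
(* The inner rate is at least [- rateI q], so an error of at most [dl] keeps the number of blocks
   required by [Hlo] below [k n]. *)
pose e' := Num.min (e / 2) dl.
have e'0 : 0 < e' by rewrite lt_min e2.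
have e'e : e' <= e / 2 by rewrite ge_min lexx.
have e'd : e' <= dl by rewrite ge_min lexx orbT.
have [n2 hn2] := Hlo hl1 e'0.
have [n3 hn3] := Hup hl2 e2.
exists (maxn n1 (maxn n2 n3)) => n; rewrite !geq_max => /and3P[nn1 nn2 nn3].
have [k0 kn] := hk n nn1.
apply/andP; split.
  apply: le_trans (le_path_count n (k n) s2); apply: le_trans (hn2 n (k n) nn2 k0 _).
    by rewrite ler_wpM2l// ler_expR ler_wpM2l//; lra.
  apply: le_trans kn; rewrite ler_expR ler_wpM2l//.
  by have : - rateI q <= l1 := t5; lra.
apply: le_trans (le_path_count n (k n) s3) _; apply: le_trans (hn3 n (k n) nn3 k0) _.
by rewrite ler_wpM2l// ler_expR ler_wpM2l//; lra.
Qed.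

(** Only windows with average near [G q] are kept. The case [p = q] serves the first clause of LD;
    in the third, [p] lies beyond [q] on the same ray. *)
Lemma path_mgf_lower q p (dl : R) (k : nat -> nat) : D q -> 0 < dl ->
  (exists n1, forall n, (n1 <= n)%N -> (0 < k n)%N /\ expR (n%:R * (rateI q + dl)) <= (k n)%:R) ->
  forall e : R, 0 < e -> exists n0, forall n, (n0 <= n)%N ->
    (n * k n)%:R * expR (n%:R * (dot p (G q) - rateI q - e)) <= path_mgf n (k n) p.
Proof.
move=> Dq dl0 hk e e0.
have p1 : 0 < enorm p + 1 by rewrite ltr_wpDl ?enorm_ge0.
pose r := e / 2 / (enorm p + 1).
have r0 : 0 < r by rewrite !divr_gt0.
have pr : enorm p * r <= e / 2.
  rewrite -[leRHS](divfK (lt0r_neq0 p1)) -/r mulrC ler_wpM2l ?(ltW r0)//; lra.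
have [g hg] := rate_exists_center Dq r0.
have e2 : 0 < e / 2 by rewrite divr_gt0.
have [n1 hn1] := path_count_near Dq r0 hg dl0 hk e2.
have gI := rate_ge oD DL Dq r0 hg (@subset_refl _ _).
exists (maxn 1 n1) => n; rewrite geq_max => /andP[n0 nn1].
have n0R : 0 < n%:R :> R by rewrite ltr0n.
have /andP[lo _] := hn1 n nn1.
apply: (@le_trans _ _ (path_count n (k n) (G q) r * expR (n%:R * (dot p (G q) - e / 2)))).
  apply: le_trans; last by apply: ler_wpM2r lo; exact: expR_ge0.
  rewrite -mulrA -expRD ler_wpM2l// ler_expR -mulrDr ler_wpM2l//.
  by have : - rateI q <= g := gI; lra.
rewrite /path_count mulr_suml; apply: ler_sum => j _; rewrite indicE.
case: (boolP (psum n j y \in nball (G q) r n)) => [/set_mem h|_]; last first.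
  by rewrite mul0r expR_ge0.
rewrite mul1r ler_expR.
have -> : dot p (psum n j y) = n%:R * dot p (n%:R^-1 *: (psum n j y : 'rV[R]_d)).
  by rewrite dotZr mulrA divff ?gt_eqF// mul1r.
rewrite ler_wpM2l//.
have := dot_le_enorm p (G q - n%:R^-1 *: (psum n j y : 'rV[R]_d)).
have : enorm p * enorm (G q - n%:R^-1 *: (psum n j y : 'rV[R]_d)) <= enorm p * r.
  by rewrite ler_wpM2l ?enorm_ge0// -enormN opprB.
by rewrite dotBr; lra.
Qed.

End good_path.

Section exponential_growth.
Context {R : realType}.

Lemma cvg_scaled_lne (b : nat -> R) (l : R) :
  (forall e : R, 0 < e -> exists n0, forall n, (n0 <= n)%N ->
     expR (n%:R * (l - e)) <= b n <= expR (n%:R * (l + e))) ->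
  ((n%:R^-1)%:E * lne (b n)%:E)%E @[n --> \oo] --> l%:E.
Proof.
move=> H.
have bE n : 0 < b n -> ((n%:R^-1)%:E * lne (b n)%:E)%E = (n%:R^-1 * ln (b n))%:E.
  by move=> b0; rewrite lne_EFin// -EFinM.
have [n1 hn1] := H 1 ltr01.
have b0 n : (n1 <= n)%N -> 0 < b n.
  by move=> /hn1/andP[h _]; apply: lt_le_trans h; exact: expR_gt0.
apply/fine_cvgP; split.
  by exists n1 => // n /= nn; rewrite bE// b0.
apply/cvgrPdist_le => /= e e0; have [n0 hn0] := H e e0.
exists (maxn 1 (maxn n0 n1)) => // n /=; rewrite !geq_max => /and3P[n_gt0 nn0 nn1].
have n0R : 0 < n%:R :> R by rewrite ltr0n.
rewrite bE ?b0//=; have := hn0 n nn0.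
rewrite -[b n](lnK (_ : _ \is Num.pos)) ?posrE ?b0// expRK !ler_expR => /andP[h1 h2].
rewrite ler_distlC mulrC ler_pdivlMr// ler_pdivrMr//.
by rewrite mulrC h1 mulrC h2.
Qed.

Variable k : nat -> nat.
Hypothesis kinc : increasing_pos k.

Lemma growth_gt (l : \bar R) (a : R) : growth k n @[n --> \oo] --> l -> (a%:E < l)%E ->
  exists n1, forall n, (n1 <= n)%N -> (0 < k n)%N /\ expR (n%:R * a) <= (k n)%:R.
Proof.
move=> kl al.
have [n1 _ hn1] : \forall n \near \oo, (a%:E < growth k n)%E.
  by move: kl => /(_ [set x | (a%:E < x)%E]); apply; exact: open_ereal_gt'.
exists (maxn 1 n1) => n; rewrite geq_max => /andP[n0 nn1].
have n0R : 0 < n%:R :> R by rewrite ltr0n.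
have [k0 _] := kinc n0; split => //.
have := hn1 n nn1; rewrite /= /growth lte_fin ltr_pdivlMr// => h.
by rewrite -[leRHS](lnK (_ : _ \is Num.pos)) ?posrE ?ltr0n// ler_expR mulrC ltW.
Qed.

Lemma growth_lt (l : \bar R) (a : R) : growth k n @[n --> \oo] --> l -> (l < a%:E)%E ->
  exists n1, forall n, (n1 <= n)%N -> (0 < k n)%N /\ (k n)%:R <= expR (n%:R * a).
Proof.
move=> kl al.
have [n1 _ hn1] : \forall n \near \oo, (growth k n < a%:E)%E.
  by move: kl => /(_ [set x | (x < a%:E)%E]); apply; exact: open_ereal_lt'.
exists (maxn 1 n1) => n; rewrite geq_max => /andP[n0 nn1].
have n0R : 0 < n%:R :> R by rewrite ltr0n.
have [k0 _] := kinc n0; split => //.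
have := hn1 n nn1; rewrite /= /growth lte_fin ltr_pdivrMr// => h.
by rewrite -[leLHS](lnK (_ : _ \is Num.pos)) ?posrE ?ltr0n// ler_expR mulrC ltW.
Qed.

Lemma near_nat_le_expR (c : R) : 0 < c -> exists n0, forall n, (n0 <= n)%N ->
  n%:R <= expR (c * n%:R).
Proof.
move=> c0; have c2 : 0 < c / 2 by rewrite divr_gt0.
have [n0 hn0] := near_le_expR (c / 2)^-1 c2.
exists n0 => n nn; apply: le_trans (nat_le_expR n c2) _.
have -> : expR (c * n%:R) = expR (c / 2 * n%:R) * expR (c / 2 * n%:R).
  by rewrite -expRD; congr expR; lra.
by rewrite ler_wpM2r ?expR_ge0// hn0.
Qed.

End exponential_growth.

Section empirical.
Context {R : realType} {d : nat}.
Local Notation rV := (rVType R d).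
Local Notation borel_rV := (g_sigma_algebraType (@open 'rV[R]_d)).
Variable y : pathType rV.

Definition path_walk n : 'rV[R]_d := \sum_(k < n) (y k : 'rV[R]_d).

Lemma increment_path_walk n j : increment path_walk n j = n%:R^-1 *: (psum n j y : 'rV[R]_d).
Proof. by rewrite /increment /path_walk big_split_ord/= [in LHS]addrAC subrr add0r. Qed.

(** The empirical measures live on the sigma-algebra generated by open sets, for which coordinates
    are measurable by continuity. *)
Lemma measurable_borel_expR_dot (q : 'rV[R]_d) (c : R) :
  measurable_fun setT (fun x : borel_rV => expR (c * dot q x)).
Proof.
apply: measurableT_comp => //; apply: measurable_funM => //.
apply: measurable_sum => j; apply: measurable_funM => //.
apply: (measurability _ (RGenOpens.measurableE R)).
move=> _ [_ [a [b ->] <-]]; rewrite setTI; apply: sub_sigma_algebra.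
have /continuousP cf : continuous (fun x : 'rV[R]_d => x ord0 j) by exact: coord_continuous.
exact/cf/interval_open.
Qed.

Lemma empirical_logmgf_path (k : nat -> nat) n q : (0 < n)%N ->
  empirical_logmgf path_walk k n q =
  lne (((n * k n)%:R^-1 * path_mgf y n (k n) q)%:E).
Proof.
move=> n0; rewrite /empirical_logmgf; congr lne.
have n0R : n%:R != 0 :> R by rewrite pnatr_eq0 -lt0n.
have me : measurable_fun setT (fun x : borel_rV => (expR (n%:R * dot q x))%:E).
  by apply/measurable_EFinP; exact: measurable_borel_expR_dot.
rewrite ge0_integral_mscale//.
rewrite ge0_integral_measure_sum//.
rewrite EFinM /path_mgf -sumEFin; congr (_ * _)%E; apply: eq_bigr => j _.
rewrite integral_dirac//= diracT mul1e increment_path_walk dotZr mulrA divff// mul1r//.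
Qed.

Lemma scaled_log_ball_path (k : nat -> nat) c r n :
  scaled_log_ball path_walk k c r n =
  ((n%:R^-1)%:E * lne (((n * k n)%:R^-1 * path_count y n (k n) c r)%:E))%E.
Proof.
rewrite /scaled_log_ball; congr (_ * lne _)%E; rewrite /empirical /mscale /msum /=.
rewrite EFinM /path_count -sumEFin; congr (_ * _)%E; apply: eq_bigr => j _.
by rewrite /dirac increment_path_walk !indicE.
Qed.

End empirical.

(** [l], [l'], [l2] stand for LL at lambda, (1 - h) lambda and (1 - 2 h) lambda, and [m], [m'] for
    the slopes along lambda at the first two. Tangents at (1 - h) lambda and the quadratic bound at
    lambda put [m'] within 4 C h of [m]; the last conclusion compares the two rates. *)
Lemma rate_arithmetic (R : realFieldType) (l l' l2 m m' h C eta : R) :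
  0 < h -> h <= 1 / 2 -> 4 * C * h <= eta ->
  l + - h * m <= l' -> l' + h * m' <= l -> l' + - h * m' <= l2 ->
  l2 <= l + - (2 * h) * m + C * (- (2 * h)) ^+ 2 ->
  [/\ 0 < 1 - h < 1, m - eta <= m', l - h * m <= l' &
    l - h * m < l' -> (1 - h) * m' - l' < m - l].
Proof.
move=> h0 h1 hC t1 t2 t3 q2.
have mm' : 0 <= h * (m - m') by lra.
rewrite pmulr_rge0// in mm'.
split; first by apply/andP; split; lra.
- have : h * (m - m' - 4 * C * h) <= 0 by rewrite expr2 in q2; lra.
  by rewrite pmulr_rle0//; lra.
- by lra.
have : 0 <= (1 - h) * (m - m') by rewrite mulr_ge0//; lra.
lra.
Qed.

Lemma lt_half_between (R : realFieldType) (a b : R) : a < b -> a + (b - a) / 2 < b.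
Proof. by move=> ab; lra. Qed.

Lemma sum_rate (R : realFieldType) (l m eta : R) : l + (m - l + eta / 2) + eta / 2 = m + eta.
Proof. by field. Qed.

(** In the third clause, [s * m' - l'] is the rate of s lambda and the last hypothesis is the
    tangent inequality at lambda. *)
Lemma lower_arithmetic (R : realFieldType) (l l' m m' th s eta e : R) :
  0 < s < 1 -> 1 <= th -> 0 < eta -> th * eta = e / 2 -> m - eta <= m' ->
  l + (s - 1) * m <= l' ->
  l + (th - 1) * m - e <= th * m' - (s * m' - l') - e / 2.
Proof.
move=> /andP[s0 s1] th1 eta0 etaE mm tg.
have : (th - s) * (m - eta) <= (th - s) * m' by rewrite ler_wpM2l// subr_ge0; lra.
have : 0 <= s * eta by rewrite mulr_ge0 ?ltW.
lra.
Qed.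

Lemma upper_arithmetic (R : realFieldType) (l m th eta e x : R) : 0 <= x -> 0 < eta ->
  th * eta = e / 2 ->
  (th - 1) * (x * (m + eta)) + x * (l + e / 2) <= x * (l + (th - 1) * m + e).
Proof.
move=> x0 eta0 etaE.
have -> : (th - 1) * (x * (m + eta)) + x * (l + e / 2) =
  x * (l + (th - 1) * m + (th * eta - eta + e / 2)) by ring.
by rewrite ler_wpM2l// etaE; lra.
Qed.

Section good_path_LD.
Context {R : realType} {d : nat}.
Local Notation rV := (rVType R d).
Variable mu : probability rV R.
Variable D : set 'rV[R]_d.
Hypothesis oD : open D.
Let L (q : 'rV[R]_d) : \bar R := lne (mgf mu q).
Hypothesis DL : forall q, D q -> L q \is a fin_num.
Local Notation LL := (log_mgf mu).
Local Notation G := (mean_at mu).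
Variable y : pathType rV.
Hypothesis Hmgf : forall (a : 'rV[rat]_d) (b : rat) sg,
  D (ratv a + ratr b *: signs sg) -> mgf_upper mu y (ratv a + ratr b *: signs sg).
Hypothesis Hup : forall (a : 'rV[rat]_d) (b : rat) l, is_rate mu (ratv a) (ratr b) l ->
  count_upper y (ratv a) (ratr b) l.
Hypothesis Hlo : forall (a : 'rV[rat]_d) (b : rat) l, is_rate mu (ratv a) (ratr b) l ->
  count_lower y (ratv a) (ratr b) l.

Let rateI q : R := dot q (G q) - LL q.

Let conjE q : D q -> conjugate L (gradient L q) = (- rateI q)%:E.
Proof. by move=> Dq; rewrite /L (gradient_LL oD DL Dq) (conjugate_mean oD DL Dq) opprB. Qed.

Let expR_dot_le_mgf n k q j : (j < n * k)%N -> expR (dot q (psum n j y)) <= path_mgf y n k q.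
Proof.
move=> jn; rewrite /path_mgf (bigD1 (Ordinal jn))//= lerDl.
by apply: sumr_ge0 => *; exact: expR_ge0.
Qed.

(* The empirical exponential moments dominate every single increment. *)
Let dot_increment_le q (a e : R) (k : nat -> nat) : D q -> 0 < e ->
  (exists n1, forall n, (n1 <= n)%N -> (0 < k n)%N /\ (k n)%:R <= expR (n%:R * a)) ->
  exists n0, forall n, (n0 <= n)%N -> forall j, (j < n * k n)%N ->
    dot q (psum n j y) <= n%:R * (LL q + a + e).
Proof.
move=> Dq e0 [n1 hk]; have e2 : 0 < e / 2 by rewrite divr_gt0.
have [n2 hn2] := mgf_upperD oD DL Hmgf Dq e2.
have [n3 hn3] := near_nat_le_expR e2.
exists (maxn n1 (maxn n2 n3)) => n; rewrite !geq_max => /and3P[nn1 nn2 nn3] j jn.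
have [k0 ka] := hk n nn1.
rewrite -ler_expR; apply: le_trans (expR_dot_le_mgf q jn) _.
apply: le_trans (hn2 n (k n) nn2 k0) _.
have -> : n%:R * (LL q + a + e) = e / 2 * n%:R + n%:R * a + n%:R * (LL q + e / 2) by lra.
rewrite !expRD ler_wpM2r ?expR_ge0// natrM ler_pM// hn3//.
Qed.

(** [mgf_upperD] and [path_mgf_lower], both at [lam], squeeze the exponential moments. The ball
    limits are the rates [gg r]. *)
Lemma good_path_LD1 k : increasing_pos k -> cvgn (growth k : nat -> \bar R) ->
  LD1 L D (path_walk y) k.
Proof.
move=> kinc kcv lam Dl.
have [-> _] := cvg_limn_einf_sup kcv; rewrite conjE// -EFinN opprK => hI.
have [dl dl0 hk] : exists2 dl, 0 < dl & exists n1, forall n, (n1 <= n)%N ->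
    (0 < k n)%N /\ expR (n%:R * (rateI lam + dl)) <= (k n)%:R.
  suff [a al ga] : exists2 a, rateI lam < a & (a%:E < limn (growth k))%E.
    exists (a - rateI lam); first by rewrite subr_gt0.
    by rewrite addrC subrK; exact: growth_gt kinc _ _ kcv ga.
  move: hI; case: (limn (growth k)) => [l| |]//.
  - rewrite lte_fin => hl; exists ((rateI lam + l) / 2); rewrite ?lte_fin; lra.
  - by move=> _; exists (rateI lam + 1); rewrite ?ltry//; lra.
have kpos n : (0 < n)%N -> 0 < (n * k n)%:R :> R.
  by move=> n0; have [k0 _] := kinc n n0; rewrite ltr0n muln_gt0 n0.
have ball_cvg r g : 0 < r -> is_rate mu (G lam) r g ->
    scaled_log_ball (path_walk y) k (G lam) r n @[n --> \oo] --> g%:E.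
  move=> r0 hg; under eq_fun do rewrite scaled_log_ball_path.
  apply: cvg_scaled_lne => e e0.
  have [n1 hn1] := path_count_near oD DL Hup Hlo Dl r0 hg dl0 hk e0.
  exists (maxn 1 n1) => n; rewrite geq_max => /andP[n0 nn1].
  have := hn1 n nn1; rewrite ler_pdivlMl ?kpos// ler_pdivrMl ?kpos//.
have [gg hgg] : exists gg : R -> R, forall r, 0 < r -> is_rate mu (G lam) r (gg r).
  have /choice[f hf] : forall r, exists l, 0 < r -> is_rate mu (G lam) r l.
    move=> r; have [r0|r0] := ltP 0 r; last by exists 0.
    by have [l hl] := rate_exists_center oD DL Dl r0; exists l.
  by exists f.
have GE : gradient L lam = G lam by rewrite /L (gradient_LL oD DL Dl).
split; rewrite ?GE.
- rewrite [L lam](D_LE DL Dl).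
  apply: (@cvg_trans _ ((n%:R^-1)%:E * lne (((n * k n)%:R^-1 * path_mgf y n (k n) lam)%:E)
    @[n --> \oo])%E).
    apply: near_eq_cvg; exists 1%N => // n /= n0.
    by rewrite empirical_logmgf_path.
  apply: cvg_scaled_lne => e e0.
  have [n1 hn1] := path_mgf_lower oD DL Hup Hlo lam Dl dl0 hk e0.
  have [n2 hn2] := mgf_upperD oD DL Hmgf Dl e0.
  exists (maxn 1 (maxn n1 n2)) => n; rewrite !geq_max => /and3P[n0 nn1 nn2].
  have [k0 _] := kinc n n0.
  rewrite ler_pdivlMl ?kpos// ler_pdivrMl ?kpos// (hn2 n (k n) nn2 k0) andbT.
  by have := hn1 n nn1; rewrite /= subKr.
- exists 1 => //= e _ e0; apply/cvg_ex; exists (gg e)%:E.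
  exact: ball_cvg (hgg _ e0).
- apply: (@cvg_trans _ ((gg e)%:E @[e --> 0^'+])).
    apply: near_eq_cvg; exists 1 => //= e _ e0; apply/esym/cvg_lim => //.
    exact: ball_cvg (hgg _ e0).
  apply: cvg_EFin; first exact: nearW.
  (* The rate at radius r lies between [- rateI lam] and [- rateI lam + enorm lam * r], by the
     Cramer and Chernoff bounds. *)
  apply/cvgrPdist_le => /= e e0.
  have l1 : 0 < enorm lam + 1 by rewrite ltr_wpDl ?enorm_ge0.
  exists (e / (enorm lam + 1)); first by rewrite /= divr_gt0.
  move=> r /=; rewrite sub0r normrN => re r0; move: re.
  rewrite gtr0_norm// ltr_pdivlMr// => re.
  have h1 := rate_ge oD DL Dl r0 (hgg r r0) (@subset_refl _ _).
  have h2 := rate_le DL Dl (hgg r r0).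
  rewrite ler_norml /rateI; apply/andP; split; lra.
Qed.

(** With so few windows, the bound on the sum of exponentials already prevents every single
    increment from reaching, in direction [lam], the values taken on a small ball around the
    gradient. *)
Lemma good_path_LD2 k : increasing_pos k -> cvgn (growth k : nat -> \bar R) ->
  LD2 L D (path_walk y) k.
Proof.
move=> kinc kcv lam Dl.
have [_ ->] := cvg_limn_einf_sup kcv; rewrite conjE// -EFinN opprK => hI.
have [a al ga] : exists2 a, a < rateI lam & (limn (growth k) < a%:E)%E.
  move: hI; case: (limn (growth k)) => [l| |]//.
  - rewrite lte_fin => hl; exists ((rateI lam + l) / 2); rewrite ?lte_fin; lra.
  - by move=> _; exists (rateI lam - 1); rewrite ?ltNyr//; lra.
rewrite /L (gradient_LL oD DL Dl); pose dl := rateI lam - a.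
have dl0 : 0 < dl by rewrite subr_gt0.
have l1 : 0 < enorm lam + 1 by rewrite ltr_wpDl ?enorm_ge0.
pose r := dl / 2 / (enorm lam + 1).
have r0 : 0 < r by rewrite !divr_gt0.
have lr : enorm lam * r <= dl / 2.
  rewrite -[leRHS](divfK (lt0r_neq0 l1)) -/r mulrC ler_wpM2l ?(ltW r0)//; lra.
exists r => //.
have dl4 : 0 < dl / 4 by rewrite divr_gt0.
have [n1 hn1] := dot_increment_le Dl dl4 (growth_lt kinc kcv ga).
exists (maxn 1 n1) => // n /=; rewrite geq_max => /andP[n0 nn1] j jn.
have n0R : 0 < n%:R :> R by rewrite ltr0n.
rewrite increment_path_walk eballE => h.
have := hn1 n nn1 j jn; set x : 'rV[R]_d := n%:R^-1 *: _ in h.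
have -> : dot lam (psum n j y) = n%:R * dot lam x.
  by rewrite dotZr mulrA divff ?gt_eqF// mul1r.
rewrite ler_pM2l// => h'.
have := dot_le_enorm lam (G lam - x).
have : enorm lam * enorm (G lam - x) <= enorm lam * r.
  by rewrite ler_wpM2l ?enorm_ge0// -enormN opprB.
rewrite dotBr; move: al; rewrite /dl /rateI in lr dl4 h' *; lra.
Qed.

(* [s lambda] with [s < 1] close to [1] has a strictly smaller rate, unless
   [Lambda] is affine along the ray of [lambda]. *)
Let smaller_rate lam (eta : R) : D lam -> ~ affine_near1 L lam -> 0 < eta ->
  exists s q, q = s *: lam /\
    [/\ 0 < s < 1, D q, dot lam (G lam) - eta <= dot lam (G q) & rateI q < rateI lam].
Proof.
move=> Dl naff eta0; have [C [s0 [C0 s00 hq]]] := LL_quadratic oD DL lam Dl.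
have C1 : 0 < 4 * C + 1 by rewrite ltr_wpDl// mulr_ge0.
have [h [h0 hs0 h1 hC]] : exists h : R, [/\ 0 < h, h <= s0 / 2, h <= 1 / 2 & 4 * C * h <= eta].
  exists (Num.min (s0 / 2) (Num.min (1 / 2) (eta / (4 * C + 1)))); split.
  - by rewrite !lt_min !divr_gt0.
  - by rewrite ge_min lexx.
  - by rewrite !ge_min lexx orbT.
  set h := Num.min _ _; have hh : h <= eta / (4 * C + 1) by rewrite /h !ge_min lexx !orbT.
  have h0 : 0 <= h by rewrite !le_min !divr_ge0// ltW.
  move: hh h0; rewrite ler_pdivlMr//; lra.
have qE t : lam + t *: lam = (1 + t) *: lam by rewrite scalerDl scale1r.
have D1 : D ((1 - h) *: lam).
  by rewrite -qE; have [|//] := hq (- h); rewrite normrN gtr0_norm//; lra.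
have [D2 q2] : D ((1 - 2 * h) *: lam) /\ LL ((1 - 2 * h) *: lam) <=
    LL lam + (- (2 * h)) * dot lam (G lam) + C * (- (2 * h)) ^+ 2.
  by rewrite -qE; apply: hq; rewrite normrN gtr0_norm//; lra.
set q := (1 - h) *: lam in D1 *.
have t1 := LL_tangent oD DL q Dl.
have t2 := LL_tangent oD DL lam D1.
have t3 := LL_tangent oD DL ((1 - 2 * h) *: lam) D1.
rewrite /= (D_LE DL D1) lee_fin (_ : q - lam = (- h) *: lam) in t1; last first.
  by rewrite /q scalerBl scale1r addrAC subrr add0r scaleNr.
rewrite /= (D_LE DL Dl) lee_fin (_ : lam - q = h *: lam) in t2; last first.
  by rewrite /q scalerBl scale1r opprB addrC subrK.
rewrite /= (D_LE DL D2) lee_fin (_ : _ - q = (- h) *: lam) in t3; last first.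
  have -> : - h = 1 - 2 * h - (1 - h) by ring.
  by rewrite [RHS]scalerBl.
rewrite !dotZl in t1 t2 t3.
have [h01 mm l_le Ilt] := rate_arithmetic h0 h1 hC t1 t2 t3 q2.
exists (1 - h), q; split => //; split => //.
rewrite /rateI [dot q _]dotZl; apply: Ilt; rewrite lt_neqAle l_le andbT.
(* Equality in the tangent inequality from [lam] to [q] is equality in Jensen's inequality, so L is
   affine on the whole line and in particular near 1. *)
apply/negP => /eqP E; apply: naff.
have /andP[q0 qoo] := D_mgf DL Dl.
have [s s_gt0 Ds] := D_line oD ((- h) *: lam) Dl.
have hp : (mgf mu (lam + s *: ((- h) *: lam)) < +oo)%E.
  by apply: (D_ltoo DL); apply: Ds; rewrite ger0_norm// ltW.
have hm : (mgf mu (lam - s *: ((- h) *: lam)) < +oo)%E.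
  by rewrite -scaleNr; apply: (D_ltoo DL); apply: Ds; rewrite normrN ger0_norm// ltW.
have eqt : mgf mu (lam + (- h) *: lam) =
    (fine (mgf mu lam) * expR (tilted_slope mu lam ((- h) *: lam)))%:E.
  rewrite (tilted_slopeE oD DL _ Dl) dotZl qE -/q (D_mgfE DL D1) (D_mgfE DL Dl) /= -expRD.
  by rewrite -E mulNr.
exists (LL lam - dot lam (G lam)), (dot lam (G lam)); apply/nbhs_ballP; exists 1 => //= th _.
have := mgf_tangent_eq s_gt0 qoo hp hm q0 eqt ((1 - th) / h).
rewrite (tilted_slopeE oD DL _ Dl) dotZl (D_mgfE DL Dl) scalerA qE.
have h0' : h != 0 by rewrite gt_eqF.
have -> : 1 + (1 - th) / h * - h = th by field.
rewrite /L => ->; rewrite [fine _]/= -expRD lne_EFin ?expR_gt0// expRK; congr EFin.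
by field.
Qed.

(** At critical growth no window exceeds n (m + eta) along [lam], so passing from [lam] to
    [th *: lam] costs at most (th - 1) n (m + eta) in the exponent. From below, s lam with s < 1 is
    supercritical and yields windows near [G (s *: lam)], whose slope is at least m - eta. *)
Lemma good_path_LD3 k : increasing_pos k -> LD3 L D (path_walk y) k.
Proof.
move=> kinc lam Dl; rewrite conjE// -EFinN opprK => kI naff th th1.
rewrite /L (gradient_LL oD DL Dl) (D_LE DL Dl : lne (mgf mu lam) = _) -EFinD; set m := dot lam (G lam).
apply: (@cvg_trans _ ((n%:R^-1)%:E *
    lne (((n * k n)%:R^-1 * path_mgf y n (k n) (th *: lam))%:E) @[n --> \oo])%E).
  apply: near_eq_cvg; exists 1%N => // n /= n0.
  by rewrite empirical_logmgf_path.
apply: cvg_scaled_lne => e e0.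
have kpos n : (0 < n)%N -> 0 < (n * k n)%:R :> R.
  by move=> n0; have [k0 _] := kinc n n0; rewrite ltr0n muln_gt0 n0.
have th0 : 0 < th by lra.
pose eta := e / (2 * th); have eta0 : 0 < eta by rewrite divr_gt0// mulr_gt0.
have etaE : th * eta = e / 2 by rewrite /eta; field; rewrite gt_eqF.
have [s [q [qE [/andP[s0 s1] Ds ms Is]]]] := smaller_rate Dl naff eta0.
have Idl : 0 < (rateI lam - rateI q) / 2 by rewrite divr_gt0// subr_gt0.
have hI : ((rateI q + (rateI lam - rateI q) / 2)%:E < (rateI lam)%:E)%E.
  by rewrite lte_fin lt_half_between.
have hk1 := growth_gt kinc kI hI.
have e2 : 0 < e / 2 by rewrite divr_gt0.
have [n1 hn1] := path_mgf_lower oD DL Hup Hlo (th *: lam) Ds Idl hk1 e2.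
have eta2 : 0 < eta / 2 by rewrite divr_gt0.
have hk2 := growth_lt kinc kI (_ : ((rateI lam)%:E < (rateI lam + eta / 2)%:E)%E).
have {}hk2 := hk2 ltac:(by rewrite lte_fin ltrDl).
have [n2 hn2] := dot_increment_le Dl eta2 hk2.
have [n3 hn3] := mgf_upperD oD DL Hmgf Dl e2.
exists (maxn 1 (maxn n1 (maxn n2 n3))) => n; rewrite !geq_max => /and4P[n0 nn1 nn2 nn3].
have n0R : 0 < n%:R :> R by rewrite ltr0n.
have [k0 _] := kinc n n0.
rewrite ler_pdivlMl ?kpos// ler_pdivrMl ?kpos//; apply/andP; split.
  apply: le_trans (hn1 n nn1); rewrite ler_wpM2l// ler_expR ler_wpM2l//= !dotZl.
  have := LL_tangent oD DL q Dl.
  rewrite /= (D_LE DL Ds) lee_fin (_ : q - lam = (s - 1) *: lam); last first.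
    by rewrite qE scalerBl scale1r.
  rewrite dotZl; have -> : dot q (G q) = s * dot lam (G q) by rewrite {1}qE dotZl.
  by apply: (lower_arithmetic (_ : 0 < s < 1) th1 eta0 etaE) => //; apply/andP.
apply: (@le_trans _ _ (path_mgf y n (k n) lam * expR ((th - 1) * (n%:R * (m + eta))))).
  rewrite /path_mgf mulr_suml; apply: ler_sum => j _.
  rewrite -expRD ler_expR dotZl -[X in _ <= X + _]mul1r -{1}[th](subrK 1) addrC mulrDl lerD2l.
  rewrite ler_wpM2l ?subr_ge0//; apply: le_trans (hn2 n nn2 j (ltn_ord j)) _.
  by rewrite ler_wpM2l// /rateI -/m sum_rate.
apply: le_trans (ler_wpM2r (expR_ge0 _) (hn3 n (k n) nn3 k0)) _.
rewrite -mulrA -expRD ler_wpM2l// ler_expR -[leLHS]addrC.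
exact: (upper_arithmetic _ _ _ eta0 etaE).
Qed.

Lemma good_path_LD : LD L D (path_walk y).
Proof.
move=> k kinc kcv; split; first exact: good_path_LD1.
  exact: good_path_LD2.
exact: good_path_LD3.
Qed.

(** The Chernoff bound at a small multiple t v, for the window starting at 0 and k constantly 1,
    bounds the averages along [v]; the error C t^2 of LL is negligible against t. The 2 d signed
    coordinate directions suffice. *)
Lemma good_path_mean : D 0 -> n%:R^-1 *: path_walk y n @[n --> \oo] --> gradient L 0.
Proof.
move=> D0; rewrite /L (gradient_LL oD DL D0).
have LL0 : LL 0 = 0.
  have := D_mgfE DL D0; rewrite /mgf.
  under eq_integral do rewrite dot0l expR0.
  rewrite integral_cst// mul1e [X in X = _](_ : _ = 1%E); last exact: probability_setT.
  by move=> -[E]; apply: expR_inj; rewrite expR0 -E.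
have key v (eta : R) : 0 < eta -> exists n0, forall n, (n0 <= n)%N ->
    dot v (n%:R^-1 *: path_walk y n) <= dot v (G 0) + eta.
  move=> eta0; have [C [s0 [C0 s00 hq]]] := LL_quadratic oD DL v D0.
  have C1 : 0 < C + 1 by rewrite ltr_wpDl.
  pose t := Num.min s0 (eta / 2 / (C + 1)).
  have t0 : 0 < t by rewrite lt_min s00 !divr_gt0.
  have tC : C * t <= eta / 2.
    have : t <= eta / 2 / (C + 1) by rewrite ge_min lexx orbT.
    by rewrite ler_pdivlMr//; lra.
  have [|Dt qt] := hq t; first by rewrite gtr0_norm// ge_min lexx.
  rewrite LL0 !add0r in Dt qt.
  have e0 : 0 < t * eta / 4 by rewrite divr_gt0// mulr_gt0.
  have k1 : exists n1, forall n, (n1 <= n)%N -> (0 < 1)%N /\ 1%:R <= expR (n%:R * 0) :> R.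
    by exists 0 => n _; rewrite mulr0 expR0.
  have e2 : 0 < t * (eta / 2) by rewrite !mulr_gt0// divr_gt0.
  have [n1 hn1] := @dot_increment_le _ 0 _ (fun=> 1%N) Dt e2 k1.
  exists (maxn 1 n1) => n; rewrite geq_max => /andP[n0 nn1].
  have n0R : 0 < n%:R :> R by rewrite ltr0n.
  have /= := hn1 n nn1 0; rewrite muln1 => /(_ n0).
  have -> : psum n 0 y = path_walk y n by [].
  move=> h; rewrite dotZr mulrC ler_pdivrMr//; move: h; rewrite dotZl addr0 => h.
  have h2 : t * dot v (path_walk y n) <= t * ((dot v (G 0) + eta) * n%:R).
    apply: le_trans h _; rewrite [leRHS]mulrA [leLHS]mulrC ler_wpM2r//.
    have : t * (C * t) <= t * (eta / 2) by rewrite ler_wpM2l// ltW.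
    by rewrite expr2 in qt; lra.
  by rewrite ler_pM2l in h2.
apply/cvg_ballP => e e0; have e2 : 0 < e / 2 by rewrite divr_gt0.
have /choice[nn hnn] : forall z : 'I_d * bool, exists n0, forall n, (n0 <= n)%N ->
    dot ((if z.2 then 1 else -1) *: delta_mx ord0 z.1) (n%:R^-1 *: path_walk y n) <=
    dot ((if z.2 then 1 else -1) *: delta_mx ord0 z.1) (G 0) + e / 2.
  by move=> z; exact: key.
exists (\max_z nn z) => // n /= nz.
have nzn z : (nn z <= n)%N by apply: leq_trans nz; exact: leq_bigmax.
split => // i j; rewrite /ball/= !ord1.
have := hnn (j, true) n (nzn _); have := hnn (j, false) n (nzn _).
rewrite /= !dotZl !dot_delta => h1 h2.
by rewrite ltr_norml; apply/andP; split; lra.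
Qed.

End good_path_LD.

(** * Almost sure bounds *)

Section rare_bounds.
Context {R : realType} {d : nat}.
Local Notation rV := (rVType R d).
Variable mu : probability rV R.
Local Notation rho := (rho mu 0%R).

Lemma small_multiple (c e : R) : 0 < e -> exists2 s : R, 0 < s <= 1 & s * `|c| <= e.
Proof.
move=> e0; have c1 : 0 < `|c| + 1 by rewrite ltr_wpDl.
exists (Num.min 1 (e / (`|c| + 1))).
  by rewrite lt_min ltr01 divr_gt0//= ge_min lexx.
set s := Num.min _ _; have : s <= e / (`|c| + 1) by rewrite ge_min lexx orbT.
have s0 : 0 <= s by rewrite le_min ler01 divr_ge0 ?ltW.
rewrite ler_pdivlMr//; lra.
Qed.

(** The tail condition is checked by the sign of [al]: an indicator never exceeds exp(al) >= 1, and
    for al < 0 the probability of the ball is small enough once s |l| <= e. *)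
Lemma count_upper_rare c r l (e : R) : is_rate mu c r l -> 0 < e ->
  rarely_fails mu (fun y => exists n0, forall n k, (n0 <= n)%N -> (0 < k)%N ->
    path_count y n k c r <= (n * k)%:R * expR (n%:R * (l + e))).
Proof.
move=> [_ [n1 hn1]]; apply: (upper_block_sums (g := fun n => \1_(nball c r n))).
- by move=> n; apply: measurable_indic; exact: measurable_nball.
- by move=> n y; rewrite indicE.
move=> {}e e0; have [s /andP[s0 s1] hs] := small_multiple l e0.
have sl : - e <= s * l.
  have : s * - `|l| <= s * l by apply: (ler_wpM2l (ltW s0)); rewrite lerNl -normrN ler_norm.
  lra.
exists s, n1; split; first by rewrite s0.
move=> n nn; split.
  have -> : Epsum mu n \1_(nball c r n) = ball_prob mu c r n.
    rewrite /ball_prob measure_integral_indic; last exact: measurable_psum_set (measurable_nball _ _ _).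
    by apply: eq_integral => x _; rewrite !indicE.
  apply: le_trans (hn1 n nn) _.
  by rewrite lee_fin ler_expR ler_wpM2l// lerDl ltW.
move=> al; have [al0|al0] := leP 0 al.
  rewrite (_ : [set x | _] = set0) ?measure0 ?lee_fin ?expR_ge0//.
  apply/seteqP; split => // x /=; rewrite indicE.
  have : 1 <= expR al by rewrite -expR0 ler_expR.
  by move=> h1 h2; have := le_lt_trans h1 h2; case: (_ \in _); rewrite ?ltxx ?ltr10.
apply: (@le_trans _ _ (ball_prob mu c r n)).
  apply: le_measure; rewrite ?inE.
  - apply: (measurable_ltr_set (measurable_cst _)); apply: measurableT_comp; last exact: measurable_psum.
    by apply: measurable_indic; exact: measurable_nball.
  - exact: measurable_psum_set (measurable_nball _ _ _).
  move=> x /=; rewrite indicE; case: (boolP (_ \in _)) => [/set_mem//|_].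
  by rewrite ltNge expR_ge0.
apply: le_trans (hn1 n nn) _; rewrite lee_fin ler_expR.
have : 0 <= n%:R * (s * l + e) by rewrite mulr_ge0//; lra.
have : (1 + s) * al <= 0 by rewrite pmulr_rle0 ?ltW//; lra.
lra.
Qed.

Lemma count_lower_rare c r l (e : R) : is_rate mu c r l -> 0 < e ->
  rarely_fails mu (fun y => exists n0, forall n k, (n0 <= n)%N -> (0 < k)%N ->
    expR (n%:R * (e - l)) <= k%:R ->
    (n * k)%:R * expR (n%:R * (l - e)) <= path_count y n k c r).
Proof.
move=> [lo _]; apply: (lower_block_counts (B := nball c r)) => //.
by move=> n; exact: measurable_nball.
Qed.

(** The moment of order 1 + s is the exponential moment at (1 + s) q. As [D] is open, a small s
    gives LL((1 + s) q) <= (1 + s) LL q + e. *)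
Lemma mgf_upper_rare D q (e : R) : open D ->
  (forall q, D q -> lne (mgf mu q) \is a fin_num) -> D q -> 0 < e ->
  rarely_fails mu (fun y => exists n0, forall n k, (n0 <= n)%N -> (0 < k)%N ->
    path_mgf y n k q <= (n * k)%:R * expR (n%:R * (log_mgf mu q + e))).
Proof.
move=> oD DL Dq; apply: (upper_block_sums (g := fun=> fun y => expR (dot q y))).
- by move=> n; exact: measurable_expR_dot.
- by move=> n y; exact: expR_ge0.
move=> {}e e0; have [C [s0 [C0 s00 hq]]] := LL_quadratic oD DL q Dq.
set m := dot q (mean_at mu q) in hq; set l := log_mgf mu q in hq *.
(* LL((1 + s) q) - (1 + s) LL q is at most s (m - l + C s), and s <= 1. *)
have [s1 /andP[s10 s11] hs1] := small_multiple (`|m| + `|l| + C) e0.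
pose s := Num.min s0 s1.
have s_gt0 : 0 < s by rewrite lt_min s00.
have ss0 : s <= s0 by rewrite ge_min lexx.
have ss1 : s <= s1 by rewrite ge_min lexx orbT.
have s_le1 : s <= 1 by exact: le_trans s11.
have [|Ds] := hq s; first by rewrite gtr0_norm.
have -> : q + s *: q = (1 + s) *: q by rewrite scalerDl scale1r.
move=> ls.
have {}Ds : D ((1 + s) *: q) by rewrite scalerDl scale1r.
have {}ls : log_mgf mu ((1 + s) *: q) <= (1 + s) * l + e.
  apply: (le_trans ls).
  have c0 : 0 <= `|m| + `|l| + C by rewrite !addr_ge0.
  have h1 : s * (`|m| + `|l| + C) <= e.
    by rewrite (ger0_norm c0) in hs1; apply: le_trans hs1; exact: ler_wpM2r.
  have h2 : s * m <= s * `|m| by apply: (ler_wpM2l (ltW s_gt0)); exact: ler_norm.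
  have h3 : s * - l <= s * `|l| by apply: (ler_wpM2l (ltW s_gt0)); rewrite -normrN ler_norm.
  have h4 : C * s ^+ 2 <= s * C by rewrite [leRHS]mulrC ler_wpM2l// expr2 ler_piMl// ltW.
  lra.
exists s, 0%N; split; first by rewrite s_gt0.
move=> n _; split.
  by rewrite (Epsum_expR DL n Dq) lee_fin ler_expR ler_wpM2l// lerDl ltW.
move=> al.
apply: le_trans (rho_Markov (f := fun y => expR (dot ((1 + s) *: q) y))
  (b := expR ((1 + s) * al)) (c := expR (n%:R * log_mgf mu ((1 + s) *: q))) _ _ _ _ _ _) _.
- exact: measurable_expR_dot.
- by move=> y; exact: expR_ge0.
- apply: (measurable_ltr_set (measurable_cst _)).
  exact: (measurableT_comp (measurable_expR_dot q) (measurable_psum n 0)).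
- exact: expR_gt0.
- by rewrite (Epsum_expR DL n Ds).
- move=> x /=; rewrite ltr_expR ler_expR dotZl => h.
  by apply: ler_wpM2l; [lra|exact: ltW].
rewrite -expRN -expRD lee_fin ler_expR lerD2r ler_wpM2l//.
Qed.

End rare_bounds.

Lemma ae_forall_countable d (T : measurableType d) (R : realType) (m : {measure set T -> \bar R})
    (I : countType) (Q : I -> T -> Prop) :
  (forall i, {ae m, forall x, Q i x}) -> {ae m, forall x, forall i, Q i x}.
Proof.
move=> H; pose Q' n x := if unpickle n is Some i then Q i x else True.
have : {ae m, forall x, forall n, Q' n x}.
  apply: ae_foralln => n; rewrite /Q'; case: unpickle => [i|]; first exact: H.
  exact: aeW.
by apply: filterS => x h i; have := h (pickle i); rewrite /Q' pickleK.
Qed.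

(** * Transfer to the Mandelbrot measure *)

Section main.
Context {disp : measure_display} {Omega : measurableType disp} {R : realType}.
Context (P : probability Omega R) {d : nat}.
Variable V : Omega -> offspringType R d.
Variables (N : seq nat -> Omega -> nat) (X : seq nat -> Omega -> 'rV[R]_d).
Variables (psi : seq nat -> Omega -> R) (nu : Omega -> {measure set rayType -> \bar R}).
Variable D : set 'rV[R]_d.
Hypothesis mV : measurable_fun setT V.
Hypothesis indW : independent_copies P V (family_at N X psi).
Hypothesis nuE : is_mandelbrot_measure P N psi nu.
Hypothesis EV1 : ('E_P[fun w => (\sum_(i < (V w).1) expR ((V w).2 i).2)%R] = 1)%E.
Local Notation mu := (letter_law mV EV1).

(** A ray outside the boundary lies in one of the countably many cylinders of words outside the
    tree, and these have mass 0. *)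
Lemma ae_boundary : {ae P, forall w, {ae nu w, forall t, boundary (N ^~ w) t}}.
Proof.
apply: filterS nuE => w nuw.
have : {ae nu w, forall t : rayType, forall u : seq nat, ~ tree (N ^~ w) u -> ~ cylinder u t}.
  apply: ae_forall_countable => u; have [tu|tu] := pselect (tree (N ^~ w) u); first exact: aeW.
  exists (cylinder u); split; first exact: measurable_cylinder.
    by rewrite nuw /mandelbrot_mass indicE memNset// !mul0r.
  move=> t /= /not_implyP[_]; exact: contrapT.
apply: filterS => t h n; apply: contrapT => /h; apply.
by rewrite /cylinder/= size_mkseq.
Qed.

Let nuS w := @filterS _ _ (ae_filter_ringOfSetsType (nu w)).
Let nuS2 w := @filterS2 _ _ (ae_filter_ringOfSetsType (nu w)).
Let nuS3 w := @filterS3 _ _ (ae_filter_ringOfSetsType (nu w)).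

Lemma rarely_fails_ae Q : rarely_fails mu Q ->
  {ae P, forall w, {ae nu w, forall t, Q (fun k => X (mkseq t k.+1) w)}}.
Proof.
move=> [h [A [mA sumA AQ]]].
apply: filterS (ray_Borel_Cantelli indW nuE mA sumA) => w.
move=> H; apply: (nuS _ H).
by move=> t [n0 hn0]; apply: AQ; exists n0 => n m; exact: hn0.
Qed.

Lemma Lambda_letter_law : Lambda P V = fun q => lne (mgf mu q).
Proof.
apply/funext => q; rewrite /Lambda /mgf; congr lne.
rewrite unlock integral_letter_measure; last 2 first.
- by apply/measurable_EFinP; exact: measurable_expR_dot.
- by move=> x; rewrite lee_fin expR_ge0.
apply: eq_integral => w _; rewrite -sumEFin; apply: eq_bigr => i _.
by rewrite addrC expRD EFinM.
Qed.

Hypothesis oD : open D.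
Hypothesis DL : forall q, D q -> Lambda P V q \is a fin_num.

Let DL' q : D q -> lne (mgf mu q) \is a fin_num.
Proof. by move=> /DL; rewrite Lambda_letter_law. Qed.

(** One instance of the pathwise bounds, with rational data and error 1 / (p + 1): countably many in
    all. *)
Let good p (I : 'rV[rat]_d * rat * {ffun 'I_d -> bool}) (y : pathType (rVType R d)) : Prop :=
  let a := ratv I.1.1 in let b := ratr I.1.2 in let e := p.+1%:R^-1 in
  [/\ D (a + b *: signs I.2) -> exists n0, forall n k, (n0 <= n)%N -> (0 < k)%N ->
        path_mgf y n k (a + b *: signs I.2) <=
          (n * k)%:R * expR (n%:R * (log_mgf mu (a + b *: signs I.2) + e)),
      forall l, is_rate mu a b l -> exists n0, forall n k, (n0 <= n)%N -> (0 < k)%N ->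
        path_count y n k a b <= (n * k)%:R * expR (n%:R * (l + e)) &
      forall l, is_rate mu a b l -> exists n0, forall n k, (n0 <= n)%N -> (0 < k)%N ->
        expR (n%:R * (e - l)) <= k%:R ->
        (n * k)%:R * expR (n%:R * (l - e)) <= path_count y n k a b].

Let ae_good : {ae P, forall w, {ae nu w, forall t, forall z,
  good z.1 z.2 (fun k => X (mkseq t k.+1) w)}}.
Proof.
suff : {ae P, forall w, forall z, {ae nu w, forall t,
    good z.1 z.2 (fun k => X (mkseq t k.+1) w)}}.
  by apply: filterS => w; exact: ae_forall_countable.
apply: ae_forall_countable => -[p [[a b] sg]] /=.
set e : R := p.+1%:R^-1; have e0 : 0 < e by rewrite invr_gt0.
pose v : 'rV[R]_d := ratv a + ratr b *: signs sg.
have h1 : {ae P, forall w, {ae nu w, forall t, D v -> exists n0, forall n k, (n0 <= n)%N -> (0 < k)%N ->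
    path_mgf (fun k => X (mkseq t k.+1) w) n k v <= (n * k)%:R * expR (n%:R * (log_mgf mu v + e))}}.
  have [Dv|Dv] := pselect (D v); last by apply: aeW => w; apply: aeW.
  apply: filterS (rarely_fails_ae (mgf_upper_rare oD DL' Dv e0)) => w.
  by apply: nuS => t ht _.
have [[l hl]|nl] := pselect (exists l, is_rate mu (ratv a) (ratr b) l); last first.
  apply: filterS h1 => w; apply: nuS => t ht; split => // l hl; case: nl; exists l; exact: hl.
(* The rate of a ball is unique, so one almost sure event per ball serves all real [l]. *)
have lE l' : is_rate mu (ratv a) (ratr b) l' -> l' = l.
  move=> hl'; apply: le_anti.
  by rewrite (le_rate hl' hl (@subset_refl _ _)) (le_rate hl hl' (@subset_refl _ _)).
have h2 := rarely_fails_ae (count_upper_rare hl e0).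
have h3 := rarely_fails_ae (count_lower_rare hl e0).
apply: filterS3 h1 h2 h3 => w; apply: nuS3 => t g1 g2 g3.
by split => // l' /lE ->.
Qed.

Let small_inverse (e : R) : 0 < e -> exists p : nat, p.+1%:R^-1 <= e.
Proof.
move=> e0; exists (Num.truncn e^-1); rewrite invf_ple ?posrE//.
by rewrite ltW// truncnS_gt.
Qed.

Lemma ae_level_set : D 0 -> {ae P, forall w, {ae nu w, forall t,
  level_set (N ^~ w) (X ^~ w) (beta P V) (Lambda P V) D t}}.
Proof.
move=> D0; apply: filterS2 ae_boundary ae_good => w; apply: nuS2 => t bt gt.
pose y : pathType (rVType R d) := fun k => X (mkseq t k.+1) w.
have wE : walk (X ^~ w) t = path_walk y by [].
have H1 (a : 'rV[rat]_d) (b : rat) sg : D (ratv a + ratr b *: signs sg) ->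
    mgf_upper mu y (ratv a + ratr b *: signs sg).
  move=> Dv e e0; have [p pe] := small_inverse e0.
  have [/(_ Dv)[n0 hn0] _ _] := gt (p, (a, b, sg)).
  exists n0 => n k nn k0; apply: le_trans (hn0 n k nn k0) _.
  by rewrite ler_wpM2l// ler_expR ler_wpM2l// lerD2l.
have H2 (a : 'rV[rat]_d) (b : rat) l : is_rate mu (ratv a) (ratr b) l ->
    count_upper y (ratv a) (ratr b) l.
  move=> hl e e0; have [p pe] := small_inverse e0.
  (* Any sign vector serves for the bounds on counts. *)
  have [_ /(_ _ hl)[n0 hn0] _] := gt (p, (a, b, [ffun=> true])).
  exists n0 => n k nn k0; apply: le_trans (hn0 n k nn k0) _.
  by rewrite ler_wpM2l// ler_expR ler_wpM2l// lerD2l.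
have H3 (a : 'rV[rat]_d) (b : rat) l : is_rate mu (ratv a) (ratr b) l ->
    count_lower y (ratv a) (ratr b) l.
  move=> hl e e0; have [p pe] := small_inverse e0.
  have [_ _ /(_ _ hl)[n0 hn0]] := gt (p, (a, b, [ffun=> true])).
  exists n0 => n k nn k0 hk; apply: le_trans (hn0 n k nn k0 _).
    by rewrite ler_wpM2l// ler_expR ler_wpM2l// lerD2l lerN2.
  by apply: le_trans hk; rewrite ler_expR ler_wpM2l// lerD2r.
split => //; rewrite wE.
  by rewrite /beta Lambda_letter_law; exact: (@good_path_mean _ _ mu D oD DL' y H1 D0).
by rewrite Lambda_letter_law; exact: (@good_path_LD _ _ mu D oD DL' y H1 H2 H3).
Qed.

End main.

Local Open Scope ereal_scope.

Theorem corollary1p1 (disp : measure_display) (Omega : measurableType disp)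
    (R : realType) (P : probability Omega R) (d : nat)
    (V : Omega -> offspringType R d)
    (N : seq nat -> Omega -> nat) (X : seq nat -> Omega -> 'rV[R]_d)
    (psi : seq nat -> Omega -> R)
    (nu : Omega -> {measure set rayType -> \bar R})
    (D : set 'rV[R]_d) :
  (1 <= d)%N ->
  measurable_fun setT V ->
  independent_copies P V (family_at N X psi) ->
  1 < 'E_P[fun w => ((V w).1)%:R] ->
  P [set w | (1 <= (V w).1)%N] = 1 ->
  is_mandelbrot_measure P N psi nu ->
  'E_P[fun w => (\sum_(i < (V w).1) expR ((V w).2 i).2)%R] = 1 ->
  'E_P[fun w => (\sum_(i < (V w).1) ((V w).2 i).2 * expR ((V w).2 i).2)%R] < 0 ->
  'E_P[fun w => ((\sum_(i < (V w).1) expR ((V w).2 i).2) *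
    Num.max 0 (ln (\sum_(i < (V w).1) expR ((V w).2 i).2)))%R] < +oo ->
  open D ->
  convex_set (D : set (convex_lmodType 'rV[R]_d)) ->
  D 0%R ->
  (forall lambda, D lambda -> Lambda P V lambda \is a fin_num) ->
  {ae P, forall w, {ae nu w, forall t, boundary (N ^~ w) t ->
    LD (Lambda P V) D (walk (X ^~ w) t)}} /\
  {ae P, forall w, {ae nu w, forall t,
    level_set (N ^~ w) (X ^~ w) (beta P V) (Lambda P V) D t}}.
Proof.
move=> _ mV indW _ _ nuE EV1 _ _ oD _ D0 DL.
have H := ae_level_set mV indW nuE EV1 oD DL D0; split => //.
apply: filterS H => w H; apply: (@filterS _ _ (ae_filter_ringOfSetsType (nu w)) _ _ _ H).
by move=> t [].
Qed.
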